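(* Let $c\in\mathbb{C}$ and $n\in\mathbb{Z}$, and let $\tau^{(n-1)}(x)$ and $\tau^{(n)}(x)$ be meromorphic functions on $H_{c+(n-1)\delta}$ and $H_{c+n\delta}$, respectively. Suppose that $\tau^{(n-1)}(x)\not\equiv 0$ and that the following two conditions are satisfied: (A1) $\tau^{(n-1)}(x)$ and $\tau^{(n)}(x)$ satisfy all the bilinear equations of type $(\mathrm{I})_{n-1/2}$. (A2) $\tau^{(n)}(x)$ satisfies all the bilinear equations of type $(\mathrm{II}_0)_{n}$. Then there exists a unique meromorphic function $\tau^{(n+1)}(x)$ on $H_{c+(n+1)\delta}$ such that (B) $\tau^{(n-1)}(x)$, $\tau^{(n)}(x)$, $\tau^{(n+1)}(x)$ satisfy all the bilinear equations of type $(\mathrm{II}_1)_{n}$. Furthermore, this $\tau^{(n+1)}(x)$ satisfies the following conditions: (C1) $\tau^{(n-1)}(x)$, $\tau^{(n)}(x)$, $\tau^{(n+1)}(x)$ satisfy all the bilinear equations of type $(\mathrm{II}_2)_{n}$. (C2) $\tau^{(n)}(x)$, $\tau^{(n+1)}(x)$ satisfy all the bilinear equations of type $(\mathrm{I})_{n+1/2}$. (C3) $\tau^{(n+1)}(x)$ satisfies all the bilinear equations of type $(\mathrm{II}_0)_{n+1}$.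
   Context: Let $V=\mathbb{C}^8$ with canonical basis $v_0,\ldots,v_7$ and the symmetric $\mathbb{C}$-bilinear form $(\cdot|\cdot)$ with $(v_i|v_j)=\delta_{ij}$. Put $\phi=\frac12(v_0+v_1+\cdots+v_7)$ and $P=\{a\in\mathbb{Z}^8\cup(\phi+\mathbb{Z}^8)\,:\,(\phi|a)\in\mathbb{Z}\}$ (the root lattice of type $E_8$). For $\kappa\in\mathbb{C}$ put $H_\kappa=\{x\in V: (\phi|x)=\kappa\}$. A $C_3$-frame is a set $\{\pm a_0,\pm a_1,\pm a_2\}\subset V$ of six vectors such that $(a_i|a_j)=\delta_{ij}$, $a_i\pm a_j\in P$ for $i<j$ and $2a_i\in P$ for all $i$. Fix a nonzero entire function $[z]$ of $z\in\mathbb{C}$ satisfying $[\beta\pm\gamma][z\pm\alpha]+[\gamma\pm\alpha][z\pm\beta]+[\alpha\pm\beta][z\pm\gamma]=0$ for all $z,\alpha,\beta,\gamma\in\mathbb{C}$, where $[\alpha\pm\beta]=[\alpha+\beta][\alpha-\beta]$. Let $\Omega=\{\omega\in\mathbb{C}:[\omega]=0\}$ and fix $\delta\in\mathbb{C}$, $\delta\neq0$, with $\mathbb{Z}\delta\cap\Omega=\{0\}$. Double signs denote products: $\tau(x\pm a\delta)=\tau(x+a\delta)\tau(x-a\delta)$ and $[(a\pm b|x)]=[(a+b|x)][(a-b|x)]$. For an integer $m$, and functions $\tau^{(k)}$ on $H_{c+k\delta}$, the bilinear equations are as follows. $(\mathrm{I})_{m+1/2}$: for every triple $a_0,a_1,a_2$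 such that $\{\pm a_0,\pm a_1,\pm a_2\}$ is a $C_3$-frame with $(\phi|a_0)=(\phi|a_1)=(\phi|a_2)=\frac12$, $$[(a_1\pm a_2|x)]\tau^{(m)}(x-a_0\delta)\tau^{(m+1)}(x+a_0\delta)+[(a_2\pm a_0|x)]\tau^{(m)}(x-a_1\delta)\tau^{(m+1)}(x+a_1\delta)+[(a_0\pm a_1|x)]\tau^{(m)}(x-a_2\delta)\tau^{(m+1)}(x+a_2\delta)=0$$ for $x\in H_{c+(m+1/2)\delta}$. $(\mathrm{II}_0)_m$: for every $C_3$-frame $\{\pm a_0,\pm a_1,\pm a_2\}$ with $(\phi|a_0)=(\phi|a_1)=(\phi|a_2)=0$, $$[(a_1\pm a_2|x)]\tau^{(m)}(x\pm a_0\delta)+[(a_2\pm a_0|x)]\tau^{(m)}(x\pm a_1\delta)+[(a_0\pm a_1|x)]\tau^{(m)}(x\pm a_2\delta)=0\quad(x\in H_{c+m\delta}).$$ $(\mathrm{II}_1)_m$: for every $C_3$-frame with $(\phi|a_0)=1$, $(\phi|a_1)=(\phi|a_2)=0$, $$[(a_1\pm a_2|x)]\tau^{(m-1)}(x-a_0\delta)\tau^{(m+1)}(x+a_0\delta)=[(a_0\pm a_2|x)]\tau^{(m)}(x\pm a_1\delta)-[(a_0\pm a_1|x)]\tau^{(m)}(x\pm a_2\delta)\quad(x\in H_{c+m\delta}).$$ $(\mathrm{II}_2)_m$: for every $C_3$-frame with $(\phi|a_0)=(\phi|a_1)=1$, $(\phi|a_2)=0$, $$[(a_1\pm a_2|x)]\tau^{(m-1)}(x-a_0\delta)\tau^{(m+1)}(x+a_0\delta)-[(a_0\pm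 a_2|x)]\tau^{(m-1)}(x-a_1\delta)\tau^{(m+1)}(x+a_1\delta)=[(a_1\pm a_0|x)]\tau^{(m)}(x\pm a_2\delta)\quad(x\in H_{c+m\delta}).$$ All equations are identities of meromorphic functions on the indicated hyperplanes. *)

(* Defs.v *)
From HB Require Import structures.
From mathcomp Require Import all_boot all_order all_algebra.
From mathcomp Require Import all_classical all_reals all_analysis.
From mathcomp.real_closed Require Export complex.

Set Implicit Arguments.
Unset Strict Implicit.
Unset Printing Implicit Defensive.

Import Order.TTheory GRing.Theory Num.Theory.
Import numFieldNormedType.Exports.

Local Open Scope classical_set_scope.
Local Open Scope ring_scope.

(* The base field K is instantiated with R[i], for R : realType, in the
   theorem; it is kept abstract here because the analysis library equips
   abstract numeric fields, but not R[i] itself, with their topology. *)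

(* Complex differentiability at each point of U, in the Fréchet sense; U is
   meant to be open. *)
Definition holomorphic_on (K : numClosedFieldType) (V : normedModType K)
  (U : set V) (g : V -> K) : Prop :=
  forall y, U y -> differentiable g y.

Definition entire (K : numClosedFieldType) (f : K -> K) : Prop :=
  holomorphic_on setT f.

(* A meromorphic function on K^d is locally a quotient g / h of holomorphic
   functions, where h vanishes identically on no nonempty open set. It is
   represented by a total function which agrees with g / h wherever h is
   nonzero; the values taken at the zeros of h are irrelevant, since
   meromorphic functions are only compared by [meq]. *)
Definition meromorphic (K : numClosedFieldType) (d : nat)
  (f : 'rV[K]_d -> K) : Prop :=
  forall p : 'rV[K]_d, exists (U : set 'rV[K]_d) (g h : 'rV[K]_d -> K),
    [/\ open_nbhs p U, holomorphic_on U g, holomorphic_on U h,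
        U `<=` closure [set y | h y != 0] &
        forall y, U y -> h y != 0 -> f y = g y / h y].

(* Equality of meromorphic functions: agreement on a dense open set. *)
Definition meq (K : numClosedFieldType) (d : nat)
  (f g : 'rV[K]_d -> K) : Prop :=
  exists D : set 'rV[K]_d,
    [/\ open D, dense D & forall y, D y -> f y = g y].

Definition dot (K : numClosedFieldType) (x y : 'rV[K]_8) : K :=
  \sum_(i < 8) x ord0 i * y ord0 i.

Definition phi (K : numClosedFieldType) : 'rV[K]_8 := const_mx 2%:R^-1.
Arguments phi {K}.

Definition hyperplane (K : numClosedFieldType) (kappa : K) : set 'rV[K]_8 :=
  [set x | dot phi x = kappa].

(* The first seven coordinates form a global affine chart of
   [hyperplane kappa], whose inverse is [param kappa]: the last coordinate is
   recovered from (x_0 + ... + x_7) / 2 = kappa. *)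
Definition param (K : numClosedFieldType) (kappa : K) (y : 'rV[K]_7) :
    'rV[K]_8 :=
  \row_(i < 8) if unlift ord_max i is Some j then y ord0 j
               else kappa *+ 2 - \sum_(j < 7) y ord0 j.

Lemma param_bij (K : numClosedFieldType) (kappa : K) :
  set_bij setT (hyperplane kappa) (param kappa).
Proof.
have dotE (x : 'rV[K]_8) : dot phi x = 2%:R^-1 * \sum_(i < 8) x ord0 i.
  by rewrite /dot mulr_sumr; apply: eq_bigr => i _; rewrite mxE.
have liftE (j : 'I_7) : widen_ord (leqnSn 7) j = lift ord_max j.
  by apply: val_inj; rewrite /= /bump leqNgt ltn_ord.
have n2 : (2%:R : K) != 0 by rewrite pnatr_eq0.
split.
- move=> y _; rewrite /hyperplane /= dotE big_ord_recr /= mxE unlift_none.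
  under eq_bigr => j _ do rewrite liftE mxE liftK.
  by rewrite addrC subrK -(mulr_natl kappa) mulrA mulVf // mul1r.
- move=> y z _ _ /rowP e; apply/rowP => j.
  by have := e (lift ord_max j); rewrite !mxE liftK.
- move=> x; rewrite /hyperplane /= dotE => hx.
  exists (\row_j x ord0 (lift ord_max j)) => //.
  apply/rowP => i; rewrite mxE; case: unliftP => [j ->|->]; first by rewrite mxE.
  rewrite -(mulr_natl kappa) -hx mulrA mulfV // mul1r big_ord_recr /=.
  under [X in _ - X]eq_bigr => j _ do rewrite mxE -liftE.
  by rewrite addrAC subrr add0r.
Qed.

(* A function on H_kappa is given by a function on the ambient space whose
   values off H_kappa are ignored. *)
Definition meromorphic_H (K : numClosedFieldType) (kappa : K)
  (f : 'rV[K]_8 -> K) : Prop := meromorphic (f \o param kappa).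

Definition meq_H (K : numClosedFieldType) (kappa : K)
  (f g : 'rV[K]_8 -> K) : Prop := meq (f \o param kappa) (g \o param kappa).

Definition Z8 (K : numClosedFieldType) : set 'rV[K]_8 :=
  [set a | forall i, exists k : int, a ord0 i = k%:~R].
Arguments Z8 {K}.

Definition latticeP (K : numClosedFieldType) : set 'rV[K]_8 :=
  [set a | (Z8 a \/ exists2 b, Z8 b & a = phi + b) /\
           exists k : int, dot phi a = k%:~R].
Arguments latticeP {K}.

(* {±a_0, ±a_1, ±a_2} is a C_3-frame; the conditions are invariant under
   permutations and sign changes of the a_i. *)
Definition C3_frame (K : numClosedFieldType) (a : 'I_3 -> 'rV[K]_8) : Prop :=
  [/\ forall i j : 'I_3, dot (a i) (a j) = (i == j)%:R,
      forall i j : 'I_3, (i < j)%N ->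
        latticeP (a i + a j) /\ latticeP (a i - a j) &
      forall i : 'I_3, latticeP (a i *+ 2)].

Definition triple (K : numClosedFieldType) (a0 a1 a2 : 'rV[K]_8)
  (i : 'I_3) : 'rV[K]_8 := tnth [tuple a0; a1; a2] i.

(* [alpha ± beta] *)
Definition brpm (K : numClosedFieldType) (br : K -> K) (alpha beta : K) : K :=
  br (alpha + beta) * br (alpha - beta).

(* [(a ± b | x)] *)
Definition brd (K : numClosedFieldType) (br : K -> K)
  (a b x : 'rV[K]_8) : K :=
  br (dot (a + b) x) * br (dot (a - b) x).

Definition three_term (K : numClosedFieldType) (br : K -> K) : Prop :=
  forall z alpha beta gamma : K,
    brpm br beta gamma * brpm br z alpha +
    brpm br gamma alpha * brpm br z beta +
    brpm br alpha beta * brpm br z gamma = 0.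

(* Below, f, g and h stand for tau^(m-1), tau^(m), tau^(m+1), as far as they
   occur, and the equation (I)_(m+1/2) is called [eqI] at m. *)

Definition eqI (K : numClosedFieldType) (br : K -> K) (delta c : K) (m : int)
  (g h : 'rV[K]_8 -> K) : Prop :=
  forall a0 a1 a2 : 'rV[K]_8, C3_frame (triple a0 a1 a2) ->
    dot phi a0 = 2%:R^-1 -> dot phi a1 = 2%:R^-1 -> dot phi a2 = 2%:R^-1 ->
    meq_H (c + (m%:~R + 2%:R^-1) * delta)
      (fun x =>
        brd br a1 a2 x * g (x - delta *: a0) * h (x + delta *: a0) +
        brd br a2 a0 x * g (x - delta *: a1) * h (x + delta *: a1) +
        brd br a0 a1 x * g (x - delta *: a2) * h (x + delta *: a2))
      (fun=> 0).

Definition eqII0 (K : numClosedFieldType) (br : K -> K) (delta c : K) (m : int)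
  (g : 'rV[K]_8 -> K) : Prop :=
  forall a0 a1 a2 : 'rV[K]_8, C3_frame (triple a0 a1 a2) ->
    dot phi a0 = 0 -> dot phi a1 = 0 -> dot phi a2 = 0 ->
    meq_H (c + m%:~R * delta)
      (fun x =>
        brd br a1 a2 x * (g (x + delta *: a0) * g (x - delta *: a0)) +
        brd br a2 a0 x * (g (x + delta *: a1) * g (x - delta *: a1)) +
        brd br a0 a1 x * (g (x + delta *: a2) * g (x - delta *: a2)))
      (fun=> 0).

Definition eqII1 (K : numClosedFieldType) (br : K -> K) (delta c : K) (m : int)
  (f g h : 'rV[K]_8 -> K) : Prop :=
  forall a0 a1 a2 : 'rV[K]_8, C3_frame (triple a0 a1 a2) ->
    dot phi a0 = 1 -> dot phi a1 = 0 -> dot phi a2 = 0 ->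
    meq_H (c + m%:~R * delta)
      (fun x => brd br a1 a2 x * f (x - delta *: a0) * h (x + delta *: a0))
      (fun x =>
        brd br a0 a2 x * (g (x + delta *: a1) * g (x - delta *: a1)) -
        brd br a0 a1 x * (g (x + delta *: a2) * g (x - delta *: a2))).

Definition eqII2 (K : numClosedFieldType) (br : K -> K) (delta c : K) (m : int)
  (f g h : 'rV[K]_8 -> K) : Prop :=
  forall a0 a1 a2 : 'rV[K]_8, C3_frame (triple a0 a1 a2) ->
    dot phi a0 = 1 -> dot phi a1 = 1 -> dot phi a2 = 0 ->
    meq_H (c + m%:~R * delta)
      (fun x =>
        brd br a1 a2 x * f (x - delta *: a0) * h (x + delta *: a0) -
        brd br a0 a2 x * f (x - delta *: a1) * h (x + delta *: a1))
      (fun x =>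
        brd br a1 a0 x * (g (x + delta *: a2) * g (x - delta *: a2))).

(* Main.v *)
Require Import Defs.
From HB Require Import structures.
From mathcomp Require Import all_boot all_order all_algebra.
From mathcomp Require Import all_classical all_reals all_analysis.
From mathcomp.real_closed Require Import complex.
From mathcomp Require Import ring lra zify.

Set Implicit Arguments.
Unset Strict Implicit.
Unset Printing Implicit Defensive.

Import Order.TTheory GRing.Theory Num.Theory.
Import numFieldNormedType.Exports.

Local Open Scope classical_set_scope.
Local Open Scope ring_scope.

(* Write f, g, h for tau^(n-1), tau^(n), tau^(n+1). A single equation (II_1), at
   one frame {±a, ±x, ±y}, can be solved for h(x + a delta) by division, since
   f and [(x ± y|.)] vanish identically on no open set; this gives uniqueness.
   By (II_0) for g and the three-term relation, the equation obtained does not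
   depend on the choice of x and y orthogonal to a. By two instances of (I) for
   f and g it implies the equation (II_1) at every b with (a|b) = 3/4, and any
   two admissible a, b are joined by a chain of such steps, so h satisfies all
   of (II_1). Each of (C1), (C2), (C3) is then a linear combination of instances
   of (II_1), and of (C2) in the case of (C3), on frames built from the given
   one, after multiplication by factors which are generically nonzero.

   The generic nonvanishing is the identity theorem for meromorphic functions.
   It is reduced to a statement on bounded holomorphic functions of one variable,
   which follows from a Goursat argument on dyadic sums over squares. *)

(** * Goursat's lemma and the identity theorem in one variable *)

Section ComplexDifferentiability.
Variable K : numFieldType.

(** The unit vectors [a] with 2a in P are the halves of the 2160 lattice vectors of square length 4.
    Modulo P they form 135 classes, each an orthonormal basis up to sign: congruent members have
    integral inner products because P is even, and that a class spans is verified by enumeration. A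
    C_3-frame is three members of one class; the auxiliary vectors used for elimination come from
    enlarging it inside its class.

    The vectors with (phi|a) = 1 are (phi + alpha)/2 for the 126 roots alpha orthogonal to phi (type
    E_7), and (a|b) = (2 + (alpha|beta))/4. So 3/4 means roots at 60 degrees, and the chains are
    paths among the roots of E_7.

    On the analytic side no integral is formed. Midpoint sums replace contour integrals: they are
    exactly additive under subdivision and exactly zero on affine functions. Cauchy's formula
    becomes an estimate with the crude constant 2, which is harmless because it is applied to g /
    w^n with n tending to infinity. *)

Definition cdiff (k : K -> K) (z : K) : Prop :=
  exists b : K, forall e : K, 0 < e -> exists2 d : K, 0 < d &
    forall w : K, `|w - z| < d -> `|k w - (k z + b * (w - z))| <= e * `|w - z|.

(** The epsilon-delta form mentions only the norm, so it makes sense at [R[i]]; this equivalence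
    transfers to it the usual rules of differentiation. *)
Lemma cdiffP (k : K -> K) (z : K) : cdiff k z <-> derivable k z 1.
Proof.
split=> [[b kb]|].
  apply/cvg_ex; exists b; apply/cvgrPdist_le => e e0.
  have [d d0 H] := kb e e0.
  near=> h.
  have h0 : h != 0 by near: h; exact: nbhs_dnbhs_neq.
  have hd : `|h| < d by near: h; exact: dnbhs0_lt.
  have -> : b - h^-1 *: ((k \o shift z) (h *: 1) - k z) =
      - ((k (h + z) - (k z + b * h)) / h).
    by rewrite /= [h *: 1]mulr1 /GRing.scale /=; field.
  rewrite normrN normf_div ler_pdivrMr ?normr_gt0 //.
  by have := H (h + z); rewrite addrK; apply.
move=> /cvg_ex[b /cvgrPdist_le H]; exists b => e /H.
move=> /nbhs_ballP[d d0 Hd]; exists d => // w wd.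
have [->|wz] := eqVneq w z; first by rewrite subrr mulr0 addr0 subrr normr0 mulr0.
have w0 : w - z != 0 by rewrite subr_eq0.
have := Hd (w - z); rewrite /ball /= sub0r normrN => /(_ wd w0).
rewrite [_ *: 1]mulr1 subrK => {}H.
rewrite -ler_pdivrMr; last by rewrite normr_gt0.
rewrite -normf_div -normrN; move: H; congr (`|_| <= _).
by rewrite /GRing.scale /=; field.
Unshelve. all: by end_near. Qed.

Lemma cdiff_cst (a z : K) : cdiff (fun=> a) z.
Proof. by apply/cdiffP; exact: derivable_cst. Qed.

Lemma cdiff_shift (a z : K) : cdiff (fun w => w + a) z.
Proof.
by apply/cdiffP; apply: derivableD; [exact: derivable_id | exact: derivable_cst].
Qed.

Lemma cdiffB (f g : K -> K) z : cdiff f z -> cdiff g z ->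
  cdiff (fun w => f w - g w) z.
Proof. by move=> /cdiffP fz /cdiffP gz; apply/cdiffP; exact: derivableB. Qed.

Lemma cdiffM (f g : K -> K) z : cdiff f z -> cdiff g z ->
  cdiff (fun w => f w * g w) z.
Proof. by move=> /cdiffP fz /cdiffP gz; apply/cdiffP; exact: derivableM. Qed.

Lemma cdiffV (f : K -> K) z : f z != 0 -> cdiff f z ->
  cdiff (fun w => (f w)^-1) z.
Proof. by move=> fz0 /cdiffP fz; apply/cdiffP; exact: derivableV. Qed.

Lemma cdiffX (f : K -> K) n z : cdiff f z -> cdiff (fun w => f w ^+ n) z.
Proof.
move=> fz; elim: n => [|n IH]; first exact: cdiff_cst.
have := cdiffM fz IH; congr cdiff; apply/funext => w; exact/esym/exprS.
Qed.

Lemma cdiff_comp_shift (f : K -> K) a z :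
  cdiff f (z + a) -> cdiff (fun w => f (w + a)) z.
Proof.
move=> [b Hb]; exists b => e /Hb[d d0 Hd]; exists d => // v vw.
by have := Hd (v + a); rewrite (_ : v + a - (z + a) = v - z); [exact | ring].
Qed.

End ComplexDifferentiability.

(** * Midpoint sums along segments and around squares *)

Section EdgeSum.
Variable K : numFieldType.
Implicit Types (k : K -> K) (z v : K).

(** The midpoint rule for the integral of [k] from [z] to [z + v], on 2^m equal pieces. Recursion on
    the two halves makes subdivision an identity rather than a limit. *)
Fixpoint edge_sum k m z v : K :=
  if m is m'.+1 then
    edge_sum k m' z (v / 2%:R) + edge_sum k m' (z + v / 2%:R) (v / 2%:R)
  else k (z + v / 2%:R) * v.

(** The midpoint rule is exact on affine functions; the subtracted term is their integral. *)
Lemma edge_sum_affine k m z v a b :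
  edge_sum (fun w => k w - (a + b * w)) m z v =
  edge_sum k m z v - (a + b * (z + v / 2%:R)) * v.
Proof.
elim: m z v => [|m IH] z v /=; first by rewrite mulrBl.
by rewrite !IH; field; rewrite ?pnatr_eq0.
Qed.

Lemma edge_sumB_scale k1 k2 c m z v :
  edge_sum (fun w => k1 w - c * k2 w) m z v =
  edge_sum k1 m z v - c * edge_sum k2 m z v.
Proof.
elim: m z v => [|m IH] z v /=; first by rewrite mulrBl mulrA.
by rewrite !IH; ring.
Qed.

(** [P x v] expresses that [x] is an admissible value for the edge [v]. Homogeneity and additivity
    carry such a bound from the sampled values to the sum; bounds on norms and on real parts are
    both of this kind. *)
Lemma edge_sum_closed (P : K -> K -> Prop) k m z v :
  (forall x v, P x v -> P (x / 2%:R) (v / 2%:R)) ->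
  (forall x y v, P x v -> P y v -> P (x + y) (v *+ 2)) ->
  (forall t, 0 <= t <= 1 -> P (k (z + t * v) * v) v) ->
  P (edge_sum k m z v) v.
Proof.
move=> Phalf Padd; elim: m z v => [|m IH] z v H /=.
  have := H 2%:R^-1; rewrite [_^-1 * v]mulrC; apply.
  by rewrite invr_ge0 ler0n invf_le1 ?ltr0n // ler1n.
have E : (v / 2%:R) *+ 2 = v by rewrite -mulr_natr divfK ?pnatr_eq0.
rewrite -[X in P _ X]E; apply: Padd; apply: IH => t /andP[t0 t1].
- rewrite (_ : t * (v / 2%:R) = t / 2%:R * v) ?mulrA; last by ring.
  apply/Phalf/H; rewrite divr_ge0 ?ler0n //= ler_pdivrMr ?ltr0n // mul1r.
  by rewrite (le_trans t1) // ler1n.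
- rewrite (_ : z + v / 2%:R + t * (v / 2%:R) = z + (1 + t) / 2%:R * v) ?mulrA; last by ring.
  apply/Phalf/H; rewrite divr_ge0 ?addr_ge0 ?ler0n ?ler01 //= ler_pdivrMr ?ltr0n // mul1r.
  by rewrite -[2%:R]/(1 + 1) lerD2l.
Qed.

Lemma edge_sum_le k m z v M :
  (forall t, 0 <= t <= 1 -> `|k (z + t * v)| <= M) ->
  `|edge_sum k m z v| <= M * `|v|.
Proof.
move=> H.
apply: (edge_sum_closed (P := fun x v => `|x| <= M * `|v|)).
- move=> x w xw; rewrite !normrM mulrA ler_wpM2r //.
- move=> x y w xw yw; apply: (le_trans (ler_normD _ _)).
  by rewrite normrMn mulrnAr mulr2n lerD.
- by move=> t t01; rewrite normrM ler_wpM2r // H.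
Qed.

Variable I : K.

(** The counterclockwise boundary sum, with [I] in the role of the imaginary unit. *)
Definition square_sum k m z s : K :=
  edge_sum k m z s + edge_sum k m (z + s) (I * s)
  - edge_sum k m (z + I * s) s - edge_sum k m z (I * s).

(** Each inner edge is shared by two quarters with opposite orientations, and each outer edge is by
    definition the sum of its halves one level lower. *)
Lemma square_sumS k m z s :
  square_sum k m.+1 z s =
  square_sum k m z (s / 2%:R) + square_sum k m (z + s / 2%:R) (s / 2%:R) +
  square_sum k m (z + I * (s / 2%:R)) (s / 2%:R) +
  square_sum k m (z + s / 2%:R + I * (s / 2%:R)) (s / 2%:R).
Proof.
have two0 : (2%:R : K) != 0 by rewrite pnatr_eq0.
have E : s / 2%:R + s / 2%:R = s by field.
rewrite /square_sum /= -!(mulrA I).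
rewrite (_ : z + s / 2%:R + I * (s / 2%:R) + s / 2%:R = z + s + I * (s / 2%:R)); last by field.
rewrite (_ : z + s / 2%:R + s / 2%:R = z + s); last by field.
rewrite (_ : z + s / 2%:R + I * (s / 2%:R) + I * (s / 2%:R) = z + I * s + s / 2%:R); last by field.
rewrite (_ : z + I * (s / 2%:R) + I * (s / 2%:R) = z + I * s); last by field.
rewrite (_ : z + I * (s / 2%:R) + s / 2%:R = z + s / 2%:R + I * (s / 2%:R)); last by ring.
by ring.
Qed.

Lemma square_sum_affine k m z s a b :
  square_sum (fun w => k w - (a + b * w)) m z s = square_sum k m z s.
Proof. by rewrite /square_sum !edge_sum_affine; field; rewrite ?pnatr_eq0. Qed.

Lemma square_sumB_scale k1 k2 c m z s :
  square_sum (fun w => k1 w - c * k2 w) m z s =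
  square_sum k1 m z s - c * square_sum k2 m z s.
Proof. by rewrite /square_sum !edge_sumB_scale; ring. Qed.

Lemma square_sum_le k m z s M : `|I| = 1 ->
  (forall t, 0 <= t <= 1 -> `|k (z + t * s)| <= M) ->
  (forall t, 0 <= t <= 1 -> `|k (z + s + t * (I * s))| <= M) ->
  (forall t, 0 <= t <= 1 -> `|k (z + I * s + t * s)| <= M) ->
  (forall t, 0 <= t <= 1 -> `|k (z + t * (I * s))| <= M) ->
  `|square_sum k m z s| <= M * `|s| *+ 4.
Proof.
move=> nI /(edge_sum_le m) H1 /(edge_sum_le m) H2 /(edge_sum_le m) H3
  /(edge_sum_le m) H4; rewrite normrM nI mul1r in H2 H4.
rewrite /square_sum 3!mulrSr mulr1n.
by do 2!(apply: (le_trans (ler_normB _ _)); apply: lerD => //);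
  apply: (le_trans (ler_normD _ _)); apply: lerD.
Qed.

End EdgeSum.

(** * Goursat's estimate and the vanishing principle over the complex numbers *)

Section Goursat.
Variable R : realType.
Local Notation C := R[i].
Local Notation Re := (@complex.Re R).
Local Notation Im := (@complex.Im R).

Lemma normc_gt0_real (e : C) : 0 < e -> exists2 r : R, e = r%:C%C & 0 < r.
Proof. by case: e => a b; rewrite ltcE /= => /andP[/eqP -> a0]; exists a. Qed.

Definition in_square (x y s : R) (w : C) : Prop :=
  [/\ x <= Re w, Re w <= x + s, y <= Im w & Im w <= y + s].

Lemma normc_le_ReIm (w : C) : `|w| <= (`|Re w| + `|Im w|)%:C%C.
Proof.
rewrite {1}[w]complexE (le_trans (ler_normD _ _)) // rmorphD lerD //.
  by rewrite normc_def /= expr0n addr0 sqrtr_sqr.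
rewrite normrM (_ : `|'i%C| = 1) ?mul1r; last first.
  by rewrite normc_def /= expr0n expr1n add0r sqrtr1.
by rewrite normc_def /= expr0n addr0 sqrtr_sqr.
Qed.

Lemma in_square_dist x y s w w' :
  in_square x y s w -> in_square x y s w' -> `|w - w'| <= (2%:R * s)%:C%C.
Proof.
case: w w' => [a b] [a' b'] [/= h1 h2 h3 h4] [/= h5 h6 h7 h8].
apply: le_trans (normc_le_ReIm _) _; rewrite lecR /=.
rewrite (_ : 2 * s = s + s); last by ring.
by rewrite lerD // ler_norml; apply/andP; split; lra.
Qed.

Definition square_boundary (x y s : R) (w : C) : Prop :=
  in_square x y s w /\
  [\/ Re w = x, Re w = x + s, Im w = y | Im w = y + s].

Lemma square_sum_bound k m x y s M : 0 <= s ->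
  (forall w, square_boundary x y s w -> `|k w| <= M%:C%C) ->
  `|square_sum 'i%C k m (x +i* y)%C s%:C%C| <= (4%:R * (M * s))%:C%C.
Proof.
move=> s0 H.
have ni : `|'i%C : C| = 1 by rewrite normc_def /= expr0n expr1n add0r sqrtr1.
have ns : `|s%:C%C : C| = s%:C%C.
  by rewrite normc_def /= expr0n addr0 sqrtr_sqr ger0_norm.
have aux (t : C) : 0 <= t <= 1 -> exists2 r : R, t = r%:C%C & 0 <= r <= 1.
  case: t => a b; rewrite !lecE /= => /andP[/andP[/eqP -> a0] /andP[_ a1]].
  by exists a => //; rewrite a0 a1.
rewrite mulr_natl rmorphMn rmorphM /= -{2}ns.
apply: square_sum_le => // t /aux[r -> /andP[r0 r1]]; apply: H;
  (split; [split; simpc => /=; nra|]).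
- by constructor 3; simpc.
- by constructor 2; simpc.
- by constructor 4; simpc.
- by constructor 1; simpc.
Qed.

(** Removing the affine approximation at [z] does not change the sum. The remainder is at most e/8
    times 2s on a boundary of length 4s, whatever the level [m]. *)
Lemma square_sum_cdiff k z (e : R) : 0 < e -> cdiff k z ->
  exists2 d, 0 < d & forall m x y s, 0 < s -> s < d -> in_square x y s z ->
    `|square_sum 'i%C k m (x +i* y)%C s%:C%C| <= (e * s ^+ 2)%:C%C.
Proof.
move=> e0 [b /(_ (e / 8%:R)%:C%C)[|_ /normc_gt0_real[d -> d0] H]].
  by rewrite ltcR divr_gt0 ?ltr0n.
exists (d / 2%:R) => [|m x y s s0 sd zQ]; first by rewrite divr_gt0 ?ltr0n.
rewrite -(square_sum_affine 'i%C k m _ _ (k z - b * z) b).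
apply: (le_trans (square_sum_bound (M := e / 8%:R * (2%:R * s)) _ _ _)).
- exact: ltW.
- move=> w [wQ _]; rewrite (_ : k w - _ = k w - (k z + b * (w - z))); last by ring.
  have wz := in_square_dist wQ zQ.
  apply: (le_trans (H _ _)).
    apply: le_lt_trans wz _; rewrite ltcR; lra.
  rewrite [leRHS]rmorphM ler_wpM2l // ler0c; apply: divr_ge0; rewrite ?ler0n //; exact: ltW.
- by rewrite lecR le_eqVlt; apply/orP; left; apply/eqP; field.
Qed.

(* An additive majorant of the area of the square, with a unit mass at the
   origin. *)
Definition punctured_area (x y s : R) : R :=
  (s + Num.sg (x + s) - Num.sg x) * (s + Num.sg (y + s) - Num.sg y).

Lemma punctured_areaS x y s :
  punctured_area x y s =
  punctured_area x y (s / 2%:R) + punctured_area (x + s / 2%:R) y (s / 2%:R) +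
  punctured_area x (y + s / 2%:R) (s / 2%:R) +
  punctured_area (x + s / 2%:R) (y + s / 2%:R) (s / 2%:R).
Proof.
rewrite /punctured_area.
have E u : u + s / 2%:R + s / 2%:R = u + s by field.
rewrite !E.
by field.
Qed.

Lemma sgr_incr (x s : R) : 0 <= s -> Num.sg x <= Num.sg (x + s).
Proof. by case: (sgrP x); case: (sgrP (x + s)); lra. Qed.

Lemma le_punctured_area x y s : 0 <= s -> s ^+ 2 <= punctured_area x y s.
Proof.
move=> s0; rewrite /punctured_area expr2.
by have := sgr_incr x s0; have := sgr_incr y s0; move=> *; apply: ler_pM => //; lra.
Qed.

(** Since [Num.sg] takes the value 0 at 0, its increment is at least 1 even when the origin is on
    the boundary of the closed square. *)
Lemma punctured_area_ge1 x y s : 0 < s -> in_square x y s 0 ->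
  1 <= punctured_area x y s.
Proof.
move=> s0 [/= x0 xs y0 ys]; rewrite /punctured_area.
have aux (u : R) : u <= 0 -> 0 <= u + s -> 1 <= s + Num.sg (u + s) - Num.sg u.
  by case: (sgrP u); case: (sgrP (u + s)); lra.
by have := aux _ x0 xs; have := aux _ y0 ys; move=> *; rewrite -[1]mulr1; apply: ler_pM; lra.
Qed.

(** A square violating [P] has a quarter violating it. The nested quarters shrink to a point, where
    the local hypothesis is contradicted. *)
Lemma bisection (P : R -> R -> R -> Prop) x y s : 0 < s ->
  (forall x y s, 0 < s ->
     P x y (s / 2%:R) -> P (x + s / 2%:R) y (s / 2%:R) ->
     P x (y + s / 2%:R) (s / 2%:R) ->
     P (x + s / 2%:R) (y + s / 2%:R) (s / 2%:R) -> P x y s) ->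
  (forall z, in_square x y s z -> exists2 d, 0 < d & forall x' y' s',
     0 < s' -> s' < d -> in_square x' y' s' z -> P x' y' s') ->
  P x y s.
Proof.
move=> s0 Psub Ploc; apply: contrapT => nP.
pose bad (q : R * R) (s : R) := ~ P q.1 q.2 s.
pose child (q q' : R * R) (s : R) :=
  (q'.1 = q.1 \/ q'.1 = q.1 + s / 2%:R) /\ (q'.2 = q.2 \/ q'.2 = q.2 + s / 2%:R).
have step q t : exists q', 0 < t -> bad q t -> bad q' (t / 2%:R) /\ child q q' t.
  have [t0|] := ltP 0 t; last by exists q.
  have [Pq|nPq] := pselect (P q.1 q.2 t); first by exists q.
  apply: contrapT => /forallNP H; apply: nPq; apply: Psub => //;
    apply: contrapT => nPq'; [apply: (H (q.1, q.2))|apply: (H (q.1 + t / 2%:R, q.2))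
      |apply: (H (q.1, q.2 + t / 2%:R))|apply: (H (q.1 + t / 2%:R, q.2 + t / 2%:R))];
    by move=> _ _; split => //; split => /=; tauto.
have [nxt nxtP] := choice (fun p => step p.1 p.2).
pose sd j := s / 2%:R ^+ j.
pose sq := fix sq j := if j is j'.+1 then nxt (sq j', sd j') else (x, y).
have sd0 j : 0 < sd j by rewrite divr_gt0 // exprn_gt0.
have sdS j : sd j.+1 = sd j / 2%:R by rewrite /sd exprSr invfM mulrA.
have sqbad j : bad (sq j) (sd j).
  elim: j => [|j IH]; first by rewrite /bad /sd expr0 divr1.
  by rewrite sdS; have [] := nxtP (sq j, sd j) (sd0 j) IH.
have sqch j : child (sq j) (sq j.+1) (sd j).
  by have [] := nxtP (sq j, sd j) (sd0 j) (sqbad j).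
(* The left ends increase and the right ends decrease, so the supremum of the left ends lies in
   every interval. *)
have limit (u : nat -> R) : (forall j, u j.+1 = u j \/ u j.+1 = u j + sd j / 2%:R) ->
    exists l, forall j, u j <= l /\ l <= u j + sd j.
  move=> H.
  have ulo j k : u j <= u (j + k)%N.
    elim: k => [|k IH]; first by rewrite addn0.
    by rewrite addnS; case: (H (j + k)%N) => ->; have := sd0 (j + k)%N; lra.
  have uhi j k : u (j + k)%N + sd (j + k)%N <= u j + sd j.
    elim: k => [|k IH]; first by rewrite addn0.
    by rewrite addnS sdS; case: (H (j + k)%N) => ->; have := sd0 (j + k)%N; lra.
  have ub j i : u i <= u j + sd j.
    have [ij|/ltnW ji] := leqP i j.
      by have := ulo i (j - i)%N; rewrite subnKC //; have := sd0 j; lra.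
    by have := uhi j (i - j)%N; rewrite subnKC //; have := sd0 i; lra.
  exists (sup (range u)) => j; split.
    by apply: ub_le_sup; [exists (u 0%N + sd 0%N) => _ [i _ <-]; exact: ub | exists j].
  by apply: ge_sup; [exists (u j), j | move=> _ [i _ <-]; exact: ub].
have [X HX] := limit _ (fun j => (sqch j).1).
have [Y HY] := limit _ (fun j => (sqch j).2).
have inQ j : in_square (sq j).1 (sq j).2 (sd j) (X +i* Y)%C.
  by have [] := HX j; have [] := HY j.
have [|d d0 Hd] := Ploc (X +i* Y)%C.
  by have := inQ 0%N; rewrite /sd expr0 divr1.
have [j jd] : exists j, sd j < d.
  have sd_gt0 : 0 < s^-1 * d by rewrite mulr_gt0 ?invr_gt0.
  have [j] := ltr_add_invr sd_gt0; rewrite add0r => Hj.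
  exists j; rewrite /sd mulrC -ltr_pdivlMr // mulrC.
  apply: le_lt_trans Hj; rewrite lef_pV2 ?posrE ?exprn_gt0 ?ltr0n //.
  by rewrite -natrX ler_nat ltn_expl.
exact: (sqbad j) (Hd _ _ _ (sd0 j) jd (inQ j)).
Qed.

(** Away from the origin differentiability bounds the sum by [e] times the area; at the origin only
    boundedness is known, and the unit mass of [punctured_area] absorbs the contribution of a small
    square. *)
Lemma goursat k x y s (B r e : R) : 0 < s -> 0 < r -> 0 < e ->
  (forall w, in_square x y s w -> w != 0 -> cdiff k w) ->
  (forall w, `|w| < r%:C%C -> `|k w| <= B%:C%C) ->
  exists N, forall m, (N <= m)%N ->
    `|square_sum 'i%C k m (x +i* y)%C s%:C%C| <= (e * punctured_area x y s)%:C%C.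
Proof.
move=> s0 r0 e0 kd kB.
have B0 : 0 <= B.
  by have := kB 0; rewrite normr0 ltcR => /(_ r0) /(le_trans (normr_ge0 _)); rewrite ler0c.
apply: (bisection (P := fun x y s => exists N, forall m, (N <= m)%N ->
  `|square_sum 'i%C k m (x +i* y)%C s%:C%C| <= (e * punctured_area x y s)%:C%C)) s0 _ _.
- move=> {kd}x {}y {}s s0 [N1 H1] [N2 H2] [N3 H3] [N4 H4].
  (* One more than the maximum, because a square at level [m.+1] is made of its quarters at level
     [m]. *)
  exists (maxn (maxn N1 N2) (maxn N3 N4)).+1 => -[//|m]; rewrite ltnS !geq_max.
  move=> /andP[/andP[/H1 {}H1 /H2 {}H2] /andP[/H3 {}H3 /H4 {}H4]].
  rewrite square_sumS punctured_areaS.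
  have E : s%:C%C / 2%:R = (s / 2%:R)%:C%C :> C by rewrite rmorphM fmorphV rmorph_nat.
  rewrite !E -[Complex x y + _]/(Complex (x + s / 2%:R) (y + 0)).
  rewrite (_ : Complex x y + _ * _ = Complex x (y + s / 2%:R)); last by simpc.
  rewrite (_ : Complex _ _ + _ * _ = Complex (x + s / 2%:R) (y + s / 2%:R)); last by simpc.
  rewrite addr0 !mulrDr !rmorphD.
  by do 3!(apply: (le_trans (ler_normD _ _)); apply: lerD => //).
- move=> z zQ; have [->|zn0] := eqVneq z 0.
    (* A side below r/2 keeps the square where [k] is bounded by [B]; a side below e/(4B + 1) makes
       the trivial bound 4Bs at most [e]. *)
    exists (Num.min (r / 2%:R) (e / (4%:R * B + 1))) => [|x' y' s' s'0].
      by rewrite lt_min !divr_gt0 //; lra.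
    rewrite lt_min => /andP[sr se] zQ'; exists 0%N => m _.
    apply: (le_trans (square_sum_bound (M := B) _ (ltW s'0) _)).
      move=> w [wQ _]; apply: kB; have := in_square_dist wQ zQ'; rewrite subr0.
      by move=> /le_lt_trans; apply; rewrite ltcR; lra.
    rewrite lecR; move: se; rewrite ltr_pdivlMr; last by lra.
    have := punctured_area_ge1 s'0 zQ'; nra.
  have [d d0 H] := square_sum_cdiff e0 (kd z zQ zn0).
  exists d => // x' y' s' s'0 s'd zQ'; exists 0%N => m _.
  apply: (le_trans (H _ _ _ _ s'0 s'd zQ')); rewrite lecR ler_pM2l //.
  exact/le_punctured_area/ltW.
Qed.

Lemma edge_sum_Re (k : C -> C) m z v a b :
  (forall t, 0 <= t <= 1 -> Re (a * v) <= Re (b * (k (z + t%:C%C * v) * v))) ->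
  Re (a * v) <= Re (b * edge_sum k m z v).
Proof.
move=> H; apply: (edge_sum_closed (P := fun x v => Re (a * v) <= Re (b * x))).
- have halfE (c u : C) : Re (c * (u / 2%:R)) = Re (c * u) / 2%:R.
    rewrite mulrA (_ : 2%:R^-1 = (2%:R^-1)%:C%C); last by rewrite fmorphV rmorph_nat.
    by case: (c * u) => p q; simpc.
  by move=> x w; rewrite !halfE; lra.
- move=> x y w; rewrite mulr2n !mulrDr.
  by case: (b * x) (b * y) (a * w) => [? ?] [? ?] [? ?]; simpc => /=; lra.
- case=> t t'; rewrite !lecE /= => /andP[/andP[/eqP -> t0] /andP[_ t1]].
  by apply: H; rewrite t0 t1.
Qed.

(** The integral is 2 pi i, but a lower bound by 4 suffices. On each edge the relevant component of
    1/w is s/|w|^2 with |w|^2 at most 2s^2, hence at least 1/(2s) over a length 2s. *)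
Lemma square_sum_inv_ge m (s : R) : 0 < s ->
  4%:R <= Im (square_sum 'i%C (fun w => w^-1) m ((- s) +i* (- s))%C (2%:R * s)%:C%C).
Proof.
move=> s0; rewrite /square_sum.
set e1 := edge_sum _ _ _ _; set e2 := edge_sum _ _ _ _.
set e3 := edge_sum _ _ _ _; set e4 := edge_sum _ _ _ _.
have s2 : 2%:R * s != 0 by rewrite mulf_neq0 ?pnatr_eq0 // gt_eqF.
have key (u : R) : 0 <= u <= 1 ->
    1 <= 2%:R * s * (s / (s ^+ 2 + (2%:R * s * u - s) ^+ 2)).
  move=> /andP[u0 u1]; rewrite mulrA ler_pdivlMr ?mul1r; last nra.
  have : 0 <= s * s * (u * (1 - u)) by rewrite !mulr_ge0 ?subr_ge0 // ltW.
  lra.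
have E1 : 1 <= Im e1.
  have := @edge_sum_Re (fun w => w^-1) m ((- s) +i* (- s))%C (2%:R * s)%:C%C
     (((2%:R * s)^-1)%:C%C) (- 'i%C).
  rewrite -/e1 -rmorphM mulVf //.
  have -> : Re (- 'i%C * e1) = Im e1 by case: (e1) => p q; simpc.
  apply => t t01; simpc => /=.
  rewrite [leRHS](_ : _ = 2%:R * s * (s / (s ^+ 2 + (2%:R * s * t - s) ^+ 2))) ?key //.
  by rewrite mulrC; congr (_ * (_ / _)); ring.
have E2 : 1 <= Im e2.
  have := @edge_sum_Re (fun w => w^-1) m (((- s) +i* (- s)) + (2%:R * s)%:C)%C
     ('i%C * (2%:R * s)%:C%C) (- 'i%C * ((2%:R * s)^-1)%:C%C) (- 'i%C).
  rewrite -/e2.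
  have -> : Re (- 'i%C * e2) = Im e2 by case: (e2) => p q; simpc.
  simpc; rewrite mulVf //.
  apply => t t01; simpc => /=.
  rewrite [leRHS](_ : _ = 2%:R * s * (s / (s ^+ 2 + (2%:R * s * t - s) ^+ 2))) ?key //.
  by rewrite mulrC; congr (_ * (_ / _)); ring.
have E3 : Im e3 <= - 1.
  have := @edge_sum_Re (fun w => w^-1) m (((- s) +i* (- s)) + 'i * (2%:R * s)%:C)%C (2%:R * s)%:C%C
     (((2%:R * s)^-1)%:C%C) ('i%C).
  rewrite -/e3 -rmorphM mulVf // lerNr.
  have -> : Re ('i%C * e3) = - Im e3 by case: (e3) => p q; simpc.
  apply => t t01; simpc => /=.
  rewrite [leRHS](_ : _ = 2%:R * s * (s / (s ^+ 2 + (2%:R * s * t - s) ^+ 2))) ?key //.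
  by rewrite mulrC; congr (_ * (_ / _)); ring.
have E4 : Im e4 <= - 1.
  have := @edge_sum_Re (fun w => w^-1) m (((- s) +i* (- s)))%C
     ('i%C * (2%:R * s)%:C%C) (- 'i%C * ((2%:R * s)^-1)%:C%C) ('i%C).
  rewrite -/e4 lerNr.
  have -> : Re ('i%C * e4) = - Im e4 by case: (e4) => p q; simpc.
  simpc; rewrite mulVf //.
  apply => t t01; simpc => /=.
  rewrite [leRHS](_ : _ = 2%:R * s * (s / (s ^+ 2 + (2%:R * s * t - s) ^+ 2))) ?key //.
  by rewrite mulrC; congr (_ * (_ / _)); ring.
case: (e1) (e2) (e3) (e4) E1 E2 E3 E4 => [? ?] [? ?] [? ?] [? ?] /=; simpc => /=; lra.
Qed.


Lemma normc_ge_Im (w : C) : (`|Im w|)%:C%C <= `|w|.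
Proof.
rewrite normc_def lecR -sqrtr_sqr ler_sqrt ?addr_ge0 ?sqr_ge0 //.
by rewrite lerDr sqr_ge0.
Qed.

Lemma normcE_real (w : C) : exists2 r : R, `|w| = r%:C%C & 0 <= r.
Proof. by exists (Num.sqrt (Re w ^+ 2 + Im w ^+ 2)); [exact: normc_def | exact: sqrtr_ge0]. Qed.

Lemma square_boundary_norm (s : R) w : 0 < s ->
  square_boundary (- s) (- s) (2%:R * s) w -> s%:C%C <= `|w|.
Proof.
move=> s0 [_ H].
have ns : `|- s| = s by rewrite normrN gtr0_norm.
have ns' : `|- s + 2%:R * s| = s by rewrite gtr0_norm //; lra.
have := normc_ge_Re w; have := normc_ge_Im w.
by case: H => -> ; rewrite ?ns ?ns'.
Qed.

(** The function (g w - g 0)/w is bounded near the origin and differentiable elsewhere, so its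
    boundary sums become arbitrarily small. Hence |g 0| times a number at least 4 is almost bounded
    by the sum of g w/w, which is at most 8M. *)
Lemma cauchy_bound (g : C -> C) (s M : R) : 0 < s ->
  (forall w, in_square (- s) (- s) (2%:R * s) w -> cdiff g w) ->
  (forall w, square_boundary (- s) (- s) (2%:R * s) w -> `|g w| <= M%:C%C) ->
  `|g 0| <= (2%:R * M)%:C%C.
Proof.
move=> s0 gd gM.
pose k (w : C) := g w / w - g 0 * w^-1.
have kd w : in_square (- s) (- s) (2%:R * s) w -> w != 0 -> cdiff k w.
  move=> wQ w0; apply: cdiffB; apply: cdiffM; [exact: gd | | exact: cdiff_cst |];
    by apply: cdiffV w0 _; apply/cdiffP; exact: derivable_id.
have [b Hb] := gd 0 ltac:(by split => /=; lra).
have [_ /normc_gt0_real[r -> r0] Hr] := Hb 1 ltr01.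
have [B EB B0] := normcE_real b.
have kB w : `|w| < r%:C%C -> `|k w| <= (B + 1)%:C%C.
  move=> wr; have [->|w0] := eqVneq w 0.
    by rewrite /k invr0 !mulr0 subrr normr0 ler0c; lra.
  rewrite /k -mulrBl normf_div ler_pdivrMr ?normr_gt0 //.
  have := Hr w; rewrite subr0 => /(_ wr); rewrite mul1r => H.
  rewrite (_ : g w - g 0 = g w - (g 0 + b * w) + b * w); last by ring.
  apply: (le_trans (ler_normD _ _)); rewrite normrM EB rmorphD mulrDl mul1r addrC.
  exact: lerD.
have [a Ea a0] := normcE_real (g 0).
rewrite Ea lecR; apply: contrapT => /negP; rewrite -ltNge => Ma.
pose nu := punctured_area (- s) (- s) (2%:R * s).
have nu0 : 0 < nu.
  by apply: lt_le_trans (punctured_area_ge1 _ _) => //; [lra | split => /=; lra].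
(* Half of the gap between 4a and 8M, so an error of [e] cannot close it. *)
pose e := (4%:R * a - 8%:R * M) / 2%:R.
have e0 : 0 < e by rewrite divr_gt0 ?ltr0n //; lra.
have s20 : 0 < 2%:R * s by lra.
have [N /(_ N (leqnn _))] := goursat s20 r0 (divr_gt0 e0 nu0) kd kB.
rewrite -/nu divfK ?gt_eqF // square_sumB_scale => H.
have S1 : `|square_sum 'i%C (fun w => g w / w) N ((- s) +i* (- s))%C (2%:R * s)%:C%C|
     <= (8%:R * M)%:C%C.
  apply: le_trans (square_sum_bound (M := M / s) N (ltW s20) _) _.
    move=> w wQ; have sw := square_boundary_norm s0 wQ.
    have w0 : 0 < `|w| by apply: lt_le_trans sw; rewrite ltcR.
    rewrite normf_div ler_pdivrMr // (le_trans (gM w wQ)) //.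
    have M0 : 0 <= M by have := le_trans (normr_ge0 _) (gM w wQ); rewrite ler0c.
    have -> : M%:C%C = (M / s)%:C%C * s%:C%C :> C by rewrite -rmorphM divfK ?gt_eqF.
    by rewrite ler_wpM2l // ler0c divr_ge0 // ltW.
  by rewrite lecR le_eqVlt; apply/orP; left; apply/eqP; field; rewrite gt_eqF.
have S2 := square_sum_inv_ge N s0.
set S := square_sum _ (fun w => w^-1) _ _ _ in H S2.
have [t Et t0] := normcE_real S.
have t4 : 4%:R <= t.
  have := normc_ge_Im S; rewrite Et lecR; apply: le_trans; apply: le_trans (ler_norm _).
  exact: S2.
have : (a * t)%:C%C <= (8%:R * M + e)%:C%C :> C.
  rewrite [leLHS]rmorphM /= -Ea -Et -normrM [leRHS]rmorphD.
  set T := square_sum _ _ _ _ _ in H S1.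
  rewrite (_ : g 0 * S = T - (T - g 0 * S)); last by ring.
  by apply: (le_trans (ler_normB _ _)); apply: lerD.
rewrite lecR /e; nra.
Qed.

(* The maximum bound is applied to [g w / w ^+ n] on a square centred at [1] whose
   boundary lies in [2 <= `|w|], and [n] tends to infinity; dividing is harmless
   at the origin, which lies inside the square, because [g] vanishes near it. *)
Lemma vanish_at1 (g : C -> C) (M : R) :
  (forall w, `|w| < 6%:R -> cdiff g w) ->
  (forall w, `|w| < 6%:R -> `|g w| <= M%:C%C) ->
  (exists2 r : C, 0 < r & forall w, `|w| < r -> g w = 0) ->
  g 1 = 0.
Proof.
move=> gd gM [r r0 gr].
have M0 : 0 <= M.
  by have := gM 0; rewrite normr0 ltr0n => /(_ isT) /(le_trans (normr_ge0 _)); rewrite ler0c.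
(* Shifted by 1, the square lies in the disc of radius |4 + 3i| = 5; this is why the functions are
   taken on the disc of radius 6. *)
have near6 (w : C) : in_square (- 3%:R) (- 3%:R) (2%:R * 3%:R) w -> `|w + 1| < 6%:R.
  case: w => x y [/= *]; rewrite normc_def (_ : 6%:R = 6%:R%:C%C); last by rewrite rmorph_nat.
  rewrite ltcR /= -(ger0_norm (ler0n _ 6)) -sqrtr_sqr ltr_sqrt; last by rewrite exprn_gt0 ?ltr0n.
  by simpc => /=; nra.
have bound n : `|g 1| <= (2%:R * (M / 2%:R ^+ n.+1))%:C%C.
  pose h (w : C) := g (w + 1) / (w + 1) ^+ n.+1.
  have -> : g 1 = h 0 by rewrite /h add0r expr1n divr1.
  apply: (@cauchy_bound h 3%:R) => [|w wQ|w wQ]; first by rewrite ltr0n.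
  - have w6 := near6 w wQ.
    have [w1|w1] := eqVneq (w + 1) 0.
      exists 0 => e e0; exists r => // v vr.
      have E : v - w = v + 1 by rewrite (_ : w = -1) ?opprK //; apply/eqP; rewrite -addr_eq0 w1.
      rewrite /h (gr (v + 1)) -?E // w1 gr ?normr0 //.
      by rewrite !mul0r addr0 subr0 normr0 mulr_ge0 // ltW.
    apply: cdiffM; first by apply: cdiff_comp_shift; exact: gd.
    apply: cdiffV; first by rewrite expf_neq0.
    by apply: cdiffX; exact: cdiff_shift.
  - have w6 := near6 w wQ.1.
    have w2 : 2%:R <= `|w + 1|.
      have : 3%:R <= `|w|.
        by have := square_boundary_norm _ wQ; rewrite rmorph_nat; apply; rewrite ltr0n.
      move=> w3; rewrite -(lerD2r 1) (_ : 2%:R + 1 = 3%:R); last by ring.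
      by have := ler_normB (w + 1) 1; rewrite addrK normr1; exact: le_trans.
    have w0 : 0 < `|w + 1| by apply: lt_le_trans w2; rewrite ltr0n.
    rewrite /h normf_div normrX ler_pdivrMr ?exprn_gt0 // (le_trans (gM _ w6)) //.
    have -> : M%:C%C = (M / 2%:R ^+ n.+1)%:C%C * 2%:R ^+ n.+1 :> C.
      have two : 2%:R ^+ n.+1 != 0 :> R by rewrite expf_neq0 // pnatr_eq0.
      rewrite -[in LHS](divfK two M) [LHS]rmorphM /=; congr (_ * _).
      by rewrite rmorphXn /= rmorph_nat.
    rewrite ler_wpM2l ?ler0c ?divr_ge0 ?exprn_ge0 ?ler0n //.
    by rewrite lerXn2r // nnegrE ?ler0n // ltW.
apply/eqP; rewrite -normr_eq0; have [a Ea a0] := normcE_real (g 1).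
rewrite Ea in bound *; rewrite -(rmorph0 (real_complex R)) (inj_eq (@complexI R)) eq_le a0 andbT.
rewrite leNgt; apply/negP => {}a0.
have := archi_boundP (divr_ge0 (mulr_ge0 (ler0n R 2) M0) (ltW a0)).
set n := Num.bound _; rewrite ltr_pdivrMr //.
have := bound n; rewrite lecR mulrA ler_pdivlMr ?exprn_gt0 ?ltr0n // => b1 b2.
have : (n%:R : R) <= 2%:R ^+ n.+1.
  by rewrite -natrX ler_nat (leq_trans (leqnSn n)) // ltnW // ltn_expl.
nra.
Qed.

End Goursat.

(* The properties of the complex numbers on which the rest relies, stated
   without topology because R[i] has no canonical one. *)
Definition vanishing_principle (K : numFieldType) : Prop :=
  forall (g : K -> K) (M : K),
    (forall w, `|w| < 6%:R -> cdiff g w) ->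
    (forall w, `|w| < 6%:R -> `|g w| <= M) ->
    (exists2 r : K, 0 < r & forall w, `|w| < r -> g w = 0) ->
    g 1 = 0.

Definition unit_interval_connected (K : numFieldType) : Prop :=
  forall A : K -> Prop,
    (forall t, 0 <= t <= 1 -> exists2 e : K, 0 < e & forall u v,
       0 <= u <= 1 -> 0 <= v <= 1 -> `|u - t| < e -> `|v - t| < e ->
       A u -> A v) ->
    A 0 -> A 1.

Lemma complex_vanishing (R : realType) : vanishing_principle R[i].
Proof.
move=> g M gd gM; have [r Er r0] := normcE_real M.
apply: (@vanish_at1 R g r) => // w w6.
have M0 : 0 <= M := le_trans (normr_ge0 (g w)) (gM w w6).
by rewrite -Er (ger0_norm M0); exact: gM.
Qed.

(** For the set [T] of all t such that [A] holds on [0, t], local constancy of [A] at the supremum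
    of [T] carries [A] past it, unless 1 has been passed. *)
Lemma complex_unit_interval_connected (R : realType) : unit_interval_connected R[i].
Proof.
move=> A Aloc A0; pose toC (r : R) : R[i] := r%:C%C.
pose T := [set t : R | 0 <= t <= 1 /\ forall u, 0 <= u <= t -> A (toC u)].
have le01 (t : R) : 0 <= t <= 1 -> 0 <= toC t <= 1.
  by move=> /andP[t0 t1]; rewrite ler0c t0 -(rmorph1 (real_complex R)) lecR.
have loc (t : R) : 0 <= t <= 1 -> exists2 e : R, 0 < e & forall u v,
    0 <= u <= 1 -> 0 <= v <= 1 -> `|u - t| < e -> `|v - t| < e ->
    A (toC u) -> A (toC v).
  move=> t01; have [_ /normc_gt0_real[e -> e0] H] := Aloc (toC t) (le01 t t01).
  have nE (w : R) : `|toC w - toC t| = toC (`|w - t|).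
    by rewrite -rmorphB normc_def /= expr0n addr0 sqrtr_sqr.
  exists e => // u v u01 v01 ut vt.
  by apply: H; rewrite ?le01 // nE ltcR.
have T0 : T 0.
  split; first by rewrite lexx ler01.
  by move=> u; rewrite -eq_le => /eqP <-.
have Tub : ubound T 1 by move=> t [/andP[]].
have supT : has_sup T by split; [exists 0 | exists 1].
have s01 : 0 <= sup T <= 1.
  by rewrite ub_le_sup //= ?ge_sup //; [exists 0 | exists 1].
have [e e0 He] := loc _ s01.
have [t Tt st] := sup_adherent e0 supT.
have tsup : t <= sup T by apply: ub_le_sup => //; exists 1.
have [/andP[t0 t1] At] := Tt.
have near_t : `|t - sup T| < e by rewrite distrC ger0_norm ?subr_ge0 //; lra.
have upto v : 0 <= v <= 1 -> v < sup T + e -> A (toC v).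
  move=> /andP[v0 v1] vs; have [vt|tv] := leP v t; first by apply: At; rewrite v0.
  apply: (He t) => //; rewrite ?t0 ?v0 //; last by apply: At; rewrite t0 /=.
  by rewrite ltr_norml; lra.
suff : 1 < sup T + e by move=> H; have := upto 1; rewrite ler01 lexx => /(_ isT H).
rewrite ltNge; apply/negP => H.
have : T (sup T + e / 2%:R).
  split; first by lra.
  by move=> u /andP[u0 us]; apply: upto; rewrite ?u0 //=; lra.
move=> /ub_le_sup => /(_ (ex_intro _ 1 Tub)); lra.
Qed.

Lemma cdiff_line (K : numFieldType) (V : normedModType K) (g : V -> K) z v t :
  differentiable g (z + t *: v) -> cdiff (fun t => g (z + t *: v)) t.
Proof.
move=> /(@diff_derivable _ _ _ _ _ v) H; apply/cdiffP.
move: H; rewrite /derivable.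
rewrite (_ : (fun h : K => h^-1 *: ((g \o shift (z + t *: v)) (h *: v) - _)) =
  (fun h : K => h^-1 *: (((fun t => g (z + t *: v)) \o shift t) (h *: 1) - g (z + t *: v)))) //.
by apply/funext => h /=; rewrite [h *: 1]mulr1 scalerDl addrCA addrA.
Qed.

(** * Meromorphic functions *)

Section Meromorphic.
Variable K : numClosedFieldType.
Hypothesis vanishing : vanishing_principle K.
Hypothesis connected01 : unit_interval_connected K.
Variable d : nat.
Local Notation V := 'rV[K]_d.
Implicit Types (f g h : V -> K) (p z : V).

(** The line through [z] and [q] is parametrised with [q] at 1. For |t| < 6 its points are within
    rho/20 + 6 rho/10 < rho of [p], whence the factor 20. *)
Lemma holomorphic_vanish g p (rho M : K) : 0 < rho ->
  (forall y, `|y - p| < rho -> differentiable g y) ->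
  (forall y, `|y - p| < rho -> `|g y| <= M) ->
  forall z, `|z - p| < rho / 20%:R -> (\forall y \near z, g y = 0) ->
  forall q, `|q - p| < rho / 20%:R -> g q = 0.
Proof.
move=> rho0 gd gM z zp /nbhs_ballP[r r0 gr] q qp.
pose v := q - z.
have vz : `|v| < rho / 10%:R.
  rewrite (_ : rho / 10%:R = rho / 20%:R + rho / 20%:R); last by field.
  rewrite /v (_ : q - z = (q - p) - (z - p)); last by rewrite opprB addrA subrK.
  by rewrite (le_lt_trans (ler_normB _ _)) // ltrD.
have inball (t : K) : `|t| < 6%:R -> `|z + t *: v - p| < rho.
  move=> t6; rewrite addrAC (le_lt_trans (ler_normD _ _)) // normrZ.
  have : `|t| * `|v| <= 6%:R * (rho / 10%:R) by rewrite ler_pM // ltW.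
  move=> /(ltr_leD zp) /lt_le_trans; apply.
  rewrite (_ : rho / 20%:R + _ = rho * (13%:R / 20%:R)); last by field.
  by rewrite -[leRHS]mulr1 ler_pM2l // ler_pdivrMr ?ltr0n // mul1r ler_nat.
have -> : q = z + 1 *: v by rewrite scale1r /v addrC subrK.
apply: (@vanishing (fun t => g (z + t *: v)) M).
- by move=> t t6; apply: cdiff_line; exact/gd/inball.
- by move=> t t6; exact/gM/inball.
- exists (r / (`|v| + 1)).
    by rewrite divr_gt0 // addr_ge0_gt0 // ltr01.
  move=> t; rewrite -[_ < _]/(`|t| < _) => tr; apply: gr; rewrite -ball_normE /ball_ /= opprD addNKr normrN normrZ.
  move: tr; rewrite ltr_pdivlMr; last by rewrite ltr_wpDl.
  by apply: le_lt_trans; rewrite ler_wpM2l // lerDl ler01.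
Qed.

(** Vanishing is asked only on an open set dense around [p], because the values of [f] at zeros of a
    local denominator are arbitrary. *)
Definition vanishes_near f p : Prop := exists W D : set V,
  [/\ open_nbhs p W, open D, W `<=` closure D & forall y, D y -> f y = 0].

Lemma open_neq0 (U : set V) h : open U -> holomorphic_on U h ->
  open [set y | U y /\ h y != 0].
Proof.
move=> oU hU; rewrite openE => y [Uy hy].
rewrite /interior; near=> x; split; first by near: x; exact: open_nbhs_nbhs.
by near: x; exact: cvgr_neq0 (differentiable_continuous (hU y Uy)) hy.
Unshelve. all: by end_near. Qed.

Lemma closure_meets (A : set V) p (B : set V) : closure A p -> nbhs p B ->
  exists2 y, A y & B y.
Proof. by move=> /[apply] -[y []]; exists y. Qed.

(** If g/h vanishes near [z], so does the numerator [g], since [h] is nonzero on a dense set; then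
    [g] vanishes on a whole ball about [p], whose size does not depend on [z]. *)
Lemma vanishes_near_loc f p : meromorphic f -> exists2 e : K, 0 < e &
  forall z z', `|z - p| < e -> `|z' - p| < e ->
    vanishes_near f z -> vanishes_near f z'.
Proof.
move=> /(_ p)[U [g [h [[oU Up] gU hU Uh fE]]]].
pose M := `|g p| + 1.
have : \forall y \near p, U y /\ `|g y| <= M.
  near=> y; split; first by near: y; exact: open_nbhs_nbhs.
  have : `|g p - g y| < 1.
    near: y; have := differentiable_continuous (gU p Up).
    by move=> /cvgrPdist_lt; apply; exact: ltr01.
  move=> gpy; rewrite (_ : g y = g p - (g p - g y)); last by rewrite opprB addrC subrK.
  by rewrite (le_trans (ler_normB _ _)) // lerD2l ltW.
move=> /nbhs_ballP[rho rho0 Hrho].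
have {}Hrho y : `|y - p| < rho -> U y /\ `|g y| <= M.
  by move=> yp; apply: Hrho; rewrite -ball_normE /ball_ /= distrC.
exists (rho / 20%:R); first by rewrite divr_gt0 ?ltr0n.
have lt20 : rho / 20%:R <= rho.
  by rewrite ler_pdivrMr ?ltr0n // ler_peMr ?(ltW rho0) // ler1n.
have oball (e : K) : open [set y : V | `|y - p| < e].
  rewrite openE => y /= ye; rewrite /interior.
  apply/nbhs_ballP; exists (e - `|y - p|); first by rewrite /= subr_gt0.
  move=> x; rewrite -ball_normE /ball_ /= distrC => xy.
  rewrite (_ : x - p = (x - y) + (y - p)); last by rewrite addrA subrK.
  by rewrite (le_lt_trans (ler_normD _ _)) // -ltrBrDr.
move=> z z' zp z'p [W [D [[oW Wz] oD WD fD]]].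
have gz : \forall y \near z, g y = 0.
  near=> y.
  have Wy : W y by near: y; exact: open_nbhs_nbhs.
  have yp : `|y - p| < rho.
    near: y; apply: (open_nbhs_nbhs (conj (oball rho) _)).
    exact: lt_le_trans zp lt20.
  have Uy := (Hrho y yp).1.
  apply: contrapT => /eqP gy.
  have := open_neq0 oU gU => oN.
  have [y1 Dy1 [Uy1 gy1]] := closure_meets (WD _ Wy) (open_nbhs_nbhs (conj oN (conj Uy gy))).
  have [y2 hy2 [Dy2 [Uy2 gy2]]] := closure_meets (Uh _ Uy1)
    (open_nbhs_nbhs (conj (openI oD oN) (conj Dy1 (conj Uy1 gy1)))).
  have := fE _ Uy2 hy2; rewrite (fD _ Dy2) => /esym/eqP.
  by rewrite mulf_eq0 invr_eq0 (negPf gy2) (negPf hy2).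
have g0 := @holomorphic_vanish g p rho M rho0
  (fun y yp => gU y (Hrho y yp).1) (fun y yp => (Hrho y yp).2) z zp gz.
exists [set y | `|y - p| < rho / 20%:R], ([set y | `|y - p| < rho / 20%:R] `&` [set y | U y /\ h y != 0]).
split.
- by split => //; exact: oball.
- by apply: openI; [exact: oball | exact: open_neq0].
- move=> y yp B By; have Uy := (Hrho y (lt_le_trans yp lt20)).1.
  have By' : nbhs y (B `&` ([set y | `|y - p| < rho / 20%:R] `&` U)).
    by apply: filterI By (open_nbhs_nbhs (conj (openI (oball _) oU) _)).
  by have [x hx [Bx [xp Ux]]] := closure_meets (Uh _ Uy) By'; exists x.
- by move=> y [yp [Uy hy]]; rewrite (fE _ Uy hy) g0 // mul0r.
Unshelve. all: by end_near. Qed.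

Lemma vanishes_near_dichotomy f : meromorphic f ->
  (forall p, vanishes_near f p) \/ (forall p, ~ vanishes_near f p).
Proof.
move=> mf; have [[p fp]|nf] := pselect (exists p, vanishes_near f p); last first.
  by right => p fp; apply: nf; exists p.
left => q; have := @connected01 (fun t => vanishes_near f (p + t *: (q - p))).
rewrite scale1r scale0r addr0 addrCA subrr addr0; apply => // t _.
have [e e0 He] := vanishes_near_loc (p + t *: (q - p)) mf.
have n0 : 0 < `|q - p| + 1 by rewrite ltr_wpDl.
have aux (u : K) : `|u - t| < e / (`|q - p| + 1) ->
    `|p + u *: (q - p) - (p + t *: (q - p))| < e.
  rewrite ltr_pdivlMr // opprD addrACA subrr add0r -scalerBl normrZ.
  by apply: le_lt_trans; rewrite ler_wpM2l // lerDl ler01.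
exists (e / (`|q - p| + 1)); first by rewrite divr_gt0.
by move=> u v _ _ /aux ut /aux vt; exact: He.
Qed.

Definition generically (Q : V -> Prop) : Prop :=
  exists D : set V, [/\ open D, dense D & forall y, D y -> Q y].

(** If [f] vanished near one point it would vanish near all, and so be zero as a meromorphic
    function. Otherwise every open set contains points where local numerator and denominator are
    both nonzero. *)
Lemma meromorphic_neq0 f : meromorphic f -> ~ meq f (fun=> 0) ->
  generically (fun y => f y != 0).
Proof.
move=> mf f0; case: (vanishes_near_dichotomy mf) => [fv|nfv].
  exfalso; apply: f0.
  exists [set y | f y = 0]°; split; first exact: open_interior.
  - move=> N [p Np] oN; have [W [D [[oW Wp] oD WD fD]]] := fv p.
    have [y Dy Ny] := closure_meets (WD _ Wp) (open_nbhs_nbhs (conj oN Np)).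
    by exists y; split => //; apply: filterS (open_nbhs_nbhs (conj oD Dy)).
  - exact: interior_subset.
exists [set y | f y != 0]°; split; first exact: open_interior.
- move=> N [p Np] oN; have [U [g [h [[oU Up] gU hU Uh fE]]]] := mf p.
  have [[y [Ny [Uy gy]]]|no] := pselect (exists y, N y /\ (U y /\ g y != 0)).
    have [y2 hy2 [Ny2 [Uy2 gy2]]] := closure_meets (Uh _ Uy)
      (open_nbhs_nbhs (conj (openI oN (open_neq0 oU gU)) (conj Ny (conj Uy gy)))).
    exists y2; split => //.
    have oUgh := openI (open_neq0 oU gU) (open_neq0 oU hU).
    apply: filterS (open_nbhs_nbhs (conj oUgh (conj (conj Uy2 gy2) (conj Uy2 hy2)))).
    move=> x [[Ux gx] [_ hx]]; rewrite /= (fE _ Ux hx).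
    by rewrite mulf_neq0 ?invr_eq0.
  exfalso; apply: (nfv p).
  exists (N `&` U), (N `&` [set y | U y /\ h y != 0]); split.
  - by split => //; exact: openI.
  - by apply: openI => //; exact: open_neq0.
  - move=> y [Ny Uy] B By.
    have By' : nbhs y (B `&` (N `&` U)).
      by apply: filterI By (open_nbhs_nbhs (conj (openI oN oU) _)).
    by have [x hx [Bx [Nx Ux]]] := closure_meets (Uh _ Uy) By'; exists x.
  - move=> y [Ny [Uy hy]]; rewrite (fE _ Uy hy).
    have [->|gy] := eqVneq (g y) 0; first by rewrite mul0r.
    by exfalso; apply: no; exists y.
- exact: interior_subset.
Qed.

End Meromorphic.

(** * Generic properties and the algebra of meromorphic functions *)

Section Generic.
Variables (K : numClosedFieldType) (d : nat).
Local Notation V := 'rV[K]_d.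
Implicit Types (P Q : V -> Prop) (f g h : V -> K).

Lemma generically_and P Q : generically P -> generically Q ->
  generically (fun y => P y /\ Q y).
Proof.
move=> [A [oA dA AP]] [B [oB dB BQ]]; exists (A `&` B); split.
- exact: openI.
- exact: denseI.
- by move=> y [Ay By]; split; [exact: AP | exact: BQ].
Qed.

Lemma generically_imp P Q : (forall y, P y -> Q y) -> generically P -> generically Q.
Proof. by move=> PQ [A [oA dA AP]]; exists A; split => // y /AP /PQ. Qed.

Lemma generically_ex Q : generically Q -> exists y, Q y.
Proof.
move=> [A [oA dA AQ]]; have [|y [_ Ay]] := dA setT _ openT; first by exists 0.
by exists y; exact: AQ.
Qed.

Lemma open_shift (A : set V) w : open A -> open [set y | A (y + w)].
Proof.
move=> oA; apply: (@open_comp _ _ (fun y : V => y + w)) oA => y _.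
by apply: differentiable_continuous; apply: differentiableD => //; exact: differentiable_cst.
Qed.

Lemma generically_shift Q w : generically Q -> generically (fun y => Q (y + w)).
Proof.
move=> [A [oA dA AQ]]; exists [set y | A (y + w)]; split.
- exact: open_shift.
- move=> N [p Np] oN.
  have [|y [Ny Ay]] := dA [set y | N (y - w)] _ (open_shift (w := - w) oN).
    by exists (p + w); rewrite /= addrK.
  by exists (y - w); split => //=; rewrite subrK.
- by move=> y /AQ.
Qed.

(** Two dense sets need not meet. Here the first, by continuity of [h], is open in [U], so the
    second can be met inside it. *)
Lemma closure_neq0I (U U' : set V) (h h' : V -> K) : open U -> open U' ->
  holomorphic_on U h -> U `<=` closure [set y | h y != 0] ->
  U' `<=` closure [set y | h' y != 0] ->
  U `&` U' `<=` closure [set y | h y * h' y != 0].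
Proof.
move=> oU oU' hU Uh U'h' y [Uy U'y] B By.
have : nbhs y (B `&` (U `&` U')).
  by apply: filterI By (open_nbhs_nbhs (conj (openI oU oU') (conj Uy U'y))).
rewrite nbhsE => -[N [oN Ny] NB].
have [y1 hy1 Ny1] := closure_meets (Uh _ Uy) (open_nbhs_nbhs (conj oN Ny)).
have [_ [Uy1 U'y1]] := NB _ Ny1.
have [y2 h'y2 [Ny2 [Uy2 hy2]]] := closure_meets (U'h' _ U'y1)
  (open_nbhs_nbhs (conj (openI oN (open_neq0 oU hU)) (conj Ny1 (conj Uy1 hy1)))).
have [By2 _] := NB _ Ny2.
by exists y2; split => //=; rewrite mulf_neq0.
Qed.

Lemma holomorphic_meromorphic f : holomorphic_on setT f -> meromorphic f.
Proof.
move=> hf p; exists setT, f, (fun=> 1); split => //.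
- by split => //; exact: openT.
- by move=> y _; apply: subset_closure; rewrite /= oner_eq0.
- by move=> y _ _; rewrite divr1.
Qed.

Lemma meromorphicB f g : meromorphic f -> meromorphic g ->
  meromorphic (fun y => f y - g y).
Proof.
move=> mf mg p.
have [U [a [b [[oU Up] aU bU Ub fE]]]] := mf p.
have [U' [a' [b' [[oU' U'p] a'U' b'U' U'b' gE]]]] := mg p.
exists (U `&` U'), (fun y => a y * b' y - a' y * b y), (fun y => b y * b' y); split.
- by split => //; exact: openI.
- move=> y [Uy U'y]; apply: differentiableB; apply: differentiableM;
    by [exact: aU|exact: b'U'|exact: a'U'|exact: bU].
- by move=> y [Uy U'y]; apply: differentiableM; [exact: bU | exact: b'U'].
- exact: closure_neq0I.
- move=> y [Uy U'y]; rewrite mulf_eq0 negb_or => /andP[by0 b'y0].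
  by rewrite fE // gE //; field; rewrite by0 b'y0.
Qed.

Lemma meromorphicM f g : meromorphic f -> meromorphic g ->
  meromorphic (fun y => f y * g y).
Proof.
move=> mf mg p.
have [U [a [b [[oU Up] aU bU Ub fE]]]] := mf p.
have [U' [a' [b' [[oU' U'p] a'U' b'U' U'b' gE]]]] := mg p.
exists (U `&` U'), (fun y => a y * a' y), (fun y => b y * b' y); split.
- by split => //; exact: openI.
- by move=> y [Uy U'y]; apply: differentiableM; [exact: aU | exact: a'U'].
- by move=> y [Uy U'y]; apply: differentiableM; [exact: bU | exact: b'U'].
- exact: closure_neq0I.
- move=> y [Uy U'y]; rewrite mulf_eq0 negb_or => /andP[by0 b'y0].
  by rewrite fE // gE //; field; rewrite by0 b'y0.
Qed.

(* The denominator [a * b] guarantees that the representation [a / b] of [f]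
   is valid wherever [b * b / (a * b)] is used. *)
Lemma meromorphicV f : meromorphic f -> generically (fun y => f y != 0) ->
  meromorphic (fun y => (f y)^-1).
Proof.
move=> mf [D [oD dD Df]] p.
have [U [a [b [[oU Up] aU bU Ub fE]]]] := mf p.
exists U, (fun y => b y * b y), (fun y => a y * b y); split => //.
- by move=> y Uy; apply: differentiableM; exact: bU.
- by move=> y Uy; apply: differentiableM; [exact: aU | exact: bU].
- move=> y Uy B By.
  have : nbhs y (B `&` U) by apply: filterI By (open_nbhs_nbhs (conj oU Uy)).
  rewrite nbhsE => -[N [oN Ny] NB].
  have [y1 hy1 Ny1] := closure_meets (Ub _ Uy) (open_nbhs_nbhs (conj oN Ny)).
  have [_ Uy1] := NB _ Ny1.
  have [|y2 [[Ny2 [Uy2 by2]] Dy2]] := dD (N `&` [set y | U y /\ b y != 0]) _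
    (openI oN (open_neq0 oU bU)); first by exists y1.
  exists y2; split; last by have [] := NB _ Ny2.
  have := Df _ Dy2; rewrite (fE _ Uy2 by2) /= => ab.
  by rewrite mulf_neq0 //; apply: contraNneq ab => ->; rewrite mul0r.
- move=> y Uy; rewrite mulf_eq0 negb_or => /andP[ay0 by0].
  by rewrite fE //; field; rewrite ay0 by0.
Qed.

Lemma meromorphic_shift f w : meromorphic f -> meromorphic (fun y => f (y + w)).
Proof.
move=> mf p; have [U [a [b [[oU Up] aU bU Ub fE]]]] := mf (p + w).
have dif (k : V -> K) : holomorphic_on U k ->
    holomorphic_on [set y | U (y + w)] (fun y => k (y + w)).
  by move=> kU y /kU ky; apply: (@differentiable_comp _ _ _ _ (fun y : V => y + w) k) => //.
exists [set y | U (y + w)], (fun y => a (y + w)), (fun y => b (y + w)); split.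
- by split => //; exact: open_shift.
- exact: dif.
- exact: dif.
- move=> y Uy B By.
  have B'y : nbhs (y + w) [set x | B (x - w)].
    move: By; rewrite !nbhsE => -[N [oN Ny] NB].
    exists [set x | N (x - w)]; first by split; [exact: open_shift | rewrite /= addrK].
    by move=> x /NB.
  have [x bx Bx] := closure_meets (Ub _ Uy) B'y.
  by exists (x - w); split => //=; rewrite subrK.
- by move=> y Uy; exact: fE.
Qed.

End Generic.

(** * The bilinear form and translations between hyperplanes *)

Section Dot.
Variable K : numClosedFieldType.
Implicit Types (x y z : 'rV[K]_8).

Lemma dotC x y : dot x y = dot y x.
Proof. by apply: eq_bigr => i _; rewrite mulrC. Qed.

Lemma dotDl x y z : dot (x + y) z = dot x z + dot y z.
Proof. by rewrite -big_split; apply: eq_bigr => i _; rewrite mxE mulrDl. Qed.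

Lemma dotZl a x y : dot (a *: x) y = a * dot x y.
Proof. by rewrite /dot mulr_sumr; apply: eq_bigr => i _; rewrite mxE mulrA. Qed.

Lemma dotNl x y : dot (- x) y = - dot x y.
Proof. by rewrite -scaleN1r dotZl mulN1r. Qed.

Lemma dotBl x y z : dot (x - y) z = dot x z - dot y z.
Proof. by rewrite dotDl dotNl. Qed.

Lemma dotMnl x y n : dot (x *+ n) y = dot x y *+ n.
Proof. by rewrite -scaler_nat dotZl mulr_natl. Qed.

Lemma dotDr x y z : dot x (y + z) = dot x y + dot x z.
Proof. by rewrite dotC dotDl !(dotC x). Qed.

Lemma dotZr a x y : dot x (a *: y) = a * dot x y.
Proof. by rewrite dotC dotZl dotC. Qed.

Lemma dotNr x y : dot x (- y) = - dot x y.
Proof. by rewrite dotC dotNl dotC. Qed.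

Lemma dotBr x y z : dot x (y - z) = dot x y - dot x z.
Proof. by rewrite dotDr dotNr. Qed.

Lemma dotMnr x y n : dot x (y *+ n) = dot x y *+ n.
Proof. by rewrite dotC dotMnl dotC. Qed.

Definition dotE :=
  (dotDl, dotDr, dotZl, dotZr, dotNl, dotNr, dotMnl, dotMnr).

Lemma dot_phi_phi : dot phi phi = 2%:R :> K.
Proof.
rewrite /dot (eq_bigr (fun=> 4%:R^-1)) => [|i _]; last by rewrite mxE; field.
by rewrite sumr_const card_ord; field.
Qed.

Lemma dot_phi_sum x : dot phi x = 2%:R^-1 * \sum_(i < 8) x ord0 i.
Proof. by rewrite /dot mulr_sumr; apply: eq_bigr => i _; rewrite mxE. Qed.

Lemma dot_delta x i : dot (delta_mx ord0 i) x = x ord0 i.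
Proof.
rewrite /dot (bigD1 i) //= mxE !eqxx mul1r big1 ?addr0 // => j ji.
by rewrite mxE (negPf ji) andbF mul0r.
Qed.

(** In the charts, translation by [w] is translation by its first seven coordinates; genericity and
    meromorphy therefore pass from one hyperplane to another. *)
Lemma param_shift kappa kappa' w (z : 'rV[K]_7) : dot phi w = kappa - kappa' ->
  param kappa' z + w = param kappa (z + \row_j w ord0 (lift ord_max j)).
Proof.
rewrite dot_phi_sum big_ord_recr /= => Hw; apply/rowP => i; rewrite !mxE.
case: unliftP => [j ->|->]; first by rewrite !mxE.
have {Hw} : \sum_(j < 7) w ord0 (lift ord_max j) + w ord0 ord_max =
    kappa *+ 2 - kappa' *+ 2.
  rewrite -mulrnBl -Hw -[RHS]mulr_natl mulrA mulfV ?pnatr_eq0 // mul1r; congr (_ + _).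
  apply: eq_bigr => j _; congr (w _ _); apply: val_inj.
  by rewrite /= /bump leqNgt ltn_ord.
have -> : \sum_(j < 7) (z + \row_j w ord0 (lift ord_max j)) ord0 j =
    \sum_(j < 7) z ord0 j + \sum_(j < 7) w ord0 (lift ord_max j).
  by rewrite -big_split; apply: eq_bigr => j _; rewrite !mxE.
rewrite -[w 0 _]/(w ord0 _).
move: (\sum_(i < 7) w _ _) (\sum_(i < 7) z _ _) => s t Hs.
rewrite (_ : w ord0 ord_max = kappa *+ 2 - kappa' *+ 2 - s); last by rewrite -Hs addrC addKr.
by ring.
Qed.

End Dot.

Section Hyperplane.
Variable K : numClosedFieldType.
Implicit Types (P Q : 'rV[K]_8 -> Prop) (f : 'rV[K]_8 -> K).

Definition genH (kappa : K) Q : Prop := generically (fun z => Q (param kappa z)).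

Lemma genH_and kappa P Q : genH kappa P -> genH kappa Q ->
  genH kappa (fun x => P x /\ Q x).
Proof. exact: generically_and. Qed.

Lemma genH_imp kappa P Q : (forall x, P x -> Q x) -> genH kappa P -> genH kappa Q.
Proof. by move=> PQ; apply: generically_imp => z; exact: PQ. Qed.

Lemma genH_shift kappa kappa' w Q : dot phi w = kappa - kappa' ->
  genH kappa Q -> genH kappa' (fun x => Q (x + w)).
Proof.
move=> Hw /(generically_shift (\row_j w ord0 (lift ord_max j))).
by apply: generically_imp => z; rewrite (param_shift z Hw).
Qed.

Lemma meromorphic_H_shift kappa kappa' w f : dot phi w = kappa - kappa' ->
  meromorphic_H kappa f -> meromorphic_H kappa' (fun x => f (x + w)).
Proof.
move=> Hw /(meromorphic_shift (\row_j w ord0 (lift ord_max j))).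
rewrite /meromorphic_H; congr meromorphic; apply/funext => z /=.
by rewrite (param_shift z Hw).
Qed.

Lemma meromorphic_HB kappa f1 f2 : meromorphic_H kappa f1 -> meromorphic_H kappa f2 ->
  meromorphic_H kappa (fun x => f1 x - f2 x).
Proof. exact: meromorphicB. Qed.

Lemma meromorphic_HM kappa f1 f2 : meromorphic_H kappa f1 -> meromorphic_H kappa f2 ->
  meromorphic_H kappa (fun x => f1 x * f2 x).
Proof. exact: meromorphicM. Qed.

Lemma meromorphic_HV kappa f : meromorphic_H kappa f -> genH kappa (fun x => f x != 0) ->
  meromorphic_H kappa (fun x => (f x)^-1).
Proof. exact: meromorphicV. Qed.

Lemma differentiable_dot_param kappa r b (z : 'rV[K]_7) :
  differentiable (fun z => dot r (param kappa z) + b) z.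
Proof.
apply: differentiableD; last exact: differentiable_cst.
rewrite (_ : (fun z => _) = \sum_(i < 8) (fun z => r ord0 i * param kappa z ord0 i)); last first.
  by apply/funext => x; rewrite fct_sumE.
apply: differentiable_sum => i; apply: differentiableM; first exact: differentiable_cst.
case: (unliftP ord_max i) => [j ->|->].
  rewrite (_ : (fun z => _) = (fun z : 'rV[K]_7 => z ord0 j)); last first.
    by apply/funext => x; rewrite mxE liftK.
  exact: differentiable_coord.
rewrite (_ : (fun z => _) =
  (fun z => kappa *+ 2 - (\sum_(j < 7) (fun z : 'rV[K]_7 => z ord0 j)) z)); last first.
  by apply/funext => x; rewrite mxE unlift_none fct_sumE.
apply: differentiableB; first exact: differentiable_cst.
by apply: differentiable_sum => j; exact: differentiable_coord.
Qed.

End Hyperplane.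

(** * Generic nonvanishing and oddness of the function [z] *)

Section Bracket.
Variable K : numClosedFieldType.
Hypothesis vanishing : vanishing_principle K.
Hypothesis connected01 : unit_interval_connected K.
Variable br : K -> K.
Hypothesis br_entire : entire br.
Hypothesis br_neq0 : exists z, br z != 0.
Hypothesis br3 : three_term br.
Implicit Types (f : 'rV[K]_8 -> K) (r x : 'rV[K]_8).

Lemma genH_neq0 kappa f : meromorphic_H kappa f -> ~ meq_H kappa f (fun=> 0) ->
  genH kappa (fun x => f x != 0).
Proof. exact: meromorphic_neq0. Qed.

Lemma meromorphic_H_br kappa r b : meromorphic_H kappa (fun x => br (dot r x + b)).
Proof.
apply: holomorphic_meromorphic => z _.
apply: (@differentiable_comp _ _ _ _ (fun z => dot r (param kappa z) + b) br).
  exact: differentiable_dot_param.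
exact: br_entire.
Qed.

(** As (phi|phi) = 2, the hypothesis says that the Gram determinant of [r] and [phi] is nonzero. So
    (r|x) is not constant on the hyperplane and can be given any value, in particular one where the
    bracket is nonzero. *)
Lemma genH_br kappa r b : dot r r *+ 2 != dot phi r ^+ 2 ->
  genH kappa (fun x => br (dot r x + b) != 0).
Proof.
move=> nphi; apply: genH_neq0; first exact: meromorphic_H_br.
move=> [D [oD dD Dbr]]; have [z0 bz0] := br_neq0.
have [u phiu ru] : exists2 u, dot phi u = 0 & dot r u != 0.
  exists (r - (dot phi r / 2%:R) *: phi); first by rewrite !dotE dot_phi_phi; field.
  rewrite !dotE (dotC r phi); apply: contra nphi => /eqP H.
  rewrite -subr_eq0; apply/eqP; rewrite -[RHS](mul0r 2%:R) -H; by field.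
pose x := (kappa / 2%:R) *: phi + ((z0 - b - kappa / 2%:R * dot r phi) / dot r u) *: u.
have [_ _ /(_ x)[|y _ yx]] := param_bij kappa.
  by rewrite /hyperplane /= /x !dotE phiu dot_phi_phi; field.
have bry : br (dot r (param kappa y) + b) != 0.
  rewrite yx (_ : _ + b = z0) // /x.
  by rewrite !dotE; field.
have oN := @open_neq0 K 7 setT (fun z => br (dot r (param kappa z) + b)) openT.
have {}oN := oN (fun z _ => differentiable_comp (differentiable_dot_param kappa r b z) (br_entire I)).
have [|y' [[_ by'] Dy']] := dD _ _ oN; first by exists y.
by have := Dbr y' Dy' => /= E; rewrite E eqxx in by'.
Qed.

Lemma br0 : br 0 = 0.
Proof.
apply: contrapT => /eqP b0; have [z bz] := br_neq0.
(* The three terms coincide, so 3 [0]^2 [z]^2 = 0. *)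
have := br3 z 0 0 0; rewrite /brpm !(addr0, subr0) -!mulrDl.
move=> /eqP; rewrite -mulr2n -mulrSr -mulr_natl !mulf_eq0 (negPf bz) (negPf b0) pnatr_eq0.
by [].
Qed.

(** When two of the three parameters are equal, one term contains [0] and the other two give [v]([z]
    + [-z]) times [w ± al]. The number [w] making the last factor nonzero is a coordinate of a
    generic point of a hyperplane. *)
Lemma brN z : br (- z) = - br z.
Proof.
have [v bv] := br_neq0.
pose e : 'rV[K]_8 := delta_mx ord0 ord0.
pose al := (v + z) / 2%:R; pose be := (v - z) / 2%:R.
have nphi : dot e e *+ 2 != dot phi e ^+ 2.
  rewrite dot_delta dotC dot_delta !mxE /= -subr_eq0.
  by rewrite (_ : _ - _ = 7%:R / 4%:R) ?mulf_neq0 ?invr_eq0 ?pnatr_eq0 //; field.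
have [y [b1 b2]] := generically_ex (genH_and (@genH_br 0 e al nphi) (@genH_br 0 e (- al) nphi)).
set w := dot e _ in b1 b2.
have := br3 w al al be.
rewrite /brpm subrr br0 mulr0 mul0r addr0 -mulrDl => /eqP.
rewrite !mulf_eq0 (negPf b1) (negPf b2) !orbF.
rewrite (_ : al + be = v); last by rewrite /al /be; field.
rewrite (_ : be + al = v); last by rewrite /al /be; field.
rewrite (_ : al - be = z); last by rewrite /al /be; field.
rewrite (_ : be - al = - z); last by rewrite /al /be; field.
by rewrite -mulrDr mulf_eq0 (negPf bv) /= addrC addr_eq0 => /eqP.
Qed.

End Bracket.

(** * Orthonormal frames in the lattice of type E8 *)

Lemma int_parity (k : int) : exists (l : int) (b : bool), k = l * 2 + b%:R.
Proof.
exists (k %/ 2)%Z, (k %% 2 == 1)%Z; rewrite {1}(divz_eq k 2); congr (_ + _).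
have := ltz_pmod k (isT : 0 < 2 :> int); have := modz_ge0 k (isT : 2 != 0 :> int).
by case: (k %% 2)%Z => [[|[|]]|] //.
Qed.

Section Lattice.
Variable K : numClosedFieldType.
Implicit Types (x y a b : 'rV[K]_8).

Definition isint (z : K) : Prop := exists k : int, z = k%:~R.

Lemma isint_int (k : int) : isint k%:~R. Proof. by exists k. Qed.
Lemma isint_nat (n : nat) : isint n%:R. Proof. by exists n; rewrite pmulrn. Qed.
Lemma isintD u v : isint u -> isint v -> isint (u + v).
Proof. by move=> [k ->] [l ->]; exists (k + l); rewrite rmorphD. Qed.
Lemma isintN u : isint u -> isint (- u).
Proof. by move=> [k ->]; exists (- k); rewrite rmorphN. Qed.
Lemma isintB u v : isint u -> isint v -> isint (u - v).
Proof. by move=> iu /isintN; exact: isintD. Qed.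
Lemma isintM u v : isint u -> isint v -> isint (u * v).
Proof. by move=> [k ->] [l ->]; exists (k * l); rewrite rmorphM. Qed.
Lemma isint_sum (I : finType) (F : I -> K) :
  (forall i, isint (F i)) -> isint (\sum_i F i).
Proof. by move=> H; apply: big_rec => [|i z _ iz]; [exact: (isint_nat 0) | exact: isintD]. Qed.

(** Since 2 phi is integral, all integer multiples of [phi] may be allowed; in this form closure
    under addition is visible. *)
Lemma latticeP_split a : latticeP a <->
  exists m (e : int), [/\ Z8 m, a = m + e%:~R *: phi & isint (dot phi a)].
Proof.
split=> [[H pa]|[m [e [mZ ae pa]]]].
  case: H => [aZ|[m mZ am]]; first by exists a, 0; rewrite scale0r addr0.
  by exists m, 1; rewrite scale1r addrC.
split=> //; have [k [b eE]] := int_parity e.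
have mkZ : Z8 (m + k%:~R *: const_mx 1).
  by move=> i; have [u mu] := mZ i; exists (u + k); rewrite !mxE mu mulr1 rmorphD.
have kphi : (k * 2)%:~R *: phi = k%:~R *: const_mx 1 :> 'rV[K]_8.
  by apply/rowP => i; rewrite !mxE rmorphM /= -mulrA mulfV ?pnatr_eq0.
rewrite ae eE rmorphD scalerDl kphi addrA /=.
case: b {eE} => /=; last by left; rewrite scale0r addr0.
by right; exists (m + k%:~R *: const_mx 1) => //; rewrite scale1r addrC.
Qed.

Lemma latticePD a b : latticeP a -> latticeP b -> latticeP (a + b).
Proof.
move=> /latticeP_split[m [e [mZ -> ma]]] /latticeP_split[n [f [nZ -> nb]]].
apply/latticeP_split; exists (m + n), (e + f); split.
- by move=> i; have [u mu] := mZ i; have [v nv] := nZ i; exists (u + v); rewrite mxE mu nv rmorphD.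
- by rewrite rmorphD scalerDl addrACA.
- by rewrite dotDr; exact: isintD.
Qed.

Lemma latticePN a : latticeP a -> latticeP (- a).
Proof.
move=> /latticeP_split[m [e [mZ -> ma]]].
apply/latticeP_split; exists (- m), (- e); split.
- by move=> i; have [u mu] := mZ i; exists (- u); rewrite mxE mu rmorphN.
- by rewrite rmorphN scaleNr opprD.
- by rewrite dotNr; exact: isintN.
Qed.

Lemma latticePB a b : latticeP a -> latticeP b -> latticeP (a - b).
Proof. by move=> aP /latticePN; exact: latticePD. Qed.

Lemma latticeP0 : latticeP (0 : 'rV[K]_8).
Proof.
apply/latticeP_split; exists 0, 0; split; rewrite ?scale0r ?addr0 //.
- by move=> i; exists 0; rewrite mxE.
- by exists 0; rewrite -(scale0r 0) dotZr mul0r.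
Qed.

Lemma latticePMz a (k : int) : latticeP a -> latticeP (k%:~R *: a).
Proof.
move=> aP; have nP n : latticeP (n%:R *: a).
  elim: n => [|n IH]; first by rewrite scale0r; exact: latticeP0.
  by rewrite mulrS scalerDl scale1r; exact: latticePD.
by case: k => n; [exact: nP | rewrite NegzE rmorphN scaleNr; exact/latticePN/nP].
Qed.

Lemma latticeP_phi : latticeP (phi : 'rV[K]_8).
Proof.
apply/latticeP_split; exists 0, 1; split; rewrite ?scale1r ?add0r //.
- by move=> i; exists 0; rewrite mxE.
- by rewrite dot_phi_phi; exact: (isint_nat 2).
Qed.

Lemma Z8_dot_phi x y : Z8 x -> Z8 y -> isint (dot x y).
Proof. by move=> xZ yZ; apply: isint_sum => i; apply: isintM; [exact: xZ | exact: yZ]. Qed.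

Lemma dot_int a b : latticeP a -> latticeP b -> isint (dot a b).
Proof.
move=> /latticeP_split[m [e [mZ -> ma]]] /latticeP_split[n [f [nZ -> nb]]].
rewrite !dotE dot_phi_phi (dotC m phi).
have aux x (j : int) : isint (dot phi (x + j%:~R *: phi)) -> isint (dot phi x).
  move=> H; have := isintB H (isintM (isint_int j) (isint_nat 2)).
  by rewrite !dotE dot_phi_phi addrK.
have := aux _ _ ma; have := aux _ _ nb => pn pm.
do !apply: isintD; do ?[exact: Z8_dot_phi | apply: isintM => //; exact: isint_int].
by do !apply: isintM; do ?[exact: isint_int | exact: (isint_nat 2)].
Qed.

(** The integers m_i^2 and m_i have the same parity, and the sum of the m_i is 2(phi|m). *)
Lemma dot_even a : latticeP a -> isint (dot a a / 2%:R).
Proof.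
move=> /latticeP_split[m [e [mZ -> ma]]].
have pm : isint (dot phi m).
  have := isintB ma (isintM (isint_int e) (isint_nat 2)).
  by rewrite !dotE dot_phi_phi addrK.
have mm : isint ((dot m m - dot phi m *+ 2) / 2%:R).
  have -> : dot phi m *+ 2 = \sum_i m ord0 i.
    by rewrite dot_phi_sum -[LHS]mulr_natl mulrA mulfV ?pnatr_eq0 // mul1r.
  rewrite /dot -sumrB mulr_suml.
  apply: isint_sum => i; have [k ->] := mZ i.
  have [l kl] : exists l : int, k * k - k = l * 2.
    exists ((k * k - k) %/ 2)%Z; rewrite divzK //.
    have : (2 %| k * (k - 1))%Z; last by rewrite mulrBr mulr1.
    rewrite dvdzE abszM Euclid_dvdM //; apply/orP.
    rewrite !dvdn2; case: k => [[|n]|n] /=; [by left| |].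
      by rewrite subn1 /=; case: (odd n); [left|right].
    by rewrite addn0; case: (odd n); [left|right].
  by exists l; rewrite -rmorphM -rmorphB kl rmorphM /= mulfK // pnatr_eq0.
have -> : dot (m + e%:~R *: phi) (m + e%:~R *: phi) / 2%:R =
    (dot m m - dot phi m *+ 2) / 2%:R + dot phi m + e%:~R * dot phi m + e%:~R * e%:~R.
  by rewrite !dotE dot_phi_phi (dotC m phi); field.
by do !apply: isintD => //; apply: isintM => //; exact: isint_int.
Qed.

(** The form is bilinear, not Hermitian, so positivity arguments apply only to real vectors; lattice
    vectors are real. *)
Lemma latticeP_real a i : latticeP a -> a ord0 i \is Num.real.
Proof.
move=> /latticeP_split[m [e [mZ -> _]]]; have [k mk] := mZ i.
by rewrite !mxE mk rpredD ?rpredM ?rpredV ?realz ?realn.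
Qed.

Lemma dot_real_ge0 x : (forall i, x ord0 i \is Num.real) -> 0 <= dot x x.
Proof. by move=> xr; apply: sumr_ge0 => i _; rewrite -expr2 real_exprn_even_ge0. Qed.

Lemma dot_real_eq0 x : (forall i, x ord0 i \is Num.real) -> dot x x = 0 -> x = 0.
Proof.
move=> xr; rewrite /dot => x0; apply/rowP => i; rewrite !mxE; apply/eqP.
have H : forall i, true -> x ord0 i * x ord0 i = 0.
  by apply: psumr_eq0P x0 => j _; rewrite -expr2 real_exprn_even_ge0.
by have /eqP := H i isT; rewrite mulf_eq0 orbb.
Qed.

End Lattice.

(** * Enumeration of the unit vectors and of frames through them *)

Definition gram_sum (s t : seq int) : int :=
  foldr intZmod.addz 0%R [seq intRing.mulz p.1 p.2 | p <- zip s t].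

Fixpoint sphere (vals : seq int) (n b : nat) : seq (seq int) :=
  if n is n'.+1 then
    flatten [seq [seq v :: w | w <- sphere vals n' (b - absz v * absz v)%N]
            | v <- vals & (absz v * absz v <= b)%N]
  else if b is 0%N then [:: [::]] else [::].

Definition coord_sum (s : seq int) : int := foldr intZmod.addz 0%R s.

(* Four times the vectors [a] of norm 1 with [2a] in the lattice. *)
Definition unit_vectors : seq (seq int) :=
  [seq k <- sphere [:: Posz 0; Posz 2; Negz 1; Posz 4; Negz 3] 8 16 ++
            sphere [:: Posz 1; Negz 0; Posz 3; Negz 2] 8 16
  | (4 %| absz (coord_sum k))%N].

Definition int_sign (z : int) : int := if z is Negz _ then Negz 0 else Posz 1.

Definition hadamard4 : seq (seq int) :=
  [:: [:: Posz 1; Posz 1; Posz 1; Posz 1]; [:: Posz 1; Posz 1; Negz 0; Negz 0];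
      [:: Posz 1; Negz 0; Posz 1; Negz 0]; [:: Posz 1; Negz 0; Negz 0; Posz 1]].

(* The orthonormal frame through k / 4, multiplied by 4: the coordinate frame,
   the reflection of the coordinate frame in a root with all entries 1/2 up to
   sign, or, when k has support S with |S| = 4, a Hadamard basis on S and on its
   complement. *)
Definition frame_rows (k : seq int) : seq (seq int) :=
  let z8 := iota 0 8 in
  let at0 (s : seq int) j := nth (Posz 0) s j in
  if has (fun z => absz z == 4%N) k then
    [seq [seq if i == j then Posz 4 else Posz 0 | j <- z8] | i <- z8]
  else if odd (absz (at0 k 0%N)) then
    let eps := [seq if absz z == 3%N then intZmod.oppz (int_sign z) else int_sign z | z <- k] in
    [seq [seq if i == j then intRing.mulz (Negz 2) (at0 eps i) else at0 eps j | j <- z8] | i <- z8]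
  else
    let rank b j := count (fun z => (absz z == 2%N) == b) (take j k) in
    let sg := if odd (count (fun z => z == Negz 1) k) then Negz 0 else Posz 1 in
    let row h j := let z := at0 k j in
       if absz z == 2%N then intRing.mulz z (at0 h (rank true j)) else Posz 0 in
    let row' h j := let z := at0 k j in
       if absz z == 2%N then Posz 0 else let r := rank false j in
       intRing.mulz (if r == 0%N then intRing.mulz sg (Posz 2) else Posz 2) (at0 h r) in
    map (fun h => map (row h) z8) hadamard4 ++ map (fun h => map (row' h) z8) hadamard4.

(** If w = 4a with a = m + e phi, the entries of [w] are 4m_i + 2e, and (phi|a) is one eighth of
    their sum. *)
Definition four_times_in_lattice (w : seq int) : bool :=
  let h := head (Posz 0) w in
  [&& ~~ odd (absz h),
      all (fun z => (4 %| absz (intZmod.addz z (intZmod.oppz h)))%N) w &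
      (8 %| absz (coord_sum w))%N].

(** Congruence is tested only against row 0, as the other differences follow by subtraction. The
    number 16 appears because all rows are multiplied by 4. *)
Definition is_frame_of (k : seq int) : bool :=
  let r := frame_rows k in
  let z8 := iota 0 8 in
  [&& (k \in r) || (map intZmod.oppz k \in r),
      size r == 8%N, all (fun x => size x == 8%N) r,
      all (fun i => all (fun j => gram_sum (nth [::] r i) (nth [::] r j) ==
             (if i == j then Posz 16 else Posz 0)) z8) z8 &
      all (fun i => let x := nth [::] r i in
             four_times_in_lattice (map (intRing.mulz (Posz 2)) x) &&
             four_times_in_lattice
               [seq intZmod.addz p.1 (intZmod.oppz p.2) | p <- zip (nth [::] r 0) x]) z8].

(** A finite check on the 2160 vectors: 16 of shape (±4, 0^7), 1120 of shape (±2^4, 0^4) and 1024 of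
    shape (±3, ±1^7). Concrete integer operations are used above so that the kernel evaluates it. *)
Lemma unit_vectors_frames : all is_frame_of unit_vectors.
Proof. by vm_cast_no_check (erefl true). Qed.

Lemma mem_sphere vals (n b : nat) (w : seq int) : size w = n ->
  all (mem vals) w -> gram_sum w w = Posz b -> w \in sphere vals n b.
Proof.
elim: n b w => [|n IH] b [|v w] //= => [_ _ [<-]//|[sw] /andP[vv ww]].
have sq (z : int) : intRing.mulz z z = Posz (absz z * absz z)%N.
  by case: z => z //=; rewrite mulnn.
have pos : exists c, gram_sum w w = Posz c.
  elim: (w) => [|u s [c Hc]] /=; first by exists 0%N.
  by exists (absz u * absz u + c)%N; rewrite /gram_sum /= sq -/(gram_sum s s) Hc.
case: pos => c Hc; rewrite /gram_sum /= sq -/(gram_sum w w) Hc /= => -[bE].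
apply/flattenP; exists [seq v :: w | w <- sphere vals n (b - absz v * absz v)%N].
  by apply/map_f; rewrite mem_filter -bE leq_addr.
by apply/map_f/IH => //; rewrite Hc -bE addKn.
Qed.

Section Frames.
Variable K : numClosedFieldType.
Implicit Types (a b x : 'rV[K]_8) (r s w : seq int).

Definition quarter_row s : 'rV[K]_8 := \row_i ((nth (Posz 0) s i)%:~R / 4%:R).

Lemma gram_sumE s t n : size s = n -> size t = n ->
  gram_sum s t = \sum_(i < n) nth 0 s i * nth 0 t i.
Proof.
elim: n s t => [|n IH] [|u s] [|v t] //= => [_ _|[ss] [st]]; first by rewrite big_ord0.
by rewrite big_ord_recl /= -(IH s t).
Qed.

Lemma coord_sumE s n : size s = n -> coord_sum s = \sum_(i < n) nth 0 s i.
Proof.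
elim: n s => [|n IH] [|u s] //= => [_|[ss]]; first by rewrite big_ord0.
by rewrite big_ord_recl /= -(IH s).
Qed.

Lemma dot_quarter_row s t : size s = 8%N -> size t = 8%N ->
  dot (quarter_row s) (quarter_row t) = (gram_sum s t)%:~R / 16%:R.
Proof.
move=> s8 t8; rewrite (gram_sumE s8 t8) rmorph_sum mulr_suml.
by apply: eq_bigr => i _; rewrite !mxE rmorphM /=; field.
Qed.

Lemma quarter_row_in_lattice w : size w = 8%N -> four_times_in_lattice w ->
  latticeP (quarter_row w).
Proof.
move=> w8 /and3P[hev /allP w4 /dvdnP[q sq]]; apply/latticeP_split.
set h := head _ w in hev w4.
have [e he] : exists e : int, h = e * 2.
  exists (h %/ 2)%Z; rewrite divzK // dvdzE dvdn2 //.
have wi (i : 'I_8) : exists m : int, nth 0 w i = m * 4 + e * 2.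
  have /w4 : nth 0 w i \in w by rewrite mem_nth // w8.
  rewrite -[intZmod.addz _ _]/(nth 0 w i - h) => H.
  by exists ((nth 0 w i - h) %/ 4)%Z; rewrite divzK // -he subrK.
have [m mE] := choice wi.
exists (\row_i (m i)%:~R), e; split.
- by move=> i; exists (m i); rewrite mxE.
- by apply/rowP => i; rewrite !mxE mE rmorphD !rmorphM /=; field.
- have [k kE] : exists k : int, coord_sum w = k * 8.
    exists (coord_sum w %/ 8)%Z; rewrite divzK // dvdzE sq dvdn_mull //.
  exists k; rewrite dot_phi_sum.
  have -> : \sum_(i < 8) quarter_row w ord0 i = (coord_sum w)%:~R / 4%:R.
    by rewrite (coord_sumE w8) rmorph_sum mulr_suml; apply: eq_bigr => i _; rewrite mxE.
  by rewrite kE rmorphM /=; field.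
Qed.

Definition unitv a : Prop := dot a a = 1 /\ latticeP (a *+ 2).

(** Orthogonality and congruence modulo the lattice. When 2b is in the lattice so is a + b = (a - b)
    + 2b, hence signs do not matter. *)
Definition frame_pair a b : Prop := dot a b = 0 /\ latticeP (a - b).

(** The coordinates of 4a are integers of equal parity whose squares sum to 16, so 4a is in the
    enumeration. Its tabulated frame may contain -a instead of [a]. *)
Lemma full_frame a : unitv a -> exists e : 'I_8 -> 'rV[K]_8,
  [/\ forall i, unitv (e i), forall i j, i != j -> frame_pair (e i) (e j) &
      exists i, a = e i \/ a = - e i].
Proof.
move=> [aa a2].
have /latticeP_split[m [e [mZ am pa]]] := a2.
have [n nE] := choice mZ.
pose k (i : 'I_8) : int := n i * 2 + e.
have ak i : a ord0 i = (k i)%:~R / 4%:R.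
  have := congr1 (fun v : 'rV[K]_8 => v ord0 i) am.
  rewrite !mxE nE mulr2n => H.
  have -> : a ord0 i = (a ord0 i + a ord0 i) / 2%:R by field.
  by rewrite H /k rmorphD rmorphM /=; field.
pose ks := [seq k i | i <- enum 'I_8].
have ks8 : size ks = 8%N by rewrite size_map size_enum_ord.
have ksE (i : 'I_8) : nth 0 ks i = k i.
  by rewrite (nth_map i) ?size_enum_ord // nth_ord_enum.
have aE : a = quarter_row ks by apply/rowP => i; rewrite mxE ksE ak.
have g16 : gram_sum ks ks = 16.
  apply: (@intr_inj K); move: aa; rewrite aE dot_quarter_row // => H.
  by rewrite -[LHS](divfK (_ : 16%:R != 0)) ?H ?mul1r ?pnatr_eq0.
have csum : (4 %| absz (coord_sum ks))%N.
  have [q qE] := pa.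
  have : (coord_sum ks)%:~R = (q * 4)%:~R :> K.
    rewrite rmorphM /= -qE dotMnr dot_phi_sum.
    have -> : \sum_(i < 8) a ord0 i = (coord_sum ks)%:~R / 4%:R.
      by rewrite (coord_sumE ks8) rmorph_sum mulr_suml; apply: eq_bigr => i _; rewrite ksE ak.
    by field.
  by move=> /intr_inj ->; rewrite abszM dvdn_mull.
have ks_small i : (absz (k i) * absz (k i) <= 16)%N.
  have := g16; rewrite (gram_sumE ks8 ks8) (bigD1 i) //= ksE => H.
  have : k i * k i <= 16.
    rewrite -H lerDl; apply: sumr_ge0 => j _; rewrite -expr2; exact: sqr_ge0.
  by move=> kk; rewrite -abszM -lez_nat gez0_abs // -expr2 sqr_ge0.
have ks_unit : ks \in unit_vectors.
  rewrite mem_filter csum mem_cat; apply/orP.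
  have small4 i : (absz (k i) <= 4)%N.
    by rewrite leqNgt; apply/negP => H; have := ks_small i; rewrite leqNgt (ltn_mul H H).
  have kodd i : odd (absz (k i)) = odd (absz e).
    by apply/negb_inj; rewrite -!dvdn2 -!(dvdzE 2) rpredDl // dvdz_mull.
  case oe: (odd (absz e)); [right|left]; apply: mem_sphere => //; apply/allP => z /mapP[i _ ->].
  - have : odd (absz (k i)) by rewrite kodd oe.
    by have := small4 i; case: (k i) => [[|[|[|[|[|]]]]]|[|[|[|[|]]]]].
  - have : ~~ odd (absz (k i)) by rewrite kodd oe.
    by have := small4 i; case: (k i) => [[|[|[|[|[|]]]]]|[|[|[|[|]]]]].
have := allP unit_vectors_frames _ ks_unit.
rewrite /is_frame_of; set r := frame_rows ks => /and5P[kr /eqP rsize r8 gr lr].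
have in8 (i : 'I_8) : val i \in iota 0 8 by rewrite mem_iota ltn_ord.
have rs (i : 'I_8) : size (nth [::] r i) = 8%N.
  by apply/eqP/(allP r8)/mem_nth; rewrite rsize.
pose E (i : 'I_8) := quarter_row (nth [::] r i).
have dotE i j : dot (E i) (E j) = (i == j)%:R.
  rewrite dot_quarter_row //; have /eqP -> := allP (allP gr _ (in8 i)) _ (in8 j).
  by rewrite val_eqE; case: eqP => _; rewrite ?mul0r ?mulfV ?pnatr_eq0.
have latE i : latticeP (E i *+ 2) /\ latticeP (E ord0 - E i).
  have /andP[l1 l2] := allP lr _ (in8 i).
  split.
    have -> : E i *+ 2 = quarter_row (map (intRing.mulz (Posz 2)) (nth [::] r i)).
      apply/rowP => l; rewrite !mxE (nth_map 0) ?rs //.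
      by rewrite -[intRing.mulz _ _]/(Posz 2 * _ : int) rmorphM /=; field.
    by apply: quarter_row_in_lattice l1; rewrite size_map; exact: rs.
  have -> : E ord0 - E i = quarter_row
      [seq intZmod.addz p.1 (intZmod.oppz p.2) | p <- zip (nth [::] r 0) (nth [::] r i)].
    apply/rowP => l; rewrite !mxE (nth_map (0, 0)); last by rewrite size_zip (rs ord0) rs.
    rewrite nth_zip ?(rs ord0) ?rs //=.
    by rewrite -[intZmod.addz _ _]/(_ - _ : int) rmorphB /=; field.
  apply: quarter_row_in_lattice l2; rewrite size_map size_zip.
  by rewrite -[0%N]/(val (ord0 : 'I_8)) -/(nat_of_ord _) (rs ord0) rs.
exists E; split.
- by move=> i; split; [rewrite dotE eqxx | have [] := latE i].
- move=> i j ij; split; first by rewrite dotE (negPf ij).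
  have -> : E i - E j = (E ord0 - E j) - (E ord0 - E i) by rewrite opprB [RHS]addrC subrKA.
  by apply: latticePB; have [] := latE i; have [] := latE j.
- case/orP: kr => /(nthP [::])[j]; rewrite rsize => j8 jE; exists (Ordinal j8).
    by left; rewrite /E /= jE.
  right; rewrite /E /= jE aE; apply/rowP => l; rewrite !mxE (@nth_map _ 0 _ 0 intZmod.oppz l ks) ?ks8 //.
  by rewrite -[intZmod.oppz _]/(- _ : int) rmorphN mulNr opprK.
Qed.

End Frames.

Ltac row_field := apply/rowP => ?; rewrite !mxE; (ring || (field; by [])).
Ltac dot_field := rewrite ?dotE;
  repeat match goal with
  | H : dot ?x ?y = _ |- _ => rewrite ?H ?(dotC y x) ?H; clear H
  end; (ring || (field; by [])).

(** * Classes of unit vectors modulo the lattice *)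

Section Completion.
Variable K : numClosedFieldType.
Implicit Types (a b u v x y : 'rV[K]_8) (s : seq 'rV[K]_8).

Lemma unitv_lattice a (k : int) : unitv a -> latticeP ((k * 2)%:~R *: a).
Proof.
move=> [_ a2]; rewrite rmorphM /= -scalerA scaler_nat; exact: latticePMz.
Qed.

Lemma unitv_real a i : unitv a -> a ord0 i \is Num.real.
Proof.
move=> [_ a2]; have {}a2 := latticeP_real i a2.
by rewrite (_ : a ord0 i = (a *+ 2) ord0 i / 2%:R) ?rpredM ?rpredV ?realn // mxE; field.
Qed.

Lemma unitvN a : unitv a -> unitv (- a).
Proof. by move=> [aa a2]; split; rewrite ?dotE ?opprK // mulNrn; exact: latticePN. Qed.

Lemma frame_pairC a b : frame_pair a b -> frame_pair b a.
Proof. by move=> [ab aP]; split; [rewrite dotC | rewrite -opprB; exact: latticePN]. Qed.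

Lemma frame_pair_add a b : unitv b -> frame_pair a b -> latticeP (a + b).
Proof.
move=> [_ b2] [_ /latticePD/(_ b2)]; congr latticeP.
by rewrite mulr2n addrA subrK.
Qed.

Lemma frame_pairN a b : unitv b -> frame_pair a b -> frame_pair a (- b).
Proof.
move=> bu ab; split; first by rewrite dotNr ab.1 oppr0.
by rewrite opprK; exact: frame_pair_add.
Qed.

(** Evenness of the lattice applied to a - b makes 1 - (a|b) an integer, and positivity of the
    square lengths of a - b and a + b leaves only 1, -1 and 0 for (a|b). *)
Lemma unitv_cong_cases a b : unitv a -> unitv b -> latticeP (a - b) ->
  [\/ b = a, b = - a | frame_pair a b].
Proof.
move=> au bu abP; have [k kE] : isint (dot a b).
  have := dot_even abP; rewrite !dotE au.1 bu.1 (dotC b a) => /isintN /(isintD (isint_nat K 1)).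
  by congr isint; field.
have areal i := unitv_real i au; have breal i := unitv_real i bu.
have Dreal i : (a - b) ord0 i \is Num.real by rewrite !mxE rpredB.
have Sreal i : (a + b) ord0 i \is Num.real by rewrite !mxE rpredD.
have D2 : dot (a - b) (a - b) = ((1 - k) * 2)%:~R.
  by rewrite !dotE au.1 bu.1 (dotC b a) kE rmorphM rmorphB /=; ring.
have S2 : dot (a + b) (a + b) = ((1 + k) * 2)%:~R.
  by rewrite !dotE au.1 bu.1 (dotC b a) kE rmorphM rmorphD /=; ring.
have := dot_real_ge0 Dreal; have := dot_real_ge0 Sreal; rewrite D2 S2 !ler0z => k1 k2.
have : [\/ k = 1, k = - 1 | k = 0].
  case: (k) k1 k2 => [[|[|n]]|[|n]] k1 k2; [by constructor 3|by constructor 1| |by constructor 2|].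
    by rewrite pmulr_lge0 // subr_ge0 in k2.
  by rewrite pmulr_lge0 // NegzE subr_ge0 in k1.
case=> kv; rewrite kv in D2 S2 kE; [constructor 1|constructor 2|constructor 3].
- by apply/esym/eqP; rewrite -subr_eq0; apply/eqP/dot_real_eq0.
- by apply/eqP; rewrite -addr_eq0 addrC; apply/eqP/dot_real_eq0.
- by split.
Qed.

Fixpoint framed s : Prop :=
  if s is x :: s' then
    [/\ unitv x, forall y, y \in s' -> frame_pair x y & framed s']
  else True.

Lemma framed_unit s x : framed s -> x \in s -> unitv x.
Proof.
elim: s => //= y s IH [yu _ fs]; rewrite in_cons => /orP[/eqP -> //|]; exact: IH.
Qed.

Lemma framed_cong s x y : framed s -> x \in s -> y \in s -> latticeP (x - y).
Proof.
elim: s => //= z s IH [zu zs fs]; rewrite !in_cons.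
move=> /orP[/eqP ->|xs] /orP[/eqP ->|ys]; last exact: IH.
- by rewrite subrr; exact: latticeP0.
- by have [] := zs y ys.
- by have [] := frame_pairC (zs x xs).
Qed.

(** For an arbitrary complex [x] positivity is of no use; instead, for a square matrix, M M^T = 1
    implies M^T M = 1. *)
Lemma orthonormal_zero (e : 'I_8 -> 'rV[K]_8) x :
  (forall i j, dot (e i) (e j) = (i == j)%:R) -> (forall i, dot x (e i) = 0) -> x = 0.
Proof.
move=> ee xe; pose M := \matrix_(i < 8) e i.
have dotM u v : (u *m v^T) ord0 ord0 = dot u v.
  by rewrite mxE; apply: eq_bigr => i _; rewrite mxE.
have MM : M *m M^T = 1%:M.
  by apply/matrixP => i j; rewrite [RHS]mxE -(ee i j) mxE; apply: eq_bigr => l _; rewrite !mxE.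
have xM : x *m M^T = 0.
  by apply/rowP => i; rewrite [RHS]mxE -(xe i) mxE; apply: eq_bigr => l _; rewrite !mxE.
by rewrite -[x]mulmx1 -(mulmx1C MM) mulmxA xM mul0mx.
Qed.

Lemma framed_zero s x : framed s -> size s = 8%N ->
  (forall y, y \in s -> dot x y = 0) -> x = 0.
Proof.
move=> fs s8 xs; apply: (@orthonormal_zero (fun i => nth 0 s i)) => [i j|i]; last first.
  by apply/xs/mem_nth; rewrite s8.
suff aux (t : seq 'rV[K]_8) m n : framed t -> (m < size t)%N -> (n < size t)%N ->
    dot (nth 0 t m) (nth 0 t n) = (m == n)%:R.
  by rewrite -val_eqE; apply: aux; rewrite ?s8.
elim: t m n => //= z t IH [|m] [|n] [zu zt ft] //= mt nt.
- exact: zu.1.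
- by have [-> _] := zt _ (mem_nth 0 nt).
- by rewrite dotC; have [-> _] := zt _ (mem_nth 0 mt).
- exact: IH.
Qed.

Lemma framed_member a x : unitv a -> x != 0 ->
  exists u, [/\ unitv u, latticeP (u - a) & dot x u != 0].
Proof.
move=> au x0; have [e [eu ee [i0 ai0]]] := full_frame au.
have ea i : latticeP (e i - a).
  have H j : latticeP (e i - e j).
    by have [->|/ee[]//] := eqVneq i j; rewrite subrr; exact: latticeP0.
  case: ai0 => ->; first exact: H.
  have := latticePD (H i0) (eu i0).2; congr latticeP.
  by rewrite mulr2n opprK addrA subrK.
apply: contrapT => /forallNP no; move/eqP: x0; apply.
apply: (orthonormal_zero (e := e)) => [i j|i].
  by have [->|/ee[]//] := eqVneq i j; rewrite (eu j).1.
by apply: contrapT => /eqP xi; apply: (no (e i)).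
Qed.

(** Members of the list are congruent to [a], hence equal up to sign to vectors of a full frame
    through [a]. Fewer than eight indices are taken, so one is free. *)
Lemma framed_extend a s : framed (a :: s) -> (size s < 7)%N ->
  exists b, framed [:: b, a & s].
Proof.
move=> fs s7; have au : unitv a by case: fs.
have [e [eu ee [i0 ai0]]] := full_frame au.
have se x : x \in a :: s -> exists i, x = e i \/ x = - e i.
  move=> xs; apply: contrapT => /forallNP no; have xu := framed_unit fs xs.
  have xe i : dot x (e i) = 0.
    have xeP : latticeP (x - e i).
      have xaP : latticeP (x - a) by apply: framed_cong fs xs _; rewrite mem_head.
      have aeP : latticeP (a - e i).
        have H : latticeP (e i0 - e i).
          by have [->|/ee[]//] := eqVneq i0 i; rewrite subrr; exact: latticeP0.
        case: ai0 => ->//; have := latticePB H (eu i0).2; congr latticeP.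
        by rewrite mulr2n; row_field.
      by have := latticePD xaP aeP; congr latticeP; rewrite addrA subrK.
    have [H|H|[] //] := unitv_cong_cases xu (eu i) xeP; exfalso; apply: (no i).
      by left.
    by right; rewrite H opprK.
  have x0 : x = 0.
    apply: (orthonormal_zero (e := e)) => // i j.
    by have [->|/ee[]//] := eqVneq i j; rewrite (eu j).1.
  by have := xu.1; rewrite x0 -(scale0r 0) dotZl mul0r => /esym/eqP; rewrite oner_eq0.
have se' x : exists i, x \in a :: s -> x = e i \/ x = - e i.
  have [xs|xs] := pselect (x \in a :: s); last by exists i0 => /xs.
  by have [i ii] := se x xs; exists i.
have [sg sgE] := choice se'.
have [i ni] : exists i, i \notin map sg (a :: s).
  apply: contrapT => /forallNP H.
  have : (#|'I_8| <= size (map sg (a :: s)))%N.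
    rewrite cardE; apply: uniq_leq_size; first exact: enum_uniq.
    by move=> i _; apply/negP => /negP; exact: H.
  by rewrite card_ord size_map /= leqNgt ltnS s7.
exists (e i); split => // y ys.
have : frame_pair (e i) (e (sg y)).
  by apply: ee; apply: contraNneq ni => ->; exact: map_f.
by case: (sgE y ys) => {2}-> //; exact: frame_pairN.
Qed.

Lemma bessel x u : (forall i, x ord0 i \is Num.real) -> unitv u ->
  dot x u ^+ 2 <= dot x x.
Proof.
move=> xr uu; have ur i := unitv_real i uu.
have vr : dot x u \is Num.real by apply: rpred_sum => i _; rewrite rpredM.
rewrite -subr_ge0 (_ : _ - _ = dot (x - dot x u *: u) (x - dot x u *: u)).
  by apply: dot_real_ge0 => i; rewrite !mxE rpredB // rpredM.
by rewrite !dotE uu.1 (dotC u x); ring.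
Qed.

(** The next half-odd value, 3/2, has square 9/4 > 2. *)
Lemma half_odd_small (v : K) : isint (v - 2%:R^-1) -> v ^+ 2 <= 2%:R ->
  v = 2%:R^-1 \/ v = - 2%:R^-1.
Proof.
move=> [m mE] v2.
have vE : v = 2%:R^-1 + m%:~R by rewrite -mE addrC subrK.
have : (m *+ 2 + 1) ^+ 2 <= 8 :> int.
  rewrite -(ler_int K) (_ : ((m *+ 2 + 1) ^+ 2)%:~R = v ^+ 2 * 4%:R :> K).
    by rewrite (_ : 8%:~R = 2%:R * 4%:R :> K) ?ler_wpM2r ?ler0n // -natrM.
  by rewrite vE rmorphXn rmorphD rmorphMn /=; field.
move=> m8; have : m = 0 \/ m = - 1 by nia.
by case=> m0; rewrite vE m0; [left|right]; field.
Qed.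

Lemma int_small (v : K) : isint v -> v != 0 -> v ^+ 2 <= 2%:R -> v = 1 \/ v = - 1.
Proof.
move=> [m ->]; rewrite intr_eq0 => m0 m2.
have : m ^+ 2 <= 2 by rewrite -(ler_int K) rmorphXn.
move=> {}m2; have : m = 1 \/ m = - 1 by nia.
by case=> ->; [left|right].
Qed.

Lemma pick_sign u x (v : K) : unitv u -> dot x u = v \/ dot x u = - v ->
  exists2 u', u' = u \/ u' = - u & dot x u' = v.
Proof.
by move=> uu [xu|xu]; [exists u; [left|]|exists (- u); [right|rewrite dotNr xu opprK]].
Qed.

(** The lattice is self-dual: integrality of the products of [a] with e_i - e_0, e_1 + e_0 and phi
    already forces [a] into it. But (a|a) = 1 is odd. *)
Lemma unitv_dual a : unitv a -> exists2 w, latticeP w & ~ isint (dot w a).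
Proof.
move=> au; apply: contrapT => no.
have H w : latticeP w -> isint (dot w a).
  by move=> wP; apply: contrapT => nw; apply: no; exists w.
pose del (i : 'I_8) : 'rV[K]_8 := delta_mx ord0 i.
have delD i : dot phi (del i) = 2%:R^-1 by rewrite dotC dot_delta mxE.
have delP i j (k : int) : isint (2%:R^-1 + k%:~R * 2%:R^-1 : K) ->
    latticeP (del i + k%:~R *: del j).
  move=> ik; apply/latticeP_split; exists (del i + k%:~R *: del j), 0; split.
  - move=> l; exists ((l == i)%:R + k * (l == j)%:R).
    by rewrite !mxE eqxx /= rmorphD rmorphM /= !rmorph_nat.
  - by rewrite scale0r addr0.
  - by rewrite !dotE !delD.
have subP i : isint (a ord0 i - a ord0 ord0).
  have /H : latticeP (del i + (- 1)%:~R *: del ord0).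
    by apply: delP; rewrite (_ : _ + _ = 0); [exact: (isint_nat K 0) | field].
  by rewrite dotDl dotZl !dot_delta mulN1r.
have [e eE] : isint (a ord0 ord0 *+ 2).
  pose i1 : 'I_8 := lift ord0 ord0.
  have /H : latticeP (del i1 + 1%:~R *: del ord0).
    by apply: delP; rewrite (_ : _ + _ = 1); [exact: (isint_nat K 1) | field].
  rewrite dotDl dotZl !dot_delta mul1r => /isintB/(_ (subP i1)); congr isint.
  by rewrite opprB addrC addrA subrK mulr2n.
have aP : latticeP a.
  apply/latticeP_split; exists (a - e%:~R *: phi), e; split; last exact: (H _ (latticeP_phi K)).
    move=> i; have [k kE] := subP i; exists k; rewrite -kE !mxE -eE.
    by field.
  by rewrite subrK.
have [k] := dot_even aP; rewrite au.1 mul1r => /(congr1 (fun z : K => z * 2%:R)).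
rewrite mulVf ?pnatr_eq0 // -[RHS]/(k%:~R * 2%:~R) -[LHS]/(1%:~R) -rmorphM => /intr_inj; lia.
Qed.

(* All coordinates of [w] on the frame [s] are half-odd integers, hence
   [w - p] is an integral combination of [s], where [s] is constant modulo the
   lattice. *)
Lemma framed_half_sum s x : framed s -> size s = 8%N -> x \in s ->
  exists p, [/\ p = 2%:R^-1 *: \sum_(y <- s) y, forall y, y \in s -> dot p y = 2%:R^-1,
    dot p p = 2%:R & latticeP p \/ latticeP (p - x)].
Proof.
move=> fs s8 xs; have xu := framed_unit fs xs.
have us : uniq s.
  elim: (s) fs => //= y t IH [yu yt ft]; rewrite IH // andbT.
  by apply/negP => /yt[]; rewrite yu.1 => /eqP; rewrite oner_eq0.
have dots y z : y \in s -> z \in s -> dot y z = (y == z)%:R.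
  move=> ys zs; elim: (s) fs ys zs => //= t r IH [tu tr fr].
  rewrite !in_cons => /orP[/eqP ->|yr] /orP[/eqP ->|zr].
  - by rewrite tu.1 eqxx.
  - have [-> _] := tr z zr; case: eqP zr => // <- /tr[].
    by rewrite tu.1 => /eqP; rewrite oner_eq0.
  - have [] := tr y yr; rewrite dotC => -> _; case: eqP yr => // -> /tr[].
    by rewrite tu.1 => /eqP; rewrite oner_eq0.
  - exact: IH.
have dot_sum (F : 'rV[K]_8 -> K) z : z \in s -> dot (\sum_(y <- s) F y *: y) z = F z.
  move=> zs.
  have -> : dot (\sum_(y <- s) F y *: y) z = \sum_(y <- s) F y * dot y z.
    elim/big_rec2: _ => [|y t1 t2 _ <-]; first by rewrite -(scale0r 0) dotZl mul0r.
    by rewrite dotDl dotZl.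
  rewrite (bigD1_seq z) //= dots // eqxx mulr1 big1_seq ?addr0 // => y /andP[yz ys].
  by rewrite dots // (negPf yz) mulr0.
pose p := 2%:R^-1 *: \sum_(y <- s) y; exists p.
have pE : p = \sum_(y <- s) 2%:R^-1 *: y by rewrite /p scaler_sumr.
have py y : y \in s -> dot p y = 2%:R^-1 by move=> ys; rewrite pE (dot_sum (fun=> 2%:R^-1)).
have [w wP nw] := unitv_dual xu.
have wx : isint (dot w x - 2%:R^-1).
  have [k kE] := dot_int wP xu.2; rewrite dotMnr in kE.
  have [l [b lb]] := int_parity k.
  have wE : dot w x = k%:~R / 2%:R by rewrite -kE; field.
  case: b lb => lb; exists l; first by rewrite wE lb rmorphD rmorphM /=; field.
  by exfalso; apply: nw; exists l; rewrite wE lb addr0 rmorphM /=; field.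
have wy y : y \in s -> isint (dot w y - 2%:R^-1).
  move=> ys; have := isintD wx (dot_int wP (framed_cong fs ys xs)).
  by rewrite dotBr; congr isint; ring.
have wE : w = \sum_(y <- s) dot w y *: y.
  apply/eqP; rewrite -subr_eq0; apply/eqP/(framed_zero fs s8) => y ys.
  by rewrite dotBl dot_sum // subrr.
have [M ME] : isint (\sum_(y <- s) (dot w y - 2%:R^-1)).
  by rewrite big_seq; apply: big_rec => [|y z ys iz]; [exact: (isint_nat K 0) | exact/isintD/iz/wy].
have key : latticeP (w - p - M%:~R *: x).
  rewrite {1}wE pE -ME -sumrB scaler_suml -sumrB big_seq.
  apply: big_rec => [|y z ys iz]; first exact: latticeP0.
  apply: latticePD iz; have [m mE] := wy y ys.
  rewrite -scalerBl mE -scalerBr; exact/latticePMz/(framed_cong fs ys xs).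
have pP : latticeP (p + M%:~R *: x).
  by have := latticePB wP key; congr latticeP; row_field.
split => //.
  rewrite {2}pE.
  have -> : dot p (\sum_(y <- s) 2%:R^-1 *: y) = \sum_(y <- s) 2%:R^-1 * dot p y.
    elim/big_rec2: _ => [|y t1 t2 _ <-]; first by rewrite -(scale0r 0) dotZr mul0r.
    by rewrite dotDr dotZr.
  rewrite (eq_big_seq (fun=> 4%:R^-1)) => [|y ys]; last by rewrite py //; field.
  by rewrite big_const_seq count_predT s8 /=; field.
(* Only the parity of [M] matters, because 2x is in the lattice. *)
have [l [b lb]] := int_parity M.
case: b lb => lb; [right|left].
  have := latticePB pP (unitv_lattice (l + 1) xu); congr latticeP.
  by rewrite lb rmorphM !rmorphD rmorphM /=; row_field.
have := latticePB pP (unitv_lattice l xu); congr latticeP.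
by rewrite lb addr0 addrK.
Qed.

End Completion.

(** * Frames with prescribed values of (phi|a) *)

Section Existence.
Variable K : numClosedFieldType.
Implicit Types (a b u v x y : 'rV[K]_8) (s : seq 'rV[K]_8).

Definition V1 a : Prop := unitv a /\ dot phi a = 1.

Lemma V1_compl a : V1 a -> V1 (phi - a) /\ frame_pair (phi - a) a.
Proof.
move=> [[aa a2] pa]; have ppK := dot_phi_phi K.
have l2 : latticeP ((phi - a) *+ 2).
  have := latticePB (latticePMz 2 (latticeP_phi K)) a2; congr latticeP.
  by rewrite mulrnBl; congr (_ - _); rewrite scaler_nat.
split; split.
- split => //; dot_field.
- dot_field.
- dot_field.
- have := latticePB (latticeP_phi K) a2; congr latticeP; row_field.
Qed.

Lemma V1_framed a : V1 a -> framed [:: phi - a; a].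
Proof.
move=> a1; have [[cu _] ca] := V1_compl a1; split => // [y|]; last by split => //; case: a1.
by rewrite inE => /eqP ->.
Qed.

Lemma V1_frame_value0 a b : V1 a -> frame_pair b (phi - a) -> frame_pair b a -> dot phi b = 0.
Proof. by move=> _ [+ _] [ba _]; rewrite dotBr ba subr0 dotC. Qed.

Lemma framed_negl b s : framed (b :: s) -> framed (- b :: s).
Proof.
move=> [bu bs fs]; split; [exact: unitvN | | exact: fs].
by move=> y /bs by_; exact/frame_pairC/(frame_pairN bu)/frame_pairC.
Qed.

Lemma framed_signl b c s : framed (b :: s) -> c = b \/ c = - b -> framed (c :: s).
Proof. by move=> fs [->|->] //; exact: framed_negl. Qed.

(** For a further member [b], (phi|b) is half-odd by congruence with [a0]. The projection of [phi]
    orthogonal to the three vectors has square length 2 - 3/4 = 5/4, so Bessel's inequality leaves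
    ±1/2. *)
Lemma half_frame_extend a0 a1 a2 : framed [:: a0; a1; a2] ->
  dot phi a0 = 2%:R^-1 -> dot phi a1 = 2%:R^-1 -> dot phi a2 = 2%:R^-1 ->
  exists2 a3, framed [:: a3; a0; a1; a2] & dot phi a3 = 2%:R^-1.
Proof.
move=> fs p0 p1 p2; have [b fb] := framed_extend fs isT.
have [bu bs _] := fb.
have [[b0 b0P] [b1 _] [b2 _]] : [/\ frame_pair b a0, frame_pair b a1 & frame_pair b a2].
  by split; apply: bs; rewrite !inE eqxx ?orbT.
have [[u0 _] a0s [[u1 _] a1s [[u2 _] _ _]]] := fs.
have [[a01 _] [a02 _]] : frame_pair a0 a1 /\ frame_pair a0 a2.
  by split; apply: a0s; rewrite !inE eqxx ?orbT.
have [a12 _] : frame_pair a1 a2 by apply: a1s; rewrite inE.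
have ppK := dot_phi_phi K.
pose x : 'rV[K]_8 := phi - 2%:R^-1 *: (a0 + a1 + a2).
have xb : dot x b = dot phi b by rewrite /x; dot_field.
have xx : dot x x = 5%:R / 4%:R by rewrite /x; dot_field.
have /(pick_sign bu)[c cb pc] : dot phi b = 2%:R^-1 \/ dot phi b = - 2%:R^-1.
  apply: half_odd_small.
    by have := dot_int (latticeP_phi K) b0P; rewrite dotBr p0.
  have xr i : x ord0 i \is Num.real.
    have r0 := unitv_real i (framed_unit fs (mem_head _ _)).
    have r1 : a1 ord0 i \is Num.real by apply: unitv_real; apply: framed_unit fs _; rewrite !inE eqxx orbT.
    have r2 : a2 ord0 i \is Num.real by apply: unitv_real; apply: framed_unit fs _; rewrite !inE eqxx !orbT.
    by rewrite !mxE rpredB ?rpredM ?rpredD ?rpredV ?realn.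
  rewrite -xb (le_trans (bessel xr bu)) // xx.
  by rewrite ler_pdivrMr ?ltr0n // -natrM ler_nat.
by exists c => //; exact: framed_signl fb cb.
Qed.

(** Any new member has a half-odd product with 2b. The vector [y] in the proof is the projection of
    2b orthogonal to [a] and phi - a; its square length 4 - 9/4 - 1/4 = 3/2 leaves ±1/2. *)
Lemma V1_adjacent_extend a b x s : V1 a -> V1 b -> dot a b = 3%:R / 4%:R ->
  framed (x :: s) -> (size s < 7)%N -> a \in x :: s -> phi - a \in x :: s ->
  exists2 u, framed [:: u, x & s] & dot u b = 4%:R^-1.
Proof.
move=> [au pa] [[bb b2] pb] ab fs s7 ai ai'; have [u fu] := framed_extend fs s7.
have [uu us _] := fu; have [ua uaP] := us _ ai; have [ua' _] := us _ ai'.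
have ppK := dot_phi_phi K; have [aa _] := au.
have pu : dot phi u = 0 by move: ua'; rewrite dotBr ua subr0 dotC.
pose y : 'rV[K]_8 := b *+ 2 - 2%:R^-1 *: phi - a.
have yu : dot y u = dot (b *+ 2) u by rewrite /y; dot_field.
have yy : dot y y = 3%:R / 2%:R by rewrite /y; dot_field.
have [c cu bc] : exists2 c, c = u \/ c = - u & dot (b *+ 2) c = 2%:R^-1.
  apply: pick_sign => //; apply: half_odd_small.
    have := isintD (dot_int b2 uaP) (isint_nat K 1); congr isint.
    have b2a : dot (b *+ 2) a = 3%:R / 2%:R by dot_field.
    by rewrite dotBr b2a; field.
  have yr i : y ord0 i \is Num.real.
    have ra := unitv_real i au; have rb := unitv_real i (conj bb b2).
    by rewrite !mxE !rpredB // ?rpredD // rpredM // rpredV realn.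
  rewrite -yu (le_trans (bessel yr uu)) // yy.
  by rewrite ler_pdivrMr ?ltr0n // -natrM ler_nat.
exists c; first exact: framed_signl fu cu.
by rewrite dotC -[LHS](mulKf (_ : 2%:R != 0)) ?pnatr_eq0 // mulr_natl -dotMnl bc; field.
Qed.

Lemma V1_adjacent_frame a b : V1 a -> V1 b -> dot a b = 3%:R / 4%:R ->
  exists e1 e2, [/\ framed [:: e2; e1; phi - a; a], dot e1 b = 4%:R^-1 & dot e2 b = 4%:R^-1].
Proof.
move=> a1 b1 ab.
have [|||e1 f1 e1b] := V1_adjacent_extend a1 b1 ab (V1_framed a1) => //;
  try by rewrite !inE eqxx ?orbT.
have [|||e2 f2 e2b] := V1_adjacent_extend a1 b1 ab f1 => //;
  try by rewrite !inE eqxx ?orbT.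
by exists e1, e2.
Qed.

(* For roots alpha = 2a - phi and beta = 2b - phi orthogonal to phi and to each
   other, beta = e2 + e3 on a frame through a, and a half-integral root with
   prescribed signs has inner product 1 with both. *)
Lemma V1_orthogonal_link a b : V1 a -> V1 b -> dot a b = 2%:R^-1 ->
  exists c, [/\ V1 c, dot a c = 3%:R / 4%:R & dot c b = 3%:R / 4%:R].
Proof.
move=> a1 b1 ab; have [[au aa2] pa] := a1; have [[bb b2] pb] := b1.
have ppK := dot_phi_phi K.
pose beta : 'rV[K]_8 := b *+ 2 - phi.
have betaP : latticeP beta by exact: latticePB b2 (latticeP_phi K).
have beta2 : dot beta beta = 2%:R by rewrite /beta; dot_field.
have betaa : dot beta a = 0 by rewrite /beta; dot_field.
have betap : dot beta phi = 0 by rewrite /beta; dot_field.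
have betaD : b = 2%:R^-1 *: (phi + beta) by rewrite /beta; row_field.
clearbody beta.
have beta0 : beta != 0.
  apply/eqP => H; move: beta2; rewrite H -(scale0r 0) dotZl mul0r => /esym/eqP.
  by rewrite pnatr_eq0.
have [u [uu uaP bu0]] := framed_member (conj au aa2) beta0.
have [e eu be] : exists2 e, e = u \/ e = - u & dot beta e = 1.
  apply: pick_sign => //; apply: int_small => //.
    by have := dot_int betaP uaP; rewrite dotBr betaa subr0.
  by rewrite -beta2; apply: bessel uu => i; exact: latticeP_real.
have eun : unitv e by case: eu => -> //; exact: unitvN.
have eaP : latticeP (e - a).
  case: eu => -> //; have := latticePB uaP uu.2; congr latticeP.
  by rewrite mulr2n; row_field.
have ea : frame_pair e a.
  have [H|H|//] := unitv_cong_cases eun (conj au aa2) eaP; exfalso; move: betaa.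
    by rewrite H be => /eqP; rewrite oner_eq0.
  by rewrite H dotNr be => /eqP; rewrite oppr_eq0 oner_eq0.
have [a'1 a'a] := V1_compl a1; have [[a'a' a'2] pa'] := a'1.
have ea' : frame_pair e (phi - a).
  have eaP' : latticeP (e - (phi - a)).
    by have := latticePB (frame_pair_add (conj au aa2) ea) (latticeP_phi K); congr latticeP; row_field.
  have [H|H|//] := unitv_cong_cases eun (proj1 a'1) eaP'; exfalso.
    have : dot beta (phi - a) = 0 by dot_field.
    by rewrite H be => /eqP; rewrite oner_eq0.
  have : dot beta (phi - a) = 0 by dot_field.
  by rewrite H dotNr be => /eqP; rewrite oppr_eq0 oner_eq0.
have [ee e2] := eun; have [ea0 _] := ea; have [ea'0 _] := ea'.
have ep : dot e phi = 0 by move: ea'0; rewrite dotBr ea0 subr0.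
have fun_ : unitv (beta - e).
  split; first by dot_field.
  have := latticePB (latticePMz 2 betaP) e2; congr latticeP.
  by rewrite mulrnBl; congr (_ - _); rewrite scaler_nat.
have f4 : framed [:: beta - e; e; phi - a; a].
  split => //; last first.
    split => //; last exact: V1_framed.
    by move=> y; rewrite !inE => /orP[]/eqP ->.
  move=> y; rewrite !inE => /or3P[]/eqP ->; split.
  - by dot_field.
  - by have := latticePB betaP e2; congr latticeP; row_field.
  - by dot_field.
  - have := latticePB betaP (frame_pair_add (proj1 a'1) ea'); congr latticeP; row_field.
  - by dot_field.
  - have := latticePB betaP (frame_pair_add (conj au aa2) ea); congr latticeP; row_field.
have [x4 f5] := framed_extend f4 isT.
have [x5 f6] := framed_extend f5 isT.
have [x6 f7] := framed_extend f6 isT.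
have [x7 f8] := framed_extend f7 isT.
have [p [_ py pp pP]] := framed_half_sum f8 (erefl _) (mem_head _ _).
have [x7u x7s _] := f8; have [x7a' x7a'P] : frame_pair x7 (phi - a) by apply: x7s; rewrite !inE eqxx ?orbT.
have [x7a _] : frame_pair x7 a by apply: x7s; rewrite !inE eqxx ?orbT.
have [x7e _] : frame_pair x7 e by apply: x7s; rewrite !inE eqxx ?orbT.
have [x7f _] : frame_pair x7 (beta - e) by apply: x7s; rewrite !inE eqxx ?orbT.
have [pa_ pa'_ pe pf px7] : [/\ dot p a = 2%:R^-1, dot p (phi - a) = 2%:R^-1,
    dot p e = 2%:R^-1, dot p (beta - e) = 2%:R^-1 & dot p x7 = 2%:R^-1].
  by split; apply: py; rewrite !inE eqxx ?orbT.
have pphi : dot p phi = 1 by rewrite -[phi](subrK a) dotDr pa_ pa'_; field.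
have pbeta : dot p beta = 1 by rewrite -[beta](subrK e) dotDr pe pf; field.
have x7phi : dot x7 phi = 0 by rewrite -[phi](subrK a) dotDr x7a x7a' addr0.
have x7beta : dot x7 beta = 0 by rewrite -[beta](subrK e) dotDr x7e x7f addr0.
have [x7x7 x72] := x7u.
have x7a'S := frame_pair_add (proj1 a'1) (conj x7a' x7a'P).
clear py f4 f5 f6 f7 f8 x7s x7a' pa'_ x7f pf ea'0 a'a'.
have conclude g : latticeP g -> dot g g = 2%:R -> dot g phi = 0 -> dot g a = 2%:R^-1 ->
    dot g beta = 1 -> exists c, [/\ V1 c, dot a c = 3%:R / 4%:R & dot c b = 3%:R / 4%:R].
  move=> gP gg gp ga gb; exists (2%:R^-1 *: (phi + g)); split.
  - split; last by dot_field.
    split; first by dot_field.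
    have := latticePD (latticeP_phi K) gP; congr latticeP.
    by rewrite -scaler_nat scalerA mulfV ?pnatr_eq0 // scale1r.
  - by dot_field.
  - by rewrite [X in dot _ X]betaD; clear bb pb ab; dot_field.
(* Flipping the sign of the coordinate of [p] on phi - a makes it orthogonal to [phi]. A second
   flip, at [x7], is needed for membership exactly when [p] itself is in the lattice. *)
case: pP => pP; [apply: (conclude (p - (phi - a) - x7))|apply: (conclude (p - (phi - a)))];
  try by dot_field.
- have := latticePB pP x7a'S.
  by congr latticeP; row_field.
- by have := latticePD pP x7a'P; congr latticeP; row_field.
Qed.

(** For alpha = 2a - phi and beta = 2b - phi, the integer 4(a|b) = 2 + (alpha|beta) runs over 0,
    ..., 4. Each value is reduced to steps of value 3 through intermediate roots. *)
Lemma V1_connected (G : 'rV[K]_8 -> Prop) :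
  (forall a b, V1 a -> V1 b -> dot a b = 3%:R / 4%:R -> G a -> G b) ->
  forall a b, V1 a -> V1 b -> G a -> G b.
Proof.
move=> step; have ppK := dot_phi_phi K.
have step0 a b : V1 a -> V1 b -> dot a b = 2%:R^-1 -> G a -> G b.
  move=> a1 b1 ab Ga; have [c [c1 ac cb]] := V1_orthogonal_link a1 b1 ab.
  exact: step cb (step _ _ a1 c1 ac Ga).
have stepm1 a b : V1 a -> V1 b -> dot a b = 4%:R^-1 -> G a -> G b.
  move=> a1 b1 ab Ga; have [[aa a2] pa] := a1; have [[bb b2] pb] := b1.
  (* The vector of the root alpha + beta, at 60 degrees from both when (alpha|beta) = -1. *)
  pose c : 'rV[K]_8 := a + b - 2%:R^-1 *: phi.
  have c1 : V1 c.
    split; last by rewrite /c; dot_field.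
    split; first by rewrite /c; dot_field.
    have := latticePB (latticePD a2 b2) (latticeP_phi K); congr latticeP.
    by rewrite /c; row_field.
  apply: (step c) => //; first by rewrite /c; dot_field.
  by apply: (step a) => //; rewrite /c; dot_field.
have stepm2 a : V1 a -> G a -> G (phi - a).
  move=> a1 Ga; have [[aa a2] pa] := a1; have [a'1 a'a] := V1_compl a1.
  have [e1 f3] := framed_extend (V1_framed a1) isT.
  have [e2 f4] := framed_extend f3 isT.
  have [e2u e2s [e1u e1s _]] := f4.
  have e1a : frame_pair e1 a by apply: e1s; rewrite !inE eqxx orbT.
  have e1a' : frame_pair e1 (phi - a) by apply: e1s; rewrite !inE eqxx.
  have e2a : frame_pair e2 a by apply: e2s; rewrite !inE eqxx !orbT.
  have e2a' : frame_pair e2 (phi - a) by apply: e2s; rewrite !inE eqxx orbT.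
  have e21 : frame_pair e2 e1 by apply: e2s; rewrite !inE eqxx.
  have pe1 := V1_frame_value0 a1 e1a' e1a; have pe2 := V1_frame_value0 a1 e2a' e2a.
  have eP := frame_pair_add e1u e21.
  have [e11 _] := e1u; have [e22 _] := e2u; have [e210 _] := e21.
  have [e1a0 _] := e1a; have [e2a0 _] := e2a.
  clear f3 f4 e1s e2s e1u e2u e1a e2a e1a' e2a' e21.
  (* The vector of the root e2 + e1, which is orthogonal to alpha, hence also to -alpha. *)
  pose b : 'rV[K]_8 := 2%:R^-1 *: (phi + (e2 + e1)).
  have b1 : V1 b.
    split; last by rewrite /b; dot_field.
    split; first by rewrite /b; dot_field.
    have := latticePD (latticeP_phi K) eP; congr latticeP.
    by rewrite -scaler_nat scalerA mulfV ?pnatr_eq0 // scale1r.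
  apply: (step0 b) => //; first by rewrite /b; dot_field.
  by apply: (step0 a) => //; rewrite /b; dot_field.
move=> a b a1 b1 Ga; have [[aa a2] pa] := a1; have [[bb b2] pb] := b1.
have [k kE] : isint (dot a b *+ 4).
  by have := dot_int a2 b2; rewrite dotMnl dotMnr -mulrnA.
have kE' : dot a b = k%:~R / 4%:R by rewrite -kE; field.
have ar i := unitv_real i (conj aa a2); have br i := unitv_real i (conj bb b2).
have k4 : k <= 4.
  have : 0 <= dot (a - b) (a - b) by apply: dot_real_ge0 => i; rewrite !mxE rpredB.
  rewrite (_ : dot _ _ = (4 - k)%:~R / 2%:R); last by rewrite rmorphB /=; dot_field.
  by rewrite pmulr_lge0 ?invr_gt0 ?ltr0n // ler0z subr_ge0.
have k0 : 0 <= k.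
  have : 0 <= dot (a + b - phi) (a + b - phi).
    by apply: dot_real_ge0 => i; rewrite !mxE rpredB ?rpredD ?rpredV ?realn.
  rewrite (_ : dot _ _ = k%:~R / 2%:R); last by dot_field.
  by rewrite pmulr_lge0 ?invr_gt0 ?ltr0n // ler0z.
have : [\/ k = 4, k = 3, k = 2 | k = 1 \/ k = 0].
  case: (k) k0 k4 => [[|[|[|[|[|n]]]]]|n] // _ _;
    by [constructor 4; right|constructor 4; left|constructor 3|constructor 2|constructor 1].
case=> [k_|k_|k_|[k_|k_]]; rewrite k_ in kE'.
- suff -> : b = a by [].
  apply/esym/eqP; rewrite -subr_eq0; apply/eqP/dot_real_eq0.
    by move=> i; rewrite !mxE rpredB.
  by dot_field.
- by apply: (step a) => //; rewrite kE'.
- by apply: (step0 a) => //; rewrite kE'; field.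
- by apply: (stepm1 a) => //; rewrite kE'; field.
- suff -> : b = phi - a by exact: stepm2.
  apply/eqP; rewrite -subr_eq0; apply/eqP/dot_real_eq0.
    by move=> i; rewrite !mxE rpredB ?rpredB ?rpredV ?realn.
  by dot_field.
Qed.

Lemma C3_frameP a b c : C3_frame (triple a b c) <-> framed [:: a; b; c].
Proof.
pose i0 : 'I_3 := ord0; pose i1 : 'I_3 := lift ord0 ord0; pose i2 : 'I_3 := ord_max.
split=> [[H1 H2 H3]|].
  have E0 : triple a b c i0 = a by []. have E1 : triple a b c i1 = b by [].
  have E2 : triple a b c i2 = c by [].
  have := H1 i0 i0; have := H1 i1 i1; have := H1 i2 i2; have := H1 i0 i1; have := H1 i0 i2.
  have := H1 i1 i2; rewrite E0 E1 E2 /= => d12 d02 d01 d22 d11 d00.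
  have := (H2 i0 i1 isT).2; have := (H2 i0 i2 isT).2; have := (H2 i1 i2 isT).2.
  have := H3 i0; have := H3 i1; have := H3 i2; rewrite E0 E1 E2 => l2 l1 l0 l12 l02 l01.
  split => // [y|]; first by rewrite !inE => /orP[]/eqP ->.
  by split => // y; rewrite inE => /eqP ->.
move=> [au abc [bu bc [cu _ _]]].
have ab : frame_pair a b by apply: abc; rewrite !inE eqxx.
have ac : frame_pair a c by apply: abc; rewrite !inE eqxx orbT.
have {}bc : frame_pair b c by apply: bc; rewrite inE.
have tE i : triple a b c i = nth 0 [:: a; b; c] i by exact: tnth_nth.
split.
- case=> [[|[|[|m]]] hi] // [[|[|[|n]]] hj] //; rewrite !tE /= ?au.1 ?bu.1 ?cu.1 ?ab.1 ?ac.1 ?bc.1 //.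
  + by rewrite dotC ab.1.
  + by rewrite dotC ac.1.
  + by rewrite dotC bc.1.
- have H x y : unitv y -> frame_pair x y -> latticeP (x + y) /\ latticeP (x - y).
    by move=> yu xy; split; [exact: frame_pair_add | case: xy].
  by case=> [[|[|[|m]]] hi] // [[|[|[|n]]] hj] // _; rewrite !tE /=; exact: H.
- by case=> [[|[|[|m]]] hi] //; rewrite tE /=; [case: au|case: bu|case: cu].
Qed.

Lemma framed_V1_compl a s : V1 a -> framed (a :: s) ->
  (forall y, y \in s -> dot phi y = 0) -> framed [:: phi - a, a & s].
Proof.
move=> a1 fas s0; have [[cu _] ca] := V1_compl a1; have [au as_ fs] := fas.
split => // y; rewrite in_cons => /orP[/eqP -> //|ys].
have ay := as_ y ys; split; first by rewrite dotBl s0 // ay.1 subrr.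
have := latticePB (latticeP_phi K) (frame_pair_add (framed_unit fs ys) ay).
by congr latticeP; rewrite opprD addrA.
Qed.

(** The class spans, so some member has nonzero product with [phi]. That product is an integer by
    congruence, and ±1 by Bessel since (phi|phi) = 2. *)
Lemma zero_frame_V1 a1 a2 a3 : framed [:: a1; a2; a3] ->
  dot phi a1 = 0 -> dot phi a2 = 0 -> dot phi a3 = 0 ->
  exists2 e, V1 e & framed [:: e; a1; a2; a3].
Proof.
move=> fs p1 p2 p3; have [a1u a1s _] := fs.
have phi0 : phi != 0 :> 'rV[K]_8.
  apply/eqP => H; have := dot_phi_phi K; rewrite {1}H -(scale0r 0) dotZl mul0r => /esym/eqP.
  by rewrite pnatr_eq0.
have [u [uu ua pu0]] := framed_member a1u phi0.
have [e eu pe] : exists2 e, e = u \/ e = - u & dot phi e = 1.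
  apply: pick_sign => //; apply: int_small => //.
    by have := dot_int (latticeP_phi K) ua; rewrite dotBr p1 subr0.
  by rewrite -(dot_phi_phi K); apply: bessel uu => i; exact: latticeP_real (latticeP_phi K).
have eun : unitv e by case: eu => -> //; exact: unitvN.
have ea1 : latticeP (e - a1).
  case: eu => -> //; have := latticePB ua uu.2; congr latticeP.
  by rewrite mulr2n; row_field.
exists e; first by [].
split => // y ys; have yu := framed_unit fs ys.
have p0 : dot phi y = 0 by move: ys; rewrite !inE => /or3P[]/eqP ->.
have ey : latticeP (e - y).
  have a1y : latticeP (a1 - y) by apply: framed_cong fs (mem_head _ _) ys.
  by have := latticePD ea1 a1y; congr latticeP; rewrite addrA subrK.
have [H|H|//] := unitv_cong_cases eun yu ey; exfalso; move: p0.
  by rewrite H pe => /eqP; rewrite oner_eq0.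
by rewrite H dotNr pe => /eqP; rewrite oppr_eq0 oner_eq0.
Qed.

(** The frame is completed by [e4], [e5], [e6], [e0] and phi - e0. Either its half-sum is in the
    lattice or it becomes so after a sign change at [e6]; accordingly [r] is e5 + e6 or e5 - e6. *)
Lemma zero_frame_extend e1 e2 e3 : framed [:: e1; e2; e3] ->
  dot phi e1 = 0 -> dot phi e2 = 0 -> dot phi e3 = 0 ->
  exists e4 r, [/\ framed [:: e4; e1; e2; e3], dot phi e4 = 0,
    [/\ latticeP r, dot r r = 2%:R & dot r phi = 0],
    [/\ dot r e1 = 0, dot r e2 = 0, dot r e3 = 0 & dot r e4 = 0] &
    latticeP (2%:R^-1 *: (phi + (e1 + e2 + e3 + e4) + r) : 'rV[K]_8)].
Proof.
move=> fs p1 p2 p3; have [e0 e0V fe] := zero_frame_V1 fs p1 p2 p3.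
have f5 : framed [:: phi - e0; e0; e1; e2; e3].
  by apply: framed_V1_compl => // y; rewrite !inE => /or3P[]/eqP ->.
have [e4 f6] := framed_extend f5 isT.
have [e5 f7] := framed_extend f6 isT.
have [e6 f8] := framed_extend f7 isT.
have value0 e s : framed (e :: s) -> phi - e0 \in s -> e0 \in s -> dot phi e = 0.
  by move=> [_ es _] i1 i2; apply: (V1_frame_value0 e0V); exact: es.
have p4 : dot phi e4 = 0 by apply: (value0 _ _ f6); rewrite !inE eqxx ?orbT.
have p5 : dot phi e5 = 0 by apply: (value0 _ _ f7); rewrite !inE eqxx ?orbT.
have p6 : dot phi e6 = 0 by apply: (value0 _ _ f8); rewrite !inE eqxx ?orbT.
have [p [pE _ _ pP]] := framed_half_sum f8 (erefl _) (mem_head _ _).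
have pE' : p = 2%:R^-1 *: (phi + (e1 + e2 + e3 + e4) + (e5 + e6)).
  by rewrite pE !big_cons big_nil; row_field.
have [e6u e6s [e5u e5s [e4u e4s _]]] := f8.
have [[e51 _] [e52 _] [e53 _] [e54 _]] :
    [/\ frame_pair e5 e1, frame_pair e5 e2, frame_pair e5 e3 & frame_pair e5 e4].
  by split; apply: e5s; rewrite !inE eqxx ?orbT.
have [[e61 _] [e62 _] [e63 _] [e64 _]] :
    [/\ frame_pair e6 e1, frame_pair e6 e2, frame_pair e6 e3 & frame_pair e6 e4].
  by split; apply: e6s; rewrite !inE eqxx ?orbT.
have e65 : frame_pair e6 e5 by apply: e6s; rewrite !inE eqxx ?orbT.
have f4 : framed [:: e4; e1; e2; e3].
  split => // y ys; apply: e4s; rewrite in_cons in_cons ys !orbT //.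
have [e55 _] := e5u; have [e66 _] := e6u; have [e650 e65P] := e65.
have e65S := frame_pair_add e5u e65.
clear f5 f6 f7 f8 value0 pE fe e6s e5s e4s e65 fs.
exists e4; case: pP => pP.
  exists (e5 + e6); split => //; [split|split|by rewrite -pE'].
  - by rewrite addrC.
  - by dot_field.
  - by dot_field.
  - by dot_field.
  - by dot_field.
  - by dot_field.
  - by dot_field.
exists (e5 - e6); split => //; [split|split|].
- by rewrite -opprB; exact: latticePN.
- by dot_field.
- by dot_field.
- by dot_field.
- by dot_field.
- by dot_field.
- by dot_field.
- by move: pP; congr latticeP; rewrite pE'; row_field.
Qed.

Lemma V1_frame_exists : exists a a1 a2 : 'rV[K]_8,
  [/\ V1 a, framed [:: a; a1; a2], dot phi a1 = 0 & dot phi a2 = 0].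
Proof.
pose i1 : 'I_8 := lift ord0 ord0.
pose r : 'rV[K]_8 := delta_mx ord0 ord0 - delta_mx ord0 i1.
have pr : dot phi r = 0 by rewrite /r dotBr !(dotC phi) !dot_delta !mxE subrr.
have rr : dot r r = 2%:R.
  by rewrite {1}/r dotBl !dot_delta !mxE /=; ring.
have rP : latticeP r.
  apply/latticeP_split; exists r, 0; split; rewrite ?scale0r ?addr0 ?pr //; last exact: (isint_nat K 0).
  by move=> j; exists ((j == ord0)%:R - (j == i1)%:R); rewrite !mxE rmorphB /= !rmorph_nat.
have ppK := dot_phi_phi K.
clearbody r.
pose a := 2%:R^-1 *: (phi + r).
have a1 : V1 a.
  split; last by rewrite /a; dot_field.
  split; first by rewrite /a; dot_field.
  have := latticePD (latticeP_phi K) rP; congr latticeP.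
  by rewrite /a -scaler_nat scalerA mulfV ?pnatr_eq0 // scale1r.
have [x1 f1] := framed_extend (V1_framed a1) isT.
have [x2 f2] := framed_extend f1 isT.
have [x2u x2s [x1u x1s [_ _ [au _ _]]]] := f2.
have x1a : frame_pair x1 a by apply: x1s; rewrite !inE eqxx ?orbT.
have x2a : frame_pair x2 a by apply: x2s; rewrite !inE eqxx ?orbT.
have x21 : frame_pair x2 x1 by apply: x2s; rewrite !inE eqxx ?orbT.
exists a, x1, x2; split => //.
- split => // [y|].
    by rewrite !inE => /orP[]/eqP ->; exact: frame_pairC.
  by split => // y; rewrite inE => /eqP ->; exact: frame_pairC.
- by apply: (V1_frame_value0 a1) => //; apply: x1s; rewrite !inE eqxx ?orbT.
- by apply: (V1_frame_value0 a1) => //; apply: x2s; rewrite !inE eqxx ?orbT.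
Qed.

End Existence.

(** * The bilinear equations *)

Section FramedSmall.
Variable K : numClosedFieldType.
Implicit Types (a b c d : 'rV[K]_8).

Lemma framed3 a b c : framed [:: a; b; c] <->
  [/\ unitv a, unitv b & unitv c] /\
  [/\ frame_pair a b, frame_pair a c & frame_pair b c].
Proof.
split=> [[au abc [bu bc [cu _ _]]]|[[au bu cu] [ab ac bc]]].
  by split; split => //; [apply: abc|apply: abc|apply: bc]; rewrite !inE eqxx ?orbT.
split => // [y|]; first by rewrite !inE => /orP[]/eqP ->.
by split => // y; rewrite inE => /eqP ->.
Qed.

Lemma framed4 a b c d : framed [:: a; b; c; d] <->
  [/\ unitv a, frame_pair a b, frame_pair a c & frame_pair a d] /\ framed [:: b; c; d].
Proof.
split=> [[au abcd fs]|[[au ab ac ad] fs]]; split => //.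
  by split => //; apply: abcd; rewrite !inE eqxx ?orbT.
by move=> y; rewrite !inE => /or3P[]/eqP ->.
Qed.

End FramedSmall.

Section TauFunctions.
Variable K : numClosedFieldType.
Hypothesis vanishing : vanishing_principle K.
Hypothesis connected01 : unit_interval_connected K.
Variable br : K -> K.
Hypothesis br_entire : entire br.
Hypothesis br_neq0 : exists z, br z != 0.
Hypothesis br3 : three_term br.
Variables (delta c : K) (n : int) (f g : 'rV[K]_8 -> K).
Hypothesis mero_f : meromorphic_H (c + (n - 1)%:~R * delta) f.
Hypothesis mero_g : meromorphic_H (c + n%:~R * delta) g.
Hypothesis f_neq0 : ~ meq_H (c + (n - 1)%:~R * delta) f (fun=> 0).
Hypothesis I_fg : eqI br delta c (n - 1) f g.
Hypothesis II0_g : eqII0 br delta c n g.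
Implicit Types (a b e x y z X : 'rV[K]_8) (h : 'rV[K]_8 -> K).

Let br_opp := brN vanishing connected01 br_entire br_neq0 br3.

Lemma brdC x y X : brd br y x X = - brd br x y X.
Proof. by rewrite /brd addrC -opprB dotNl br_opp mulrN. Qed.

Lemma brdNr x y X : brd br x (- y) X = brd br x y X.
Proof. by rewrite /brd opprK mulrC. Qed.

Lemma brdNl x y X : brd br (- x) y X = brd br x y X.
Proof. by rewrite brdC brdNr brdC opprK. Qed.

Lemma brd_three x y z w X :
  brd br y z X * brd br w x X + brd br z x X * brd br w y X + brd br x y X * brd br w z X = 0.
Proof.
have := br3 (dot w X) (dot x X) (dot y X) (dot z X).
by rewrite /brpm /brd !dotDl !dotNl.
Qed.

Lemma genH_br_root kappa r (b : K) : dot r r = 2%:R -> dot phi r = 0 ->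
  genH kappa (fun X => br (dot r X + b) != 0).
Proof.
move=> rr pr; apply: genH_br => //; rewrite rr pr expr0n /= mulrn_eq0 pnatr_eq0 //.
Qed.

Lemma genH_brd kappa x y : framed [:: x; y] -> dot phi x = 0 -> dot phi y = 0 ->
  genH kappa (fun X => brd br x y X != 0).
Proof.
move=> [[xx _] xys [[yy _] _ _]] px py.
have [xy _] : frame_pair x y by apply: xys; rewrite inE.
apply: genH_imp (genH_and (@genH_br_root kappa (x + y) 0 _ _) (@genH_br_root kappa (x - y) 0 _ _)).
- by move=> X [b1 b2]; rewrite /brd !addr0 in b1 b2 *; rewrite mulf_neq0.
- by dot_field.
- by dot_field.
- by dot_field.
- by dot_field.
Qed.

Lemma meq_H_genH kappa (F G : 'rV[K]_8 -> K) :
  meq_H kappa F G <-> genH kappa (fun X => F X = G X).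
Proof. by []. Qed.

Definition II1_at h a x y : Prop := genH (c + n%:~R * delta) (fun X =>
  brd br x y X * f (X - delta *: a) * h (X + delta *: a) =
  brd br a y X * (g (X + delta *: x) * g (X - delta *: x)) -
  brd br a x X * (g (X + delta *: y) * g (X - delta *: y))).

Lemma II1_atC h a x y : II1_at h a x y -> II1_at h a y x.
Proof.
apply: genH_imp => X H; rewrite (brdC x y) -[RHS]opprB -H; ring.
Qed.

Lemma II1_atNl h a x y : II1_at h a x y -> II1_at h a (- x) y.
Proof.
by apply: genH_imp => X; rewrite brdNl brdNr scalerN opprK (mulrC (g (X - _))).
Qed.

(** After multiplication by [(x ± y|X)], equation (II_0) for [x], [y], [z] trades the values of [g]
    along [y] for those along [z], and the three-term relation with fourth vector [a] adjusts the
    coefficient of those along [x]. *)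
Lemma II1_at_step h a x y z : V1 a -> framed [:: a; x; y; z] ->
  dot phi x = 0 -> dot phi y = 0 -> dot phi z = 0 ->
  II1_at h a x y -> II1_at h a x z.
Proof.
move=> a1 /framed4[[_ ax ay az] fs] px py pz H.
have fxy : framed [:: x; y].
  by have /framed3[[xu yu _] [xy _ _]] := fs; split => // t; rewrite inE => /eqP ->.
have /meq_H_genH II0 := II0_g (proj2 (C3_frameP _ _ _) fs) px py pz.
rewrite /II1_at in H *.
apply: genH_imp (genH_and H (genH_and II0 (genH_brd _ fxy px py))) => X [{}H [{}II0 b0]].
apply: (mulfI b0); have T := brd_three x y z a X.
rewrite /= (brdC x z) in II0; rewrite (brdC x z) in T.
move: H II0 T b0.
move: (brd br x y X) (brd br x z X) (brd br y z X) (brd br a x X) (brd br a y X) (brd br a z X).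
move=> xy xz yz a_x a_y a_z.
move: (g (X + delta *: x) * _) (g (X + delta *: y) * _) (g (X + delta *: z) * _) => gx gy gz.
move: (f _) (h _) => F H.
move=> H1 H2 H3 _.
apply/eqP; rewrite -subr_eq0.
rewrite (_ : _ - _ = xz * (xy * F * H - (a_y * gx - a_x * gy)) -
  gx * (yz * a_x + - xz * a_y + xy * a_z) + a_x * (yz * gx + - xz * gy + xy * gz)); last by ring.
by rewrite H1 H2 H3 subrr !mulr0 subrr addr0.
Qed.

Lemma II1_at_indep h a x y x' y' : V1 a ->
  framed [:: a; x; y] -> framed [:: a; x'; y'] ->
  dot phi x = 0 -> dot phi y = 0 -> dot phi x' = 0 -> dot phi y' = 0 ->
  II1_at h a x y -> II1_at h a x' y'.
Proof.
move=> a1 fs fs' px py px' py' H.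
have /framed3[[au xu yu] [ax ay xy]] := fs.
have /framed3[[_ x'u y'u] [ax' ay' x'y']] := fs'.
have cong u v : frame_pair a u -> frame_pair a v -> latticeP (u - v).
  by move=> [_ au'] [_ av]; have := latticePB av au'; congr latticeP; row_field.
have link u v w : unitv u -> unitv v -> unitv w -> frame_pair a u -> frame_pair a v ->
    frame_pair a w -> frame_pair u v -> frame_pair u w ->
    dot phi u = 0 -> dot phi v = 0 -> dot phi w = 0 ->
    II1_at h a u v -> II1_at h a u w.
  move=> uu vu wu aU aV aW uv uw pu pv pw Huv.
  have [->|->|vw] := unitv_cong_cases vu wu (cong v w aV aW) => //.
    exact/II1_atC/II1_atNl/II1_atC.
  by apply: II1_at_step Huv => //; apply/framed4; split => //; apply/framed3.
have [z [zu az x'z pz Hz]] : exists z, [/\ unitv z, frame_pair a z, frame_pair x' z,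
    dot phi z = 0 & II1_at h a x' z].
  have [xx'|xx'|xx'] := unitv_cong_cases xu x'u (cong x x' ax ax').
  - by exists y; rewrite xx'.
  - exists y; rewrite xx'; split => //; last exact: II1_atNl.
    exact/frame_pairC/(frame_pairN xu)/frame_pairC.
  exists x; split => //; first exact: frame_pairC.
  apply/II1_atC; exact: (link x y x').
exact: (link x' z y').
Qed.

Lemma f_generic kappa w : dot phi w = c + (n - 1)%:~R * delta - kappa ->
  genH kappa (fun X => f (X + w) != 0).
Proof.
move=> Hw; apply: (genH_shift (Q := fun X => f X != 0) Hw).
exact: (genH_neq0 vanishing connected01 mero_f f_neq0).
Qed.

(* With s0 = 2a, s1 = 2b, s2 = 2b - e1 - e2 and the three roots q_i and three
   roots p_jk such that s_i = p_ij + q_j, the frames below are (s_i - q_i) / 2. *)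
Lemma adjacent_half_frame a b e1 e2 : V1 a -> V1 b -> dot a b = 3%:R / 4%:R ->
  framed [:: a; e1; e2] -> dot phi e1 = 0 -> dot phi e2 = 0 ->
  dot e1 b = 4%:R^-1 -> dot e2 b = 4%:R^-1 ->
  framed [:: 2%:R^-1 *: (a *+ 3 + e1) - b; b - 2%:R^-1 *: (a - e1);
             b - 2%:R^-1 *: (a + e1) - e2].
Proof.
move=> [_ pa] [[bb b2] pb] ab /framed3[[[aa a2] e1u e2u] [ae1 ae2 e12]] p1 p2 e1b e2b.
have ae1P := frame_pair_add e1u ae1; have e12P := frame_pair_add e2u e12.
have [e11 e1P] := e1u; have [e22 e2P] := e2u; have [ae1_ ae1M] := ae1; have [ae2_ ae2M] := ae2.
have [e12_ e12M] := e12; have ppK := dot_phi_phi K.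
clear ae1 ae2 e12 e1u e2u.
apply/framed3; split; split; split; try by dot_field.
- have := latticePB (latticePD ae1P a2) b2; congr latticeP; row_field.
- have := latticePB b2 ae1M; congr latticeP; row_field.
- have := latticePB (latticePB b2 ae1P) e2P; congr latticeP; row_field.
- have := latticePB a2 b2; congr latticeP; row_field.
- have := latticePB (latticePD a2 e12P) b2; congr latticeP; row_field.
- have := e12P; congr latticeP; row_field.
Qed.

(** The frame is chosen to match (II_1) at [a], [e1], [e2] in the point x = X + delta(b - a): there
    x + delta a = X + delta b, and x - delta e_i = X - delta(a + e_i - b). *)
Lemma adjacent_second_frame a b e1 e2 : V1 a -> V1 b -> dot a b = 3%:R / 4%:R ->
  framed [:: a; e1; e2] -> dot phi e1 = 0 -> dot phi e2 = 0 ->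
  dot e1 b = 4%:R^-1 -> dot e2 b = 4%:R^-1 ->
  framed [:: b; a + e1 - b; a + e2 - b].
Proof.
move=> [_ pa] [[bb b2] pb] ab /framed3[[[aa a2] e1u e2u] [ae1 ae2 e12]] p1 p2 e1b e2b.
have ae1P := frame_pair_add e1u ae1; have ae2P := frame_pair_add e2u ae2.
have [e11 e1P] := e1u; have [e22 e2P] := e2u; have [ae1_ ae1M] := ae1; have [ae2_ ae2M] := ae2.
have [e12_ e12M] := e12; have ppK := dot_phi_phi K.
clear ae1 ae2 e12 e1u e2u.
apply/framed3; split; split; split; try by dot_field.
- exact: b2.
- have := latticePB (latticePD ae1P ae1P) b2; congr latticeP; row_field.
- have := latticePB (latticePD ae2P ae2P) b2; congr latticeP; row_field.
- have := latticePB b2 ae1P; congr latticeP; row_field.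
- have := latticePB b2 ae2P; congr latticeP; row_field.
- by have := e12M; congr latticeP; row_field.
Qed.

Definition II1_good h a : Prop := forall x y, framed [:: a; x; y] ->
  dot phi x = 0 -> dot phi y = 0 -> II1_at h a x y.

(** Equation (I) on the half frame, moved by (delta/2)(a - e1) so that its point runs over the
    hyperplane of (II_1). *)
Lemma adjacent_eqI a b e1 e2 : V1 a -> V1 b -> dot a b = 3%:R / 4%:R ->
  framed [:: a; e1; e2] -> dot phi e1 = 0 -> dot phi e2 = 0 ->
  dot e1 b = 4%:R^-1 -> dot e2 b = 4%:R^-1 ->
  genH (c + n%:~R * delta) (fun X =>
    br (dot b X *+ 2 - dot a X - dot e2 X) * br (dot e1 X + dot e2 X + delta / 2%:R) *
      f (X + delta *: (b - a *+ 2)) * g (X + delta *: (a + e1 - b)) +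
    br (dot a X - dot e2 X - delta / 2%:R) *
      br (dot b X *+ 2 - dot a X *+ 2 - dot e1 X - dot e2 X) *
      f (X - delta *: b) * g (X + delta *: (b - a + e1)) +
    br (dot a X + dot e1 X) * br (dot a X *+ 2 - dot b X *+ 2 - delta / 2%:R) *
      f (X + delta *: (e1 + e2 - b)) * g (X + delta *: (b - a - e2)) = 0).
Proof.
move=> a1 b1 ab fs p1 p2 e1b e2b.
have hf := adjacent_half_frame a1 b1 ab fs p1 p2 e1b e2b.
have [[[aa _] pa] [[bb _] pb]] := (a1, b1).
have /framed3[[_ [e11 _] [e22 _]] [[ae1 _] [ae2 _] [e12 _]]] := fs.
have := I_fg (proj2 (C3_frameP _ _ _) hf).
have w : dot phi (- (delta / 2%:R) *: (a - e1)) =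
    c + ((n - 1)%:~R + 2%:R^-1) * delta - (c + n%:~R * delta).
  by rewrite rmorphB /=; dot_field.
move=> /(_ ltac:(by dot_field) ltac:(by dot_field) ltac:(by dot_field)) /meq_H_genH /(genH_shift w).
apply: genH_imp => X.
rewrite /brd.
set a_0 := 2%:R^-1 *: (a *+ 3 + e1) - b; set a_1 := b - 2%:R^-1 *: (a - e1).
set a_2 := b - 2%:R^-1 *: (a + e1) - e2.
set x := X + _.
have -> : dot (a_1 + a_2) x = dot b X *+ 2 - dot a X - dot e2 X by rewrite /x /a_1 /a_2; dot_field.
have -> : dot (a_1 - a_2) x = dot e1 X + dot e2 X + delta / 2%:R by rewrite /x /a_1 /a_2; dot_field.
have -> : dot (a_2 + a_0) x = dot a X - dot e2 X - delta / 2%:R by rewrite /x /a_0 /a_2; dot_field.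
have -> : dot (a_2 - a_0) x = dot b X *+ 2 - dot a X *+ 2 - dot e1 X - dot e2 X.
  by rewrite /x /a_0 /a_2; dot_field.
have -> : dot (a_0 + a_1) x = dot a X + dot e1 X by rewrite /x /a_0 /a_1; dot_field.
have -> : dot (a_0 - a_1) x = dot a X *+ 2 - dot b X *+ 2 - delta / 2%:R.
  by rewrite /x /a_0 /a_1; dot_field.
have -> : x - delta *: a_0 = X + delta *: (b - a *+ 2) by rewrite /x /a_0; row_field.
have -> : x + delta *: a_0 = X + delta *: (a + e1 - b) by rewrite /x /a_0; row_field.
have -> : x - delta *: a_1 = X - delta *: b by rewrite /x /a_1; row_field.
have -> : x + delta *: a_1 = X + delta *: (b - a + e1) by rewrite /x /a_1; row_field.
have -> : x - delta *: a_2 = X + delta *: (e1 + e2 - b) by rewrite /x /a_2; row_field.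
have -> : x + delta *: a_2 = X + delta *: (b - a - e2) by rewrite /x /a_2; row_field.
by [].
Qed.

Lemma II1_good_intro h a x y : V1 a -> framed [:: a; x; y] ->
  dot phi x = 0 -> dot phi y = 0 -> II1_at h a x y -> II1_good h a.
Proof. by move=> a1 fs px py H x' y' fs' px' py'; exact: II1_at_indep H. Qed.

Lemma II1_good_adjacent h a b : V1 a -> V1 b -> dot a b = 3%:R / 4%:R ->
  II1_good h a -> II1_good h b.
Proof.
move=> a1 b1 ab Ha; have [e1 [e2 [fs4 e1b e2b]]] := V1_adjacent_frame a1 b1 ab.
have /framed4[[e2u e21 e2a' e2a] /framed3[[e1u _ au] [e1a' e1a _]]] := fs4.
have fs : framed [:: a; e1; e2].
  by apply/framed3; split; split => //; exact: frame_pairC.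
have fs' : framed [:: a; e2; e1].
  by apply/framed3; split; split => //; exact: frame_pairC.
have p1 := V1_frame_value0 a1 e1a' e1a; have p2 := V1_frame_value0 a1 e2a' e2a.
have EA := adjacent_eqI a1 b1 ab fs p1 p2 e1b e2b.
have EB := adjacent_eqI a1 b1 ab fs' p2 p1 e2b e1b.
have fb := adjacent_second_frame a1 b1 ab fs p1 p2 e1b e2b.
have [[[aa _] pa] [[bb _] pb]] := (a1, b1).
have [e11 _] := e1u; have [e22 _] := e2u; have [ea1 _] := e1a; have [ea2 _] := e2a.
have [e12 _] := e21.
clear fs4 fs' e2a' e1a' e1a e2a e21 e1u e2u.
have w : dot phi (delta *: (b - a)) = c + n%:~R * delta - (c + n%:~R * delta) by dot_field.
have J0 := Ha _ _ fs p1 p2; rewrite /II1_at in J0.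
have J := genH_shift w J0.
have fn : genH (c + n%:~R * delta) (fun X => f (X + delta *: (b - a *+ 2)) != 0).
  by apply: f_generic; rewrite rmorphB /=; dot_field.
have bn : genH (c + n%:~R * delta) (fun X => br (dot (e1 + e2) X + delta / 2%:R) != 0).
  by apply: genH_br_root; dot_field.
apply: (II1_good_intro (x := a + e1 - b) (y := a + e2 - b) b1 fb); try by dot_field.
rewrite /II1_at.
apply: genH_imp (genH_and EA (genH_and EB (genH_and J (genH_and fn bn)))) => X.
move=> [{}EA [{}EB [{}J [{}fn {}bn]]]].
move: J; rewrite /brd.
set x := X + _.
have -> : dot (e1 + e2) x = dot e1 X + dot e2 X + delta / 2%:R by rewrite /x; dot_field.
have -> : dot (e1 - e2) x = dot e1 X - dot e2 X by rewrite /x; dot_field.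
have -> : dot (a + e2) x = dot a X + dot e2 X by rewrite /x; dot_field.
have -> : dot (a - e2) x = dot a X - dot e2 X - delta / 2%:R by rewrite /x; dot_field.
have -> : dot (a + e1) x = dot a X + dot e1 X by rewrite /x; dot_field.
have -> : dot (a - e1) x = dot a X - dot e1 X - delta / 2%:R by rewrite /x; dot_field.
have -> : x - delta *: a = X + delta *: (b - a *+ 2) by rewrite /x; row_field.
have -> : x + delta *: a = X + delta *: b by rewrite /x; row_field.
have -> : x + delta *: e1 = X + delta *: (b - a + e1) by rewrite /x; row_field.
have -> : x - delta *: e1 = X + delta *: (b - a - e1) by rewrite /x; row_field.
have -> : x + delta *: e2 = X + delta *: (b - a + e2) by rewrite /x; row_field.
have -> : x - delta *: e2 = X + delta *: (b - a - e2) by rewrite /x; row_field.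
have -> : dot (a + e1 - b + (a + e2 - b)) X = - (dot b X *+ 2 - dot a X *+ 2 - dot e1 X - dot e2 X).
  by rewrite !dotE; ring.
have -> : dot (a + e1 - b - (a + e2 - b)) X = dot e1 X - dot e2 X by rewrite !dotE; ring.
have -> : dot (b + (a + e2 - b)) X = dot a X + dot e2 X by rewrite !dotE; ring.
have -> : dot (b - (a + e2 - b)) X = dot b X *+ 2 - dot a X - dot e2 X by rewrite !dotE; ring.
have -> : dot (b + (a + e1 - b)) X = dot a X + dot e1 X by rewrite !dotE; ring.
have -> : dot (b - (a + e1 - b)) X = dot b X *+ 2 - dot a X - dot e1 X by rewrite !dotE; ring.
have -> : X - delta *: (a + e1 - b) = X + delta *: (b - a - e1) by row_field.
have -> : X - delta *: (a + e2 - b) = X + delta *: (b - a - e2) by row_field.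
rewrite br_opp.
move: EA EB bn; rewrite dotDl (addrC (dot e2 X) (dot e1 X)) (addrC e1 e2).
have -> : dot b X *+ 2 - dot a X *+ 2 - dot e2 X - dot e1 X =
  dot b X *+ 2 - dot a X *+ 2 - dot e1 X - dot e2 X by ring.
move: fn.
move: (f (X + delta *: (b - a *+ 2))) (f (X - delta *: b)) (f _) => f0 f1 f2.
move: (g (X + delta *: (a + e1 - b))) (g (X + delta *: (a + e2 - b))).
move: (g (X + delta *: (b - a + e1))) (g (X + delta *: (b - a + e2))).
move: (g (X + delta *: (b - a - e1))) (g (X + delta *: (b - a - e2))).
move: (h _) => H g1 g2 g3 g4 g5 g6.
move: (br (dot e1 X + _ + _)) (br (dot e1 X - _)) (br (dot a X + dot e1 X)) (br (dot a X + dot e2 X)).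
move: (br (dot a X - dot e1 X - _)) (br (dot a X - dot e2 X - _)) (br (_ - dot e1 X - dot e2 X)).
move: (br (_ - dot a X - dot e1 X)) (br (_ - dot a X - dot e2 X)) (br (_ - dot b X *+ 2 - _)).
move=> k1 k2 k3 k4 k5 k6 k7 k8 k9 k10 fn EA EB bn J.
(* Up to these two factors the goal is a combination of [J], [EA] and [EB]: the values g(X + delta(b
   - a + e_i)) cancel between [J] and the other two, and the terms with f(X + delta(e1 + e2 - b))
   between [EA] and [EB]. *)
apply: (mulfI (mulf_neq0 fn bn)).
apply/eqP; rewrite -subr_eq0.
move: (f _) EA EB => f3 EA EB.
rewrite (_ : _ - _ =
  - k6 * f1 * (k7 * k8 * f2 * H - (k10 * k5 * (g3 * g1) - k9 * k4 * (g4 * g2)))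
  - k10 * g1 * (k2 * k7 * f2 * g5 + k5 * k6 * f1 * g3 + k9 * k3 * f3 * g2)
  + k9 * g2 * (k1 * k7 * f2 * g6 + k4 * k6 * f1 * g4 + k10 * k3 * f3 * g1)); last by ring.
by rewrite EA EB J subrr !mulr0 subr0 addr0.
Qed.

Lemma II1_good_all h a : V1 a -> II1_good h a -> forall b, V1 b -> II1_good h b.
Proof.
move=> a1 Ha b b1; apply: (V1_connected (G := II1_good h)) a1 b1 Ha.
exact: II1_good_adjacent.
Qed.

Lemma eqII1P h : eqII1 br delta c n f g h <-> forall a, V1 a -> II1_good h a.
Proof.
split=> [H a [_ pa] x y fs px py|H a x y /C3_frameP fs pa px py].
  exact: H (proj2 (C3_frameP _ _ _) fs) pa px py.
by apply: H => //; split => //; case: fs.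
Qed.

Lemma II1_good_unique h h' a : V1 a -> II1_good h a -> II1_good h' a ->
  (exists x y, [/\ framed [:: a; x; y], dot phi x = 0 & dot phi y = 0]) ->
  meq_H (c + (n + 1)%:~R * delta) h h'.
Proof.
move=> [_ pa] H H' [x [y [fs px py]]].
have fxy : framed [:: x; y] by case: fs.
have J := H x y fs px py; have J' := H' x y fs px py; rewrite /II1_at in J J'.
have fn : genH (c + n%:~R * delta) (fun X => f (X + - (delta *: a)) != 0).
  by apply: f_generic; rewrite rmorphB /=; dot_field.
have E : genH (c + n%:~R * delta) (fun X => h (X + delta *: a) = h' (X + delta *: a)).
  apply: genH_imp (genH_and J (genH_and J' (genH_and fn (genH_brd _ fxy px py)))) => X.
  move=> [{}J [{}J' [{}fn b0]]].
  by apply: (mulfI (mulf_neq0 b0 fn)); rewrite J J'.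
have w : dot phi (- (delta *: a)) = c + n%:~R * delta - (c + (n + 1)%:~R * delta).
  by rewrite rmorphD /=; dot_field.
apply/meq_H_genH; have := genH_shift w E; apply: genH_imp => X; by rewrite subrK.
Qed.

Lemma II1_solution : exists h a x y,
  [/\ meromorphic_H (c + (n + 1)%:~R * delta) h, V1 a, framed [:: a; x; y],
      dot phi x = 0 /\ dot phi y = 0 & II1_at h a x y].
Proof.
have [a [x [y [a1 fs px py]]]] := V1_frame_exists K.
have fxy : framed [:: x; y] by case: fs.
have [_ pa] := a1.
pose kappa := c + n%:~R * delta.
pose num X := brd br a y X * (g (X + delta *: x) * g (X + - (delta *: x))) -
    brd br a x X * (g (X + delta *: y) * g (X + - (delta *: y))).
pose den X := brd br x y X * f (X + - (delta *: a)).
have mbrd u v : meromorphic_H kappa (brd br u v).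
  have E r : meromorphic_H kappa (fun X => br (dot r X)).
    have := meromorphic_H_br br_entire kappa r 0; congr meromorphic_H.
    by apply/funext => X; rewrite addr0.
  exact: (meromorphic_HM (E (u + v)) (E (u - v))).
have mg w : dot phi w = 0 -> meromorphic_H kappa (fun X => g (X + w)).
  by move=> pw; apply: meromorphic_H_shift mero_g; rewrite pw subrr.
have mf : meromorphic_H kappa (fun X => f (X + - (delta *: a))).
  by apply: meromorphic_H_shift mero_f; rewrite rmorphB /= /kappa; dot_field.
have mnum : meromorphic_H kappa num.
  apply: meromorphic_HB; apply: meromorphic_HM; try exact: mbrd;
    apply: meromorphic_HM; apply: mg; by dot_field.
have mden : meromorphic_H kappa den by apply: meromorphic_HM; [exact: mbrd | exact: mf].
have fn : genH kappa (fun X => f (X + - (delta *: a)) != 0).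
  by apply: f_generic; rewrite rmorphB /= /kappa; dot_field.
have gden : genH kappa (fun X => den X != 0).
  apply: genH_imp (genH_and fn (genH_brd _ fxy px py)) => X [f0 b0].
  by rewrite /den mulf_neq0.
have mquo : meromorphic_H kappa (fun X => num X * (den X)^-1).
  by apply: meromorphic_HM => //; exact: meromorphic_HV.
exists (fun Y => num (Y + - (delta *: a)) * (den (Y + - (delta *: a)))^-1), a, x, y; split => //.
  apply: (meromorphic_H_shift (f := fun X => num X * (den X)^-1)) mquo.
  by rewrite /kappa rmorphD /=; dot_field.
apply: genH_imp gden => X d0; rewrite -/(den X) addrK.
by rewrite mulrC divfK.
Qed.

(** * Derivation of (C1), (C2) and (C3) *)

Section Consequences.
Variable h : 'rV[K]_8 -> K.
Hypothesis II1_h : forall a, V1 a -> II1_good h a.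

(** Here phi = a0 + a1, as the difference has square length 2 - 4 + 2 = 0, so a fourth member [a3]
    is orthogonal to [phi]. Between (II_1) at [a0] and at [a1], both with [a2], [a3], the values of
    [g] along [a3] are eliminated; the three-term relation simplifies the rest. *)
Lemma II2_holds : eqII2 br delta c n f g h.
Proof.
move=> a0 a1 a2 /C3_frameP fs p0 p1 p2; apply/meq_H_genH.
have [a3 f4] := framed_extend fs isT.
have /framed4[[a3u a30 a31 a32] /framed3[[u0 u1 u2] [a01 a02 a12]]] := f4.
have ppK := dot_phi_phi K; have [u00 _] := u0; have [u11 _] := u1; have [a010 _] := a01.
have phiE : phi = a0 + a1.
  apply/eqP; rewrite -subr_eq0; apply/eqP/dot_real_eq0 => [i|]; last by dot_field.
  have r0 := unitv_real i u0; have r1 := unitv_real i u1.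
  by rewrite !mxE rpredB ?rpredD ?rpredV ?realn.
have p3 : dot phi a3 = 0 by rewrite phiE dotDl dotC a30.1 dotC a31.1 addr0.
have V0 : V1 a0 by []. have V1' : V1 a1 by [].
have f023 : framed [:: a0; a2; a3] by apply/framed3; split; split => //; exact: frame_pairC.
have f123 : framed [:: a1; a2; a3] by apply/framed3; split; split => //; exact: frame_pairC.
have J0 := II1_h V0 f023 p2 p3; have J1 := II1_h V1' f123 p2 p3; rewrite /II1_at in J0 J1.
have b0 : genH (c + n%:~R * delta) (fun X => brd br a2 a3 X != 0).
  by apply: genH_brd => //; case: f023.
apply: genH_imp (genH_and J0 (genH_and J1 b0)) => X [{}J0 [{}J1 {}b0]].
have T := brd_three a0 a1 a2 a3 X.
rewrite (brdC a0 a3) (brdC a1 a3) (brdC a2 a3) (brdC a0 a2) (brdC a1 a0 X) in T.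
apply: (mulfI b0).
move: J0 J1 T b0.
move: (brd br a2 a3 X) (brd br a0 a3 X) (brd br a0 a2 X) (brd br a1 a3 X) (brd br a1 a2 X) (brd br a1 a0 X).
move: (f _) (h _) (f _) (h _) (g _ * g _) (g _ * g _) => F1 H1 F0 H0 G3 G2 k23 k03 k02 k13 k12 k10.
move=> J0 J1 T _.
apply/eqP; rewrite -subr_eq0.
rewrite (_ : _ - _ = k12 * (k23 * F0 * H0 - (k03 * G2 - k02 * G3))
  - k02 * (k23 * F1 * H1 - (k13 * G2 - k12 * G3))
  - G2 * (k12 * - k03 + - k02 * - k13 + - k10 * - k23)); last by ring.
by rewrite J0 J1 T !subrr !mulr0 !subr0.
Qed.

(** This is (II_1) at e = (phi + a0 - a3)/2, in the point X + delta(a0 - e). The factor f(X +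
    delta(a3 - phi)) and the bracket of a0 + a1 + a2 + a3 - phi are symmetric in [a0], [a1], [a2],
    so the three rotations can be combined. *)
Lemma half_eqII1 a0 a1 a2 a3 : framed [:: a3; a0; a1; a2] ->
  dot phi a0 = 2%:R^-1 -> dot phi a1 = 2%:R^-1 -> dot phi a2 = 2%:R^-1 ->
  dot phi a3 = 2%:R^-1 ->
  genH (c + (n%:~R + 2%:R^-1) * delta) (fun X =>
    br (dot (a1 - a2) X) * br (dot (a0 + a1 + a2 + a3 - phi) X + delta / 2%:R) *
      f (X + delta *: (a3 - phi)) * h (X + delta *: a0) =
    br (dot (a0 + a2) X) * br (dot (phi - a3 - a2) X - delta / 2%:R) *
      (g (X - delta *: a1) * g (X + delta *: (a0 + a1 + a3 - phi))) -
    br (dot (a0 + a1) X) * br (dot (phi - a3 - a1) X - delta / 2%:R) *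
      (g (X - delta *: a2) * g (X + delta *: (a0 + a2 + a3 - phi)))).
Proof.
move=> /framed4[[a3u a30 a31 a32] /framed3[[u0 u1 u2] [a01 a02 a12]]] p0 p1 p2 p3.
have ppK := dot_phi_phi K; have phiP := latticeP_phi K.
have s01 := frame_pair_add u1 a01; have s02 := frame_pair_add u2 a02.
have s31 := frame_pair_add u1 a31; have s32 := frame_pair_add u2 a32.
have s12 := frame_pair_add u2 a12.
have [u00 l0] := u0; have [u11 l1] := u1; have [u22 l2] := u2; have [u33 l3] := a3u.
have [d30 l30] := a30; have [d31 l31] := a31; have [d32 l32] := a32.
have [d01 l01] := a01; have [d02 l02] := a02; have [d12 l12] := a12.
clear a3u a30 a31 a32 u0 u1 u2 a01 a02 a12.
pose e := 2%:R^-1 *: (phi + a0 - a3).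
have ee : dot e e = 1 by rewrite /e; dot_field.
have eP : dot phi e = 1 by rewrite /e; dot_field.
have e0 : dot e a0 = 3%:R / 4%:R by rewrite /e; dot_field.
have e1 : dot e a1 = 4%:R^-1 by rewrite /e; dot_field.
have e2 : dot e a2 = 4%:R^-1 by rewrite /e; dot_field.
have e3 : dot e a3 = - 4%:R^-1 by rewrite /e; dot_field.
have eE : e *+ 2 = phi + a0 - a3 by rewrite /e; row_field.
have el : latticeP (e *+ 2).
  by rewrite eE; have := latticePB phiP l30; congr latticeP; row_field.
clearbody e.
have fs : framed [:: e; a0 + a1 - e; a0 + a2 - e].
  apply/framed3; split; split; split; try by dot_field.
  - by [].
  - by have := latticePB (latticePD s01 s01) el; congr latticeP; row_field.
  - by have := latticePB (latticePD s02 s02) el; congr latticeP; row_field.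
  - by have := latticePB el s01; congr latticeP; row_field.
  - by have := latticePB el s02; congr latticeP; row_field.
  - by have := l12; congr latticeP; row_field.
have Ve : V1 e by split.
have J := II1_h Ve fs ltac:(by dot_field) ltac:(by dot_field).
have w : dot phi (delta *: (a0 - e)) = c + n%:~R * delta - (c + (n%:~R + 2%:R^-1) * delta).
  by dot_field.
rewrite /II1_at in J; have := genH_shift w J; apply: genH_imp => X.
rewrite /brd.
set x := X + _.
have -> : dot (a0 + a1 - e + (a0 + a2 - e)) x =
    dot (a0 + a1 + a2 + a3 - phi) X + delta / 2%:R.
  rewrite (_ : a0 + a1 - e + (a0 + a2 - e) = a0 *+ 2 + a1 + a2 - e *+ 2); last by row_field.
  by rewrite eE /x; dot_field.
have -> : dot (a0 + a1 - e - (a0 + a2 - e)) x = dot (a1 - a2) X by rewrite /x; dot_field.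
have -> : dot (e + (a0 + a2 - e)) x = dot (a0 + a2) X by rewrite /x; dot_field.
have -> : dot (e + (a0 + a1 - e)) x = dot (a0 + a1) X by rewrite /x; dot_field.
have -> : dot (e - (a0 + a2 - e)) x = dot (phi - a3 - a2) X - delta / 2%:R.
  rewrite (_ : e - (a0 + a2 - e) = e *+ 2 - a0 - a2); last by row_field.
  by rewrite eE /x; dot_field.
have -> : dot (e - (a0 + a1 - e)) x = dot (phi - a3 - a1) X - delta / 2%:R.
  rewrite (_ : e - (a0 + a1 - e) = e *+ 2 - a0 - a1); last by row_field.
  by rewrite eE /x; dot_field.
have -> : x - delta *: e = X + delta *: (a3 - phi).
  rewrite (_ : x - delta *: e = X + delta *: (a0 - e *+ 2)); last by rewrite /x; row_field.
  by rewrite eE; row_field.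
have -> : x + delta *: e = X + delta *: a0 by rewrite /x; row_field.
have E b : x + delta *: (a0 + b - e) = X + delta *: (a0 + b + a3 - phi).
  rewrite (_ : _ + _ *: _ = X + delta *: (a0 *+ 2 + b - e *+ 2)); last by rewrite /x; row_field.
  by rewrite eE; row_field.
rewrite !E.
have -> : x - delta *: (a0 + a1 - e) = X - delta *: a1 by rewrite /x; row_field.
have -> : x - delta *: (a0 + a2 - e) = X - delta *: a2 by rewrite /x; row_field.
move=> H; rewrite [X in X * f _](mulrC (br _)) H; ring.
Qed.

(** After multiplication by the symmetric factor each term of (I) becomes a difference of two
    products of values of [g]; over the three rotations these cancel in pairs. *)
Lemma I_holds : eqI br delta c n g h.
Proof.
move=> a0 a1 a2 /C3_frameP fs p0 p1 p2; apply/meq_H_genH.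
have [a3 f4 p3] := half_frame_extend fs p0 p1 p2.
have /framed4[[a3u a30 a31 a32] /framed3[[u0 u1 u2] [a01 a02 a12]]] := f4.
have f4' : framed [:: a3; a1; a2; a0].
  by apply/framed4; split => //; apply/framed3; split; split => //; exact: frame_pairC.
have f4'' : framed [:: a3; a2; a0; a1].
  by apply/framed4; split => //; apply/framed3; split; split => //; exact: frame_pairC.
have E0 := half_eqII1 f4 p0 p1 p2 p3; have E1 := half_eqII1 f4' p1 p2 p0 p3.
have E2 := half_eqII1 f4'' p2 p0 p1 p3.
have ppK := dot_phi_phi K.
have fn : genH (c + (n%:~R + 2%:R^-1) * delta) (fun X => f (X + delta *: (a3 - phi)) != 0).
  by apply: f_generic; rewrite rmorphB /=; dot_field.
have bn : genH (c + (n%:~R + 2%:R^-1) * delta)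
    (fun X => br (dot (a0 + a1 + a2 + a3 - phi) X + delta / 2%:R) != 0).
  have [[u00 _] [u11 _] [u22 _] [u33 _]] := And4 u0 u1 u2 a3u.
  have [[d30 _] [d31 _] [d32 _]] := And3 a30 a31 a32.
  have [[d01 _] [d02 _] [d12 _]] := And3 a01 a02 a12.
  by apply: genH_br_root; dot_field.
apply: genH_imp (genH_and E0 (genH_and E1 (genH_and E2 (genH_and fn bn)))) => X.
move=> [{}E0 [{}E1 [{}E2 [{}fn {}bn]]]]; rewrite /brd.
rewrite (_ : a1 + a2 + a0 + a3 = a0 + a1 + a2 + a3) in E1; last by row_field.
rewrite (_ : a2 + a0 + a1 + a3 = a0 + a1 + a2 + a3) in E2; last by row_field.
rewrite (addrC a1 a0) in E1; rewrite (addrC a2 a1) (addrC a2 a0) in E2; rewrite (addrC a2 a0).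
apply: (mulfI (mulf_neq0 fn bn)); rewrite mulr0.
move: fn bn E0 E1 E2.
move: (br (_ + _ / _)) (f _) => E F _ _.
move: (g (X + delta *: (a0 + a1 + _ - _))) (g (X + delta *: (a0 + a2 + _ - _))).
move: (g (X + delta *: (a1 + a2 + _ - _))) (g (X - delta *: a0)) (g (X - delta *: a1)) (g (X - delta *: a2)).
move: (h (X + delta *: a0)) (h (X + delta *: a1)) (h (X + delta *: a2)).
move: (br (_ - delta / _)) (br (_ - delta / _)) (br (_ - delta / _)).
move: (br (dot (a0 + a1) X)) (br (dot (a0 + a2) X)) (br (dot (a1 + a2) X)).
move: (br (dot (a1 - a2) X)) (br (dot (a2 - a0) X)) (br (dot (a0 - a1) X)).
move=> m12 m20 m01 s01 s02 s12 q2 q1 q0 h0 h1 h2 k12 g0 g1 g2 k01 k02 E0 E1 E2.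
rewrite [LHS](_ : _ = s12 * g0 * (m12 * E * F * h0) + s02 * g1 * (m20 * E * F * h1)
  + s01 * g2 * (m01 * E * F * h2)); last by ring.
by rewrite E0 E1 E2; ring.
Qed.

(** This is (C2) on the frame of the p/2 - e_i, in the point X - (delta/2)p, so that [h] is
    evaluated at X - delta e_i. *)
Lemma zero_eqI p e1 e2 e3 : framed [:: e1; e2; e3] ->
  dot phi e1 = 0 -> dot phi e2 = 0 -> dot phi e3 = 0 ->
  latticeP p -> dot p p = 2%:R -> dot p phi = 1 ->
  [/\ dot p e1 = 2%:R^-1, dot p e2 = 2%:R^-1 & dot p e3 = 2%:R^-1] ->
  genH (c + (n + 1)%:~R * delta) (fun X =>
    br (dot (p - e2 - e3) X - delta / 2%:R) * br (dot (e3 - e2) X) *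
      g (X + delta *: (e1 - p)) * h (X - delta *: e1) +
    br (dot (p - e3 - e1) X - delta / 2%:R) * br (dot (e1 - e3) X) *
      g (X + delta *: (e2 - p)) * h (X - delta *: e2) +
    br (dot (p - e1 - e2) X - delta / 2%:R) * br (dot (e2 - e1) X) *
      g (X + delta *: (e3 - p)) * h (X - delta *: e3) = 0).
Proof.
move=> /framed3[[u1 u2 u3] [a12 a13 a23]] p1 p2 p3 pP pp pphi [pe1 pe2 pe3].
have s12 := frame_pair_add u2 a12; have s13 := frame_pair_add u3 a13.
have s23 := frame_pair_add u3 a23.
have [u11 l1] := u1; have [u22 l2] := u2; have [u33 l3] := u3.
have [d12 l12] := a12; have [d13 l13] := a13; have [d23 l23] := a23.
clear a12 a13 a23 u1 u2 u3.
have fs : framed [:: 2%:R^-1 *: p - e1; 2%:R^-1 *: p - e2; 2%:R^-1 *: p - e3].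
  apply/framed3; split; split; split; try by dot_field.
  - have := latticePB pP l1; congr latticeP; row_field.
  - have := latticePB pP l2; congr latticeP; row_field.
  - have := latticePB pP l3; congr latticeP; row_field.
  - have := latticePB s12 l1; congr latticeP; row_field.
  - have := latticePB s13 l1; congr latticeP; row_field.
  - have := latticePB s23 l2; congr latticeP; row_field.
have w : dot phi (- (delta / 2%:R) *: p) =
    c + (n%:~R + 2%:R^-1) * delta - (c + (n + 1)%:~R * delta).
  by rewrite rmorphD /=; dot_field.
have := I_holds (proj2 (C3_frameP _ _ _) fs) ltac:(by dot_field) ltac:(by dot_field)
  ltac:(by dot_field).
move=> /meq_H_genH /(genH_shift w); apply: genH_imp => X.
rewrite /brd; set x := X + _.
have E a b : dot p a = 2%:R^-1 -> dot p b = 2%:R^-1 ->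
    dot (2%:R^-1 *: p - a + (2%:R^-1 *: p - b)) x = dot (p - a - b) X - delta / 2%:R.
  by move=> pa pb; rewrite /x; dot_field.
have E' a b : dot p a = 2%:R^-1 -> dot p b = 2%:R^-1 ->
    dot (2%:R^-1 *: p - a - (2%:R^-1 *: p - b)) x = dot (b - a) X.
  by move=> pa pb; rewrite /x; dot_field.
have G a : x - delta *: (2%:R^-1 *: p - a) = X + delta *: (a - p) by rewrite /x; row_field.
have G' a : x + delta *: (2%:R^-1 *: p - a) = X - delta *: a by rewrite /x; row_field.
by rewrite !E // !E' // !G !G'.
Qed.

(** * Instances of the type-one equation used for (C3) *)

Section ZeroFrame.
Variables (e4 r : 'rV[K]_8).

(** Both this vector and its reflection [zero_p - r] in the root [r] have product 1 with [phi] and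
    1/2 with each e_i, as [zero_eqI] requires. *)
Definition zero_p e1 e2 e3 : 'rV[K]_8 := 2%:R^-1 *: (phi + (e1 + e2 + e3 + e4) + r).

Definition zero_data e1 e2 e3 : Prop :=
  [/\ framed [:: e4; e1; e2; e3],
    [/\ dot phi e1 = 0, dot phi e2 = 0, dot phi e3 = 0 & dot phi e4 = 0],
    [/\ latticeP r, dot r r = 2%:R & dot r phi = 0],
    [/\ dot r e1 = 0, dot r e2 = 0, dot r e3 = 0 & dot r e4 = 0] &
    latticeP (zero_p e1 e2 e3)].

Lemma zero_data_rot e1 e2 e3 : zero_data e1 e2 e3 -> zero_data e2 e3 e1.
Proof.
move=> [/framed4[[u4 a41 a42 a43] /framed3[[u1 u2 u3] [a12 a13 a23]]] [p1 p2 p3 p4] hr [r1 r2 r3 r4] pP].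
split => //; last by move: pP; congr latticeP; rewrite /zero_p; row_field.
by apply/framed4; split => //; apply/framed3; split; split => //; exact: frame_pairC.
Qed.

(** This is (II_1) at e = (phi + e1 + e4)/2 with p - e and p - r - e, in the point X + delta(e1 -
    e). The factor [(r|X)] f(X - delta(phi + e4)) does not involve [e1], [e2], [e3]. *)
Lemma zero_eqII1 e1 e2 e3 : zero_data e1 e2 e3 ->
  genH (c + (n + 1)%:~R * delta) (fun X =>
    br (dot r X) * br (dot (e2 + e3) X) * f (X - delta *: (phi + e4)) * h (X + delta *: e1) =
    br (dot (zero_p e1 e2 e3 - r) X - delta / 2%:R) *
      br (dot (zero_p e1 e2 e3 - e2 - e3) X - delta / 2%:R) *
      (g (X + delta *: (e1 - zero_p e1 e2 e3)) *
       g (X + delta *: (zero_p e1 e2 e3 - phi - e4))) -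
    br (dot (zero_p e1 e2 e3) X - delta / 2%:R) *
      br (dot (zero_p e1 e2 e3 - r - e2 - e3) X - delta / 2%:R) *
      (g (X + delta *: (e1 - zero_p e1 e2 e3 + r)) *
       g (X + delta *: (zero_p e1 e2 e3 - r - phi - e4)))).
Proof.
move=> [/framed4[[u4 a41 a42 a43] /framed3[[u1 u2 u3] [a12 a13 a23]]] [p1 p2 p3 p4]
  [rP rr rp] [r1 r2 r3 r4] pP].
have ppK := dot_phi_phi K; have phiP := latticeP_phi K.
have s41 := frame_pair_add u1 a41; have s23 := frame_pair_add u3 a23.
have [u11 l1] := u1; have [u22 l2] := u2; have [u33 l3] := u3; have [u44 l4] := u4.
have [d41 l41] := a41; have [d42 l42] := a42; have [d43 l43] := a43.
have [d12 l12] := a12; have [d13 l13] := a13; have [d23 l23] := a23.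
clear a41 a42 a43 a12 a13 a23 u1 u2 u3 u4.
set p := zero_p e1 e2 e3 in pP *.
have pE : p = 2%:R^-1 *: (phi + (e1 + e2 + e3 + e4) + r) by [].
have pp : dot p p = 2%:R by rewrite pE; dot_field.
have pphi : dot p phi = 1 by rewrite pE; dot_field.
have pe1 : dot p e1 = 2%:R^-1 by rewrite pE; dot_field.
have pe2 : dot p e2 = 2%:R^-1 by rewrite pE; dot_field.
have pe3 : dot p e3 = 2%:R^-1 by rewrite pE; dot_field.
have pe4 : dot p e4 = 2%:R^-1 by rewrite pE; dot_field.
have pr : dot p r = 1 by rewrite pE; dot_field.
have rE : r = p *+ 2 - phi - (e1 + e2 + e3 + e4) by rewrite pE; row_field.
clearbody p.
pose e := 2%:R^-1 *: (phi + e1 + e4).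
have ee : dot e e = 1 by rewrite /e; dot_field.
have eP : dot phi e = 1 by rewrite /e; dot_field.
have ee1 : dot e e1 = 2%:R^-1 by rewrite /e; dot_field.
have ee2 : dot e e2 = 0 by rewrite /e; dot_field.
have ee3 : dot e e3 = 0 by rewrite /e; dot_field.
have ee4 : dot e e4 = 2%:R^-1 by rewrite /e; dot_field.
have er : dot e r = 0 by rewrite /e; dot_field.
have ep : dot e p = 1 by rewrite /e; dot_field.
have eE : e *+ 2 = phi + e1 + e4 by rewrite /e; row_field.
have el : latticeP (e *+ 2).
  by rewrite eE; have := latticePD phiP s41; congr latticeP; row_field.
clearbody e.
have fs : framed [:: e; p - e; p - r - e].
  apply/framed3; split; split; split; try by dot_field.
  - by [].
  - by have := latticePB (latticePD pP pP) el; congr latticeP; row_field.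
  - have := latticePB (latticePB (latticePD pP pP) (latticePD rP rP)) el; congr latticeP; row_field.
  - by have := latticePB el pP; congr latticeP; row_field.
  - by have := latticePD (latticePB el pP) rP; congr latticeP; row_field.
  - by have := rP; congr latticeP; row_field.
have Ve : V1 e by split.
have J := II1_h Ve fs ltac:(by dot_field) ltac:(by dot_field).
have w : dot phi (delta *: (e1 - e)) = c + n%:~R * delta - (c + (n + 1)%:~R * delta).
  by rewrite rmorphD /=; dot_field.
rewrite /II1_at in J; have := genH_shift w J; apply: genH_imp => X.
rewrite /brd.
set x := X + _.
have -> : dot (p - e + (p - r - e)) x = dot (e2 + e3) X.
  rewrite (_ : p - e + (p - r - e) = e2 + e3); first by rewrite /x; dot_field.
  rewrite (_ : p - e + (p - r - e) = p *+ 2 - r - e *+ 2); last by row_field.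
  by rewrite eE {1}rE; row_field.
have -> : dot (p - e - (p - r - e)) x = dot r X.
  by rewrite (_ : p - e - (p - r - e) = r); [rewrite /x; dot_field | row_field].
have -> : dot (e + (p - r - e)) x = dot (p - r) X - delta / 2%:R by rewrite /x; dot_field.
have -> : dot (e + (p - e)) x = dot p X - delta / 2%:R by rewrite /x; dot_field.
have -> : dot (e - (p - r - e)) x = dot (p - e2 - e3) X - delta / 2%:R.
  rewrite (_ : e - (p - r - e) = p - e2 - e3); first by rewrite /x; dot_field.
  rewrite (_ : e - (p - r - e) = e *+ 2 + r - p); last by row_field.
  by rewrite eE {1}rE; row_field.
have -> : dot (e - (p - e)) x = dot (p - r - e2 - e3) X - delta / 2%:R.
  rewrite (_ : e - (p - e) = p - r - e2 - e3); first by rewrite /x; dot_field.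
  rewrite (_ : e - (p - e) = e *+ 2 - p); last by row_field.
  by rewrite eE {1}rE; row_field.
have -> : x - delta *: e = X - delta *: (phi + e4).
  rewrite (_ : x - delta *: e = X + delta *: (e1 - e *+ 2)); last by rewrite /x; row_field.
  by rewrite eE; row_field.
have -> : x + delta *: e = X + delta *: e1 by rewrite /x; row_field.
have E b : x + delta *: (b - e) = X + delta *: (b - phi - e4).
  rewrite (_ : _ + _ *: _ = X + delta *: (e1 + b - e *+ 2)); last by rewrite /x; row_field.
  by rewrite eE; row_field.
rewrite !E.
have -> : x - delta *: (p - e) = X + delta *: (e1 - p) by rewrite /x; row_field.
have -> : x - delta *: (p - r - e) = X + delta *: (e1 - p + r) by rewrite /x; row_field.
move=> H; rewrite [X in X * f _](mulrC (br _)) H; ring.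
Qed.

End ZeroFrame.

(** [zero_eqII1] and its rotations express each h(X + delta e_i) through [g]. Multiplied by h(X -
    delta e_i) and summed, the right-hand sides regroup into two multiples of [zero_eqI], one at [p]
    and one at p - r. *)
Lemma II0_holds : eqII0 br delta c (n + 1) h.
Proof.
move=> e1 e2 e3 /C3_frameP fs p1 p2 p3; apply/meq_H_genH.
have [e4 [r [f4 p4 rh rhe pP]]] := zero_frame_extend fs p1 p2 p3.
have D1 : zero_data e4 r e1 e2 e3 by split.
have D2 := zero_data_rot D1; have D3 := zero_data_rot D2.
have E1 := zero_eqII1 D1; have E2 := zero_eqII1 D2; have E3 := zero_eqII1 D3.
have P2 : zero_p e4 r e2 e3 e1 = zero_p e4 r e1 e2 e3 by rewrite /zero_p; row_field.
have P3 : zero_p e4 r e3 e1 e2 = zero_p e4 r e1 e2 e3 by rewrite /zero_p; row_field.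
rewrite P2 in E2; rewrite P3 in E3; rewrite -[2%:R^-1 *: _]/(zero_p e4 r e1 e2 e3) in pP.
have ppK := dot_phi_phi K.
have [rP rr rp] := rh; have [r1 r2 r3 r4] := rhe.
have [pp pphi pr [pe1 pe2 pe3]] : [/\ dot (zero_p e4 r e1 e2 e3) (zero_p e4 r e1 e2 e3) = 2%:R,
    dot (zero_p e4 r e1 e2 e3) phi = 1, dot (zero_p e4 r e1 e2 e3) r = 1 &
    [/\ dot (zero_p e4 r e1 e2 e3) e1 = 2%:R^-1, dot (zero_p e4 r e1 e2 e3) e2 = 2%:R^-1 &
        dot (zero_p e4 r e1 e2 e3) e3 = 2%:R^-1]].
  have /framed4[[[u44 _] [d41 _] [d42 _] [d43 _]]
    /framed3[[[u11 _] [u22 _] [u33 _]] [[d12 _] [d13 _] [d23 _]]]] := f4.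
  by split; last split; rewrite /zero_p; dot_field.
move: (zero_p e4 r e1 e2 e3) pP pp pphi pr pe1 pe2 pe3 E1 E2 E3 => p pP pp pphi pr pe1 pe2 pe3 E1 E2 E3.
clear D1 D2 D3 P2 P3.
have J := zero_eqI fs p1 p2 p3 pP pp pphi (And3 pe1 pe2 pe3).
have J' := zero_eqI fs p1 p2 p3 (latticePB pP rP) ltac:(by dot_field) ltac:(by dot_field)
  ltac:(by split; dot_field).
have fn : genH (c + (n + 1)%:~R * delta) (fun X => f (X + - (delta *: (phi + e4))) != 0).
  by apply: f_generic; rewrite rmorphB rmorphD /=; dot_field.
have bn : genH (c + (n + 1)%:~R * delta) (fun X => br (dot r X + 0) != 0).
  by apply: genH_br_root => //; dot_field.
apply: genH_imp (genH_and E1 (genH_and E2 (genH_and E3 (genH_and J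
  (genH_and J' (genH_and fn bn)))))) => X.
move=> [{}E1 [{}E2 [{}E3 [{}J [{}J' [{}fn]]]]]]; rewrite addr0 /brd => {}bn.
have S e : e - (p - r) = e - p + r by row_field.
rewrite !S in J'.
have N e e' : br (dot (e - e') X) = - br (dot (e' - e) X) by rewrite -br_opp -dotNl opprB.
rewrite (N e2 e3) (N e3 e1) (N e1 e2).
apply: (mulfI (mulf_neq0 bn fn)); rewrite mulr0.
move: J J' E1 E2 E3; clear.
move: (br (dot r X)) (f _) (br (dot (e2 + e3) X)) (br (dot (e3 + e1) X)) (br (dot (e1 + e2) X)).
move: (br (dot (e3 - e2) X)) (br (dot (e1 - e3) X)) (br (dot (e2 - e1) X)).
move: (br (dot p X - _)) (br (dot (p - r) X - _)).
move: (br (dot (p - e2 - e3) X - _)) (br (dot (p - e3 - e1) X - _)) (br (dot (p - e1 - e2) X - _)).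
move: (br (dot (p - r - e2 - e3) X - _)) (br (dot (p - r - e3 - e1) X - _)) (br (dot (p - r - e1 - e2) X - _)).
move: (g (X + delta *: (e1 - p))) (g (X + delta *: (e2 - p))) (g (X + delta *: (e3 - p))).
move: (g (X + delta *: (e1 - p + r))) (g (X + delta *: (e2 - p + r))) (g (X + delta *: (e3 - p + r))).
move: (g _) (g _) (h (X + delta *: e1)) (h (X + delta *: e2)) (h (X + delta *: e3)).
move: (h _) (h _) (h _) => h3' h2' h1' G1 G2 h1 h2 h3 g1' g2' g3' g1 g2 g3 q1' q2' q3' q1 q2 q3 Ap Apr.
move=> m1 m2 m3 R F s1 s2 s3 J J' E1 E2 E3.
rewrite [LHS](_ : _ = - (R * s1 * F * h1) * (m1 * h1') - (R * s2 * F * h2) * (m2 * h2')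
  - (R * s3 * F * h3) * (m3 * h3')); last by ring.
rewrite E1 E2 E3.
rewrite [LHS](_ : _ = Ap * G1 * (q1' * m1 * g1' * h1' + q2' * m2 * g2' * h2' + q3' * m3 * g3' * h3')
  - Apr * G2 * (q1 * m1 * g1 * h1' + q2 * m2 * g2 * h2' + q3 * m3 * g3 * h3')); last by ring.
by rewrite J J' !mulr0 subrr.
Qed.

End Consequences.

End TauFunctions.

Theorem theorem3p3 (R : realType) (br : R[i] -> R[i])
  (br_entire : entire br)
  (br_neq0 : exists z, br z != 0)
  (br_three_term : three_term br)
  (delta : R[i]) (delta_neq0 : delta != 0)
  (delta_Omega :
     [set k%:~R * delta | k in [set: int]] `&` [set omega | br omega = 0]
     = [set 0])
  (c : R[i]) (n : int) (tau_prev tau_cur : 'rV[R[i]]_8 -> R[i])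
  (mero_prev : meromorphic_H (c + (n - 1)%:~R * delta) tau_prev)
  (mero_cur : meromorphic_H (c + n%:~R * delta) tau_cur)
  (prev_neq0 : ~ meq_H (c + (n - 1)%:~R * delta) tau_prev (fun=> 0))
  (A1 : eqI br delta c (n - 1) tau_prev tau_cur)
  (A2 : eqII0 br delta c n tau_cur) :
  exists tau_next : 'rV[R[i]]_8 -> R[i],
    [/\ meromorphic_H (c + (n + 1)%:~R * delta) tau_next,
        eqII1 br delta c n tau_prev tau_cur tau_next,
        forall sigma : 'rV[R[i]]_8 -> R[i],
          meromorphic_H (c + (n + 1)%:~R * delta) sigma ->
          eqII1 br delta c n tau_prev tau_cur sigma ->
          meq_H (c + (n + 1)%:~R * delta) sigma tau_next &
        [/\ eqII2 br delta c n tau_prev tau_cur tau_next,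
            eqI br delta c n tau_cur tau_next &
            eqII0 br delta c (n + 1) tau_next]].
Proof.
have V : vanishing_principle R[i] by exact: complex_vanishing.
have C : unit_interval_connected R[i] by exact: complex_unit_interval_connected.
have [h [a [x [y [mero_h Va fs [px py] Hh]]]]] :=
  II1_solution V C br_entire br_neq0 mero_prev mero_cur prev_neq0.
have good := II1_good_all V C br_entire br_neq0 br_three_term mero_prev prev_neq0 A1 A2 Va
  (II1_good_intro V C br_entire br_neq0 br_three_term A2 Va fs px py Hh).
exists h; split => //.
- exact/eqII1P.
- move=> sigma _ /eqII1P Hs.
  have xy : exists x y, [/\ framed [:: a; x; y], dot phi x = 0 & dot phi y = 0] by exists x, y.
  exact: (II1_good_unique V C br_entire br_neq0 mero_prev prev_neq0 Va (Hs a Va) (good a Va) xy).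
split.
- exact: (II2_holds V C br_entire br_neq0 br_three_term good).
- exact: (I_holds V C br_entire br_neq0 mero_prev prev_neq0 good).
- exact: (II0_holds V C br_entire br_neq0 br_three_term mero_prev prev_neq0 good).
Qed.
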